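(* Let $A\subset\mathbb A$ be an essential thin annular continuum. Then: (1) if $A$ is not compactly generated, then either (1a) $C_A$ is not compactly generated, or (1b) $C_A$ is compactly generated and $A$ contains an infinite spike; (2) if $A$ is compactly generated, then so is $C_A$.
   Context: $\mathbb A=\mathbb S^1\times\mathbb R$, $\pi:\mathbb R^2\to\mathbb A$ the projection, $T(x,y)=(x+1,y)$. For $B$ bounded above (resp. below), $\mathcal U^+(B)$ (resp. $\mathcal U^-(B)$) is the connected component of the complement unbounded above (resp. below); same notation in $\mathbb R^2$. A continuum $A\subset\mathbb A$ is an essential annular continuum if $\mathbb A\setminus A$ consists of exactly two connected components $\mathcal U^+(A),\mathcal U^-(A)$, unbounded above resp. below; it is a circloid if it contains no other essential annular continuum strictly; thin means empty interior. For thin $A$, $C_A=\overline{\mathcal U^+(A)}\cap\overline{\mathcal U^-(A)}$ is the unique circloid contained in $A$. Write $\hat A=\pi^{-1}(A)$, $C_{\hat A}=\pi^{-1}(C_A)$. $A$ is compactly generated if there is a compact connected $G_0\subset\hat A$ with $\hat A=\bigcup_{n\in\mathbb Z}T^n(G_0)$. For $X\subset\mathbb R^2$, $h(X)=\sup\{x_1-x_2:(x_1,y_1),(x_2,y_2)\in X\}$. The spikes of $A$ are the connected components of $\hat A\setminus C_{\hat A}$; an infinite spike is a spike $S$ with $h(S)=\infty$. *)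

(* Defs.v *)
From Stdlib Require Import Reals List.
Open Scope R_scope.

(* Points of R^2. The annulus A = S^1 x R is modelled through the projection
   pi : R^2 -> A: a subset of A is represented by its full preimage under pi,
   i.e. by a T-invariant subset of R^2, where T(x,y) = (x+1,y). *)
Definition pt := (R * R)%type.
Definition pset := pt -> Prop.

Definition T (p : pt) : pt := (fst p + 1, snd p).

Definition Tinv (P : pset) : Prop := forall p, P p <-> P (T p).

Definition open2 (U : pset) : Prop :=
  forall p, U p -> exists eps, 0 < eps /\
    forall q, (fst q - fst p)^2 + (snd q - snd p)^2 < eps^2 -> U q.

(* Open sets of the annulus = preimages of opens under pi
   = T-invariant open subsets of R^2 (quotient topology). *)
Definition openA (U : pset) : Prop := open2 U /\ Tinv U.

Definition connected_in (O : pset -> Prop) (S : pset) : Prop :=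
  ~ exists U V, O U /\ O V /\
      (forall p, S p -> U p \/ V p) /\
      (exists p, S p /\ U p) /\ (exists p, S p /\ V p) /\
      (forall p, S p -> U p -> V p -> False).

Definition compact_in (O : pset -> Prop) (S : pset) : Prop :=
  forall (I : Type) (F : I -> pset),
    (forall i, O (F i)) -> (forall p, S p -> exists i, F i p) ->
    exists l : list I, forall p, S p -> exists i, In i l /\ F i p.

Definition closure_in (O : pset -> Prop) (S : pset) (p : pt) : Prop :=
  forall U, O U -> U p -> exists q, U q /\ S q.

Definition subset (P Q : pset) : Prop := forall p, P p -> Q p.

Definition component2 (X C : pset) : Prop :=
  subset C X /\ (exists p, C p) /\ connected_in open2 C /\
  forall D, subset D X -> connected_in open2 D -> subset C D -> subset D C.

Definition componentA (X C : pset) : Prop :=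
  Tinv C /\ subset C X /\ (exists p, C p) /\ connected_in openA C /\
  forall D, Tinv D -> subset D X -> connected_in openA D -> subset C D -> subset D C.

Definition unb_above (C : pset) : Prop := forall M, exists p, C p /\ snd p > M.
Definition unb_below (C : pset) : Prop := forall M, exists p, C p /\ snd p < M.

Definition complA (A : pset) : pset := fun p => ~ A p.

Definition continuumA (A : pset) : Prop :=
  Tinv A /\ (exists p, A p) /\ compact_in openA A /\ connected_in openA A.

Definition essential_annular (A : pset) : Prop :=
  continuumA A /\
  exists Up Um, componentA (complA A) Up /\ componentA (complA A) Um /\
    unb_above Up /\ unb_below Um /\ ~ (forall p, Up p <-> Um p) /\
    forall C, componentA (complA A) C ->
      (forall p, C p <-> Up p) \/ (forall p, C p <-> Um p).

Definition thin (A : pset) : Prop :=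
  forall U, openA U -> subset U A -> forall p, ~ U p.

(* C_A = closure(U^+(A)) /\ closure(U^-(A)) (closures in the annulus),
   given as a T-invariant set, i.e. directly as its lift C_{\hat A}. *)
Definition CA (A : pset) : pset := fun p =>
  exists Up Um, componentA (complA A) Up /\ unb_above Up /\
    componentA (complA A) Um /\ unb_below Um /\
    closure_in openA Up p /\ closure_in openA Um p.

Definition compactly_generated (A : pset) : Prop :=
  exists G0 : pset, subset G0 A /\ compact_in open2 G0 /\ connected_in open2 G0 /\
    forall p, A p <-> exists n : Z, G0 (fst p - IZR n, snd p).

Definition spike (A S : pset) : Prop :=
  component2 (fun p => A p /\ ~ CA A p) S.

Definition infinite_width (S : pset) : Prop :=
  forall M, exists p q, S p /\ S q /\ fst p - fst q > M.

(* Main.v *)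
Require Import Defs.
From Stdlib Require Import Reals ZArith List Lra Lia Bool Classical ClassicalEpsilon.
Open Scope R_scope.

(* The only input from plane topology is that every double cover of the plane is trivial, proved by
   gluing local sections over rectangles. Fix [a], [b] and the double cover branched at [a] and [b].
   For a closed set [X] missing [a] and [b] (and infinity), the cover is trivial over [X] exactly when
   [X] does not separate [a] from [b] (Eilenberg's criterion); Janiszewski's theorem follows by gluing sections.

   Let [Up], [Um] be the lifts of the complementary components of [A]. Since [A] is thin, they are
   dense in the open sets [off Um], [off Up], which are the two sides of the core, the lift of [C_A].

   (2) If [K] is a continuum in the lift of [A], then its intersection with the core is connected: otherwise pick
   [m], [n] in two separated pieces of it. The cover branched at [m] and [n] is trivial off [K] and on both
   sides of the core, and by density these trivializations agree, so the cover is trivial on a curve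
   around the piece of [m], which is absurd. Hence a generator of [A] cuts the core in a generator.

   (1) Let the core be generated by a continuum. It is enough to bound the width of the continua in [A]
   off the core. Suppose there are arbitrarily wide ones [B] above the core, and that no spike is
   infinite. The spike of a wide [B] reaches the core, so a much wider [B'] must pass over
   translates of it; near the core [B'] cannot do so, hence some deep piece of [B'] is caught between [B] and infinity
   and is about as wide as [B]. Nesting such pieces at decreasing depths and passing
   to a limit gives an infinite spike. *)

(** * Topology of the plane *)

(** A double cover is encoded by Boolean local trivializations, so that its triviality is a
    statement about locally constant functions and neither angles nor path lifting occur. Branching
    at two points makes the cover trivial around infinity, so closed unbounded sets can be handled
    as if they contained infinity. The obstacle in (1) is that a limit of wide continua off the core
    may fall into the core. Hence the depth of the pieces caught in [B'] may depend on the wanted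
    width, but not on [B']: it is taken from one fixed [B] and two escape paths from its ends to the
    top, all compact and so at positive distance from [cl Um]. Compact generation of the core enters
    through its tails, unions of consecutive translates of a generator that meets its own translate.
    They are connected; they prolong [B'] to infinity on both sides, and they make connected the
    intersection to which Janiszewski's theorem is applied for the escape paths. Continua below the
    core are treated by reflection. *)

Definition near (e : R) (p q : pt) : Prop :=
  Rabs (fst q - fst p) < e /\ Rabs (snd q - snd p) < e.

Definition opn (U : pset) : Prop :=
  forall p, U p -> exists e, 0 < e /\ forall q, near e p q -> U q.

Definition closed (S : pset) : Prop := opn (fun p => ~ S p).

Definition cl (S : pset) : pset := fun p => forall e, 0 < e -> exists q, near e p q /\ S q.

(* [phi p] is a local trivialization, near [p], of a double cover; a section [f] of the cover is a
   function that differs from each [phi p] by a constant near [p]. *)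
Definition sec (phi : pt -> pt -> bool) (D : pset) (f : pt -> bool) : Prop :=
  forall p, D p -> exists e, 0 < e /\
    forall q, D q -> near e p q -> xorb (f q) (phi p q) = xorb (f p) (phi p p).

Definition locc (S : pset) (f : pt -> bool) : Prop :=
  forall p, S p -> exists e, 0 < e /\ forall q, S q -> near e p q -> f q = f p.

(** Connectedness is tested on Boolean functions because the difference of two sections of a double
    cover is a locally constant function of this kind. *)
Definition conn (S : pset) : Prop :=
  forall f, locc S f -> forall p q, S p -> S q -> f p = f q.

Definition bounded (S : pset) : Prop :=
  exists M, forall p, S p -> Rabs (fst p) <= M /\ Rabs (snd p) <= M.

Definition cpt (S : pset) : Prop := closed S /\ bounded S.

Lemma Rabs_le_between x a : Rabs x <= a -> - a <= x <= a.
Proof. unfold Rabs; destruct Rcase_abs; lra. Qed.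

Lemma near_refl e p : 0 < e -> near e p p.
Proof. intros; split; rewrite Rminus_diag, Rabs_R0; auto. Qed.

Lemma near_sym e p q : near e p q -> near e q p.
Proof. intros [H1 H2]; split; rewrite Rabs_minus_sym; auto. Qed.

Lemma near_trans e1 e2 p q r : near e1 p q -> near e2 q r -> near (e1 + e2) p r.
Proof.
  intros [H1 H2] [H3 H4]; apply Rabs_def2 in H1, H2, H3, H4.
  split; apply Rabs_def1; lra.
Qed.

Lemma near_le e1 e2 p q : e1 <= e2 -> near e1 p q -> near e2 p q.
Proof. intros H [H1 H2]; split; lra. Qed.

Lemma near_min_l a b p q : near (Rmin a b) p q -> near a p q.
Proof. apply near_le, Rmin_l. Qed.
Lemma near_min_r a b p q : near (Rmin a b) p q -> near b p q.
Proof. apply near_le, Rmin_r. Qed.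

Lemma near_def e p q : near e p q <->
  (fst p - e < fst q < fst p + e /\ snd p - e < snd q < snd p + e).
Proof.
  split.
  - intros [H1 H2]; apply Rabs_def2 in H1, H2; lra.
  - intros [H1 H2]; split; apply Rabs_def1; lra.
Qed.

Lemma sq_lt_abs x e : 0 < e -> x ^ 2 < e ^ 2 -> - e < x < e.
Proof.
  intros He H. split; apply Rnot_le_lt; intro Hx; assert (0 <= (x - e) * (x + e)); nra.
Qed.

Lemma opn_open2 U : opn U <-> open2 U.
Proof.
  split; intros H p Hp; destruct (H p Hp) as [e [He Hq]].
  - exists e; split; auto. intros q Hd. apply Hq. apply near_def.
    pose proof (pow2_ge_0 (fst q - fst p)). pose proof (pow2_ge_0 (snd q - snd p)).
    assert (Hx : - e < fst q - fst p < e) by (apply sq_lt_abs; lra).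
    assert (Hy : - e < snd q - snd p < e) by (apply sq_lt_abs; lra).
    lra.
  - exists (e / 2); split; [lra|]. intros q Hn. apply Hq.
    apply near_def in Hn.
    assert (- (e/2) < fst q - fst p < e / 2) by lra.
    assert (- (e/2) < snd q - snd p < e / 2) by lra.
    nra.
Qed.

Lemma opn_near e p : opn (near e p).
Proof.
  intros q Hq. apply near_def in Hq.
  set (m := Rmin (Rmin (fst q - (fst p - e)) (fst p + e - fst q))
                 (Rmin (snd q - (snd p - e)) (snd p + e - snd q))).
  assert (Hm : 0 < m) by (unfold m; repeat apply Rmin_glb_lt; lra).
  assert (m <= fst q - (fst p - e) /\ m <= fst p + e - fst q /\
          m <= snd q - (snd p - e) /\ m <= snd p + e - snd q).
  { unfold m. repeat split.
    - eapply Rle_trans; [apply Rmin_l|apply Rmin_l].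
    - eapply Rle_trans; [apply Rmin_l|apply Rmin_r].
    - eapply Rle_trans; [apply Rmin_r|apply Rmin_l].
    - eapply Rle_trans; [apply Rmin_r|apply Rmin_r]. }
  exists m; split; auto. intros r Hr. apply near_def in Hr. apply near_def. lra.
Qed.

Lemma opn_inter U V : opn U -> opn V -> opn (fun p => U p /\ V p).
Proof.
  intros HU HV p [H1 H2].
  destruct (HU p H1) as [e [He Hq]], (HV p H2) as [e' [He' Hq']].
  exists (Rmin e e'); split; [apply Rmin_glb_lt; auto|].
  intros q Hn; split; [apply Hq|apply Hq']; eapply near_le; eauto; [apply Rmin_l|apply Rmin_r].
Qed.

Lemma opn_union U V : opn U -> opn V -> opn (fun p => U p \/ V p).
Proof.
  intros HU HV p [H|H]; [destruct (HU p H) as [e [He Hq]]|destruct (HV p H) as [e [He Hq]]];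
  exists e; split; auto.
Qed.

Lemma opn_Union (J : Type) (F : J -> pset) : (forall j, opn (F j)) -> opn (fun p => exists j, F j p).
Proof.
  intros HF p [j Hj]. destruct (HF j p Hj) as [e [He Hq]]. exists e; split; eauto.
Qed.

Lemma opn_ext U V : (forall p, U p <-> V p) -> opn U -> opn V.
Proof.
  intros E H p Hp. apply E in Hp. destruct (H p Hp) as [e [He Hq]].
  exists e; split; auto. intros; apply E; auto.
Qed.

Lemma closed_ext U V : (forall p, U p <-> V p) -> closed U -> closed V.
Proof. intros E. apply opn_ext. intro p; specialize (E p); tauto. Qed.

Lemma closed_inter U V : closed U -> closed V -> closed (fun p => U p /\ V p).
Proof.
  intros H1 H2. eapply opn_ext; [|apply (opn_union _ _ H1 H2)].
  intro p; simpl; tauto.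
Qed.

Lemma closed_union U V : closed U -> closed V -> closed (fun p => U p \/ V p).
Proof.
  intros H1 H2. eapply opn_ext; [|apply (opn_inter _ _ H1 H2)].
  intro p; simpl; tauto.
Qed.

Lemma closed_compl U : opn U -> closed (fun p => ~ U p).
Proof. apply opn_ext. intro p; tauto. Qed.

Lemma closed_Inter (J : Type) (F : J -> pset) : (forall j, closed (F j)) -> closed (fun p => forall j, F j p).
Proof.
  intros HF. eapply opn_ext; [|apply (opn_Union J (fun j p => ~ F j p) HF)].
  intro p; simpl; split.
  - intros [j Hj] H; auto.
  - intro H. apply not_all_ex_not in H; auto.
Qed.

Lemma closed_cl S : closed (cl S).
Proof.
  intros p Hp. unfold cl in Hp. apply not_all_ex_not in Hp. destruct Hp as [e He].
  apply imply_to_and in He. destruct He as [He Hn].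
  exists (e/2); split; [lra|]. intros q Hq Hc.
  destruct (Hc (e/2)) as [r [Hr HS]]; [lra|]. apply Hn. exists r; split; auto.
  replace e with (e/2+e/2) by lra. eapply near_trans; eauto.
Qed.

Lemma cl_incl (S : pset) p : S p -> cl S p.
Proof. intros H e He; exists p; split; auto; apply near_refl; auto. Qed.

Lemma cl_mono (S S' : pset) : subset S S' -> subset (cl S) (cl S').
Proof. intros H p Hp e He. destruct (Hp e He) as [q [Hq HS]]. exists q; auto. Qed.

Lemma cl_closed (S : pset) p : closed S -> cl S p -> S p.
Proof.
  intros HS Hc. apply NNPP; intro Hn. destruct (HS p Hn) as [e [He Hq]].
  destruct (Hc e He) as [q [H1 H2]]. apply (Hq q); auto.
Qed.

Lemma closed_halfx_le a : closed (fun p => fst p <= a).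
Proof.
  intros p Hp. exists (fst p - a); split; [lra|]. intros q Hq. apply near_def in Hq. lra.
Qed.
Lemma closed_halfx_ge a : closed (fun p => a <= fst p).
Proof.
  intros p Hp. exists (a - fst p); split; [lra|]. intros q Hq. apply near_def in Hq. lra.
Qed.
Lemma closed_halfy_le a : closed (fun p => snd p <= a).
Proof.
  intros p Hp. exists (snd p - a); split; [lra|]. intros q Hq. apply near_def in Hq. lra.
Qed.
Lemma closed_halfy_ge a : closed (fun p => a <= snd p).
Proof.
  intros p Hp. exists (a - snd p); split; [lra|]. intros q Hq. apply near_def in Hq. lra.
Qed.

Definition pred_bool (P : Prop) : bool := if excluded_middle_informative P then true else false.

Lemma pred_bool_true (P : Prop) : P -> pred_bool P = true.
Proof. unfold pred_bool; destruct excluded_middle_informative; tauto. Qed.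
Lemma pred_bool_false (P : Prop) : ~ P -> pred_bool P = false.
Proof. unfold pred_bool; destruct excluded_middle_informative; tauto. Qed.
Lemma pred_bool_iff (P Q : Prop) : (P <-> Q) -> pred_bool P = pred_bool Q.
Proof. unfold pred_bool; repeat (destruct excluded_middle_informative); tauto. Qed.
Lemma pred_boolP (P : Prop) : pred_bool P = true <-> P.
Proof. unfold pred_bool; destruct excluded_middle_informative; split; auto; discriminate. Qed.

Lemma conn_connected S : conn S <-> connected_in open2 S.
Proof.
  split.
  - intros HS [U [V [HU [HV [Hc [[p [Hp1 Hp2]] [[q [Hq1 Hq2]] Hd]]]]]]].
    apply opn_open2 in HU, HV.
    assert (E : pred_bool (U p) = pred_bool (U q)).
    { apply (HS (fun z => pred_bool (U z))); auto.
      intros z Hz. destruct (Hc z Hz) as [H|H].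
      - destruct (HU z H) as [e [He Hn]]. exists e; split; auto.
        intros r Hr Hzr. apply pred_bool_iff. specialize (Hn r Hzr). tauto.
      - destruct (HV z H) as [e [He Hn]]. exists e; split; auto.
        intros r Hr Hzr. apply pred_bool_iff. specialize (Hn r Hzr).
        split; intro; exfalso; [apply (Hd r)|apply (Hd z)]; auto. }
    apply (Hd q Hq1); auto. apply pred_boolP. rewrite <- E. apply pred_boolP; auto.
  - intros HS f Hf.
    assert (Hex : forall b, opn (fun z => exists p e, S p /\ f p = b /\ near e p z /\
              forall q, S q -> near e p q -> f q = b)).
    { intros b. intros z [p [e [H1 [H2 [H3 H4]]]]].
      destruct (opn_near e p z H3) as [e' [He' Hn]].
      exists e'; split; auto. intros q Hq. exists p, e; repeat split; auto; apply Hn; auto. }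
    assert (Hin : forall z, S z -> exists p e, S p /\ f p = f z /\ near e p z /\
              forall q, S q -> near e p q -> f q = f z).
    { intros z Hz. destruct (Hf z Hz) as [e [He Hn]]. exists z, e. repeat split; auto;
      apply near_refl; auto. }
    assert (Hmain : forall p q, S p -> S q -> f p = true -> f q = false -> False).
    { intros p q Hp Hq Ep Eq. apply HS.
      exists (fun z => exists p e, S p /\ f p = true /\ near e p z /\
              forall q, S q -> near e p q -> f q = true),
             (fun z => exists p e, S p /\ f p = false /\ near e p z /\
              forall q, S q -> near e p q -> f q = false).
      split; [apply opn_open2, Hex|]. split; [apply opn_open2, Hex|].
      split; [|split; [|split]].
      - intros z Hz. specialize (Hin z Hz). destruct (f z); auto.
      - exists p; split; auto. rewrite <- Ep. auto.
      - exists q; split; auto. rewrite <- Eq. auto.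
      - intros z Hz [a [e [_ [_ [Ha Hb]]]]] [a' [e' [_ [_ [Ha' Hb']]]]].
        specialize (Hb z Hz Ha). specialize (Hb' z Hz Ha'). congruence. }
    intros p q Hp Hq. destruct (f p) eqn:Ep, (f q) eqn:Eq; auto; exfalso; eauto.
Qed.

Lemma locc_sub (S S' : pset) f : subset S' S -> locc S f -> locc S' f.
Proof.
  intros H Hf p Hp. destruct (Hf p (H p Hp)) as [e [He Hq]]. exists e; auto.
Qed.

Lemma conn_ext S S' : (forall p, S p <-> S' p) -> conn S -> conn S'.
Proof.
  intros E HS f Hf p q Hp Hq. apply HS; try (apply E; auto).
  apply (locc_sub S'); auto. intros z Hz; apply E; auto.
Qed.

Lemma conn_Union (J : Type) (F : J -> pset) c :
  (forall j, conn (F j)) -> (forall j, F j c) -> conn (fun p => exists j, F j p).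
Proof.
  intros H Hc f Hf p q [j Hj] [k Hk].
  assert (forall i z, F i z -> f z = f c).
  { intros i z Hz. apply (H i f); auto. apply (locc_sub (fun p => exists j, F j p)); auto.
    intros r Hr; eauto. }
  rewrite (H0 j p), (H0 k q); auto.
Qed.

Lemma conn_union S S' c : conn S -> conn S' -> S c -> S' c -> conn (fun p => S p \/ S' p).
Proof.
  intros H1 H2 Hc Hc'.
  apply (conn_ext (fun p => exists b : bool, (if b then S else S') p)).
  - intro p; split.
    + intros [[|] H]; auto.
    + intros [H|H]; [exists true|exists false]; auto.
  - apply (conn_Union bool (fun b => if b then S else S') c); intros [|]; auto.
Qed.

Lemma conn_between S S' : conn S -> subset S S' -> subset S' (cl S) -> conn S'.
Proof.
  intros HS H1 H2 f Hf.
  assert (forall p, S' p -> exists q, S q /\ f q = f p).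
  { intros p Hp. destruct (Hf p Hp) as [e [He Hn]].
    destruct (H2 p Hp e He) as [q [Hq HSq]]. exists q; split; auto. }
  intros p q Hp Hq. destruct (H p Hp) as [p' [Hp' <-]], (H q Hq) as [q' [Hq' <-]].
  apply HS; auto. apply (locc_sub S'); auto.
Qed.

Lemma conn_attach S S' : conn S -> subset S S' ->
  (forall p, S' p -> exists L, conn L /\ subset L S' /\ L p /\ exists q, L q /\ S q) -> conn S'.
Proof.
  intros HS H1 H2 f Hf.
  assert (forall p, S' p -> exists q, S q /\ f p = f q).
  { intros p Hp. destruct (H2 p Hp) as [L [HL [HLS [HLp [q [Hq HSq]]]]]].
    exists q; split; auto. apply HL; auto. apply (locc_sub S'); auto. }
  intros p q Hp Hq. destruct (H p Hp) as [p' [Hp' ->]], (H q Hq) as [q' [Hq' ->]].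
  apply HS; auto. apply (locc_sub S'); auto.
Qed.

Lemma conn_point c : conn (fun p => p = c).
Proof. intros f _ p q -> ->; auto. Qed.

(** Compactness of an interval as an induction principle: the supremum of the right ends reached
    from [a] is itself reached, and is passed unless it is [b]. *)
Lemma interval_induction (P : R -> R -> Prop) :
  (forall a b c, a <= c <= b -> P a c -> P c b -> P a b) ->
  (forall x, exists e, 0 < e /\ forall u v, x - e < u -> u <= x -> x <= v -> v < x + e -> P u v) ->
  forall a b, a <= b -> P a b.
Proof.
  intros Hadd Hloc a b Hab.
  set (E := fun z => a <= z <= b /\ P a z).
  assert (Ha : E a).
  { split; [lra|]. destruct (Hloc a) as [e [He H]]. apply H; lra. }
  destruct (completeness E) as [s [Hub Hlub]].
  - exists b. intros z [Hz _]; lra.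
  - exists a; auto.
  - assert (Has : a <= s) by (apply Hub; auto).
    assert (Hsb : s <= b) by (apply Hlub; intros z [Hz _]; lra).
    destruct (Hloc s) as [e [He H]].
    assert (Hz : exists z, E z /\ s - e < z).
    { apply NNPP; intro Hn. assert (s <= s - e); [|lra].
      apply Hlub. intros z Hz. apply Rnot_lt_le. intro. apply Hn. exists z; auto. }
    destruct Hz as [z [Hz1 Hz2]].
    assert (Hzs : z <= s) by (apply Hub; auto).
    assert (Hv : E (Rmin b (s + e/2))).
    { destruct Hz1 as [Hz1 Hz3].
      assert (s <= Rmin b (s + e/2)) by (apply Rmin_glb; lra).
      assert (Rmin b (s+e/2) <= s + e/2) by apply Rmin_r.
      assert (Rmin b (s+e/2) <= b) by apply Rmin_l.
      split; [lra|]. apply (Hadd a _ z); [lra|auto|]. apply H; lra. }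
    assert (Hvs := Hub _ Hv). unfold Rmin in *. destruct (Rle_dec b (s+e/2)); [|lra].
    destruct Hv; auto.
Qed.

Lemma rectangle_induction (Q : R -> R -> R -> R -> Prop) :
  (forall a b m c d, a <= m <= b -> c <= d -> Q a m c d -> Q m b c d -> Q a b c d) ->
  (forall a b c d m, a <= b -> c <= m <= d -> Q a b c m -> Q a b m d -> Q a b c d) ->
  (forall x y, exists e, 0 < e /\ forall a b c d, x - e < a <= x -> x <= b < x + e ->
     y - e < c <= y -> y <= d < y + e -> Q a b c d) ->
  forall a b c d, a <= b -> c <= d -> Q a b c d.
Proof.
  intros Hh Hv Hl a b c d Hab Hcd.
  apply (interval_induction (fun c d => c <= d -> Q a b c d)); auto.
  - intros u v w Hw H1 H2 _. apply (Hv a b u v w); auto; [apply H1|apply H2]; lra.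
  - intros y.
    (* The tube lemma, by induction over the width: one height [e] serves the whole of [[a, b]]. *)
    assert (H : exists e, 0 < e /\ forall u v, y - e < u <= y -> y <= v < y + e -> Q a b u v).
    { apply (interval_induction (fun a b => a <= b -> exists e, 0 < e /\
         forall u v, y - e < u <= y -> y <= v < y + e -> Q a b u v)); auto.
      - intros p q r Hr H1 H2 _.
        destruct H1 as [e1 [He1 H1]]; [lra|]. destruct H2 as [e2 [He2 H2]]; [lra|].
        exists (Rmin e1 e2). split; [apply Rmin_glb_lt; auto|].
        intros u v Hu Hv'. assert (Rmin e1 e2 <= e1) by apply Rmin_l.
        assert (Rmin e1 e2 <= e2) by apply Rmin_r.
        apply (Hh p q r); [lra|lra|apply H1; lra|apply H2; lra].
      - intros x. destruct (Hl x y) as [e [He H]]. exists e; split; auto.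
        intros p q H1 H2 H3 H4 _. exists e; split; auto. }
    destruct H as [e [He H]]. exists e; split; auto.
Qed.

Definition seg (p q : pt) (t : R) : pt := (fst p + t * (fst q - fst p), snd p + t * (snd q - snd p)).
Definition segment (p q : pt) : pset := fun z => exists t, 0 <= t <= 1 /\ z = seg p q t.

Lemma seg0 p q : seg p q 0 = p.
Proof. destruct p, q; unfold seg; simpl; f_equal; ring. Qed.
Lemma seg1 p q : seg p q 1 = q.
Proof. destruct p, q; unfold seg; simpl; f_equal; ring. Qed.

Lemma seg_near p q e : 0 < e -> exists d, 0 < d /\
  forall t u, Rabs (u - t) < d -> near e (seg p q t) (seg p q u).
Proof.
  intro He. set (M := Rabs (fst q - fst p) + Rabs (snd q - snd p) + 1).
  assert (H1 := Rabs_pos (fst q - fst p)). assert (H2 := Rabs_pos (snd q - snd p)).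
  assert (HM : 0 < M) by (unfold M; lra).
  exists (e / M). split; [apply Rdiv_lt_0_compat; auto|].
  intros t u Ht.
  assert (Hb : Rabs (u - t) * M < e).
  { apply (Rmult_lt_compat_r M) in Ht; auto. unfold Rdiv in Ht.
    rewrite Rmult_assoc, Rinv_l in Ht; lra. }
  assert (H3 := Rabs_pos (u - t)).
  unfold near, seg; simpl. split.
  - replace (fst p + u * (fst q - fst p) - (fst p + t * (fst q - fst p)))
      with ((u - t) * (fst q - fst p)) by ring.
    rewrite Rabs_mult. unfold M in Hb. nra.
  - replace (snd p + u * (snd q - snd p) - (snd p + t * (snd q - snd p)))
      with ((u - t) * (snd q - snd p)) by ring.
    rewrite Rabs_mult. unfold M in Hb. nra.
Qed.

(** Retraction onto the unit interval: it extends a function on a segment to the whole line, where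
    [interval_induction] requires its local hypothesis. *)
Definition clamp (t : R) : R := Rmax 0 (Rmin 1 t).
Lemma clamp_range t : 0 <= clamp t <= 1.
Proof. unfold clamp, Rmax, Rmin; repeat (destruct Rle_dec); lra. Qed.
Lemma clamp_id t : 0 <= t <= 1 -> clamp t = t.
Proof. unfold clamp, Rmax, Rmin; repeat (destruct Rle_dec); lra. Qed.
Lemma clamp_lip t u : Rabs (clamp u - clamp t) <= Rabs (u - t).
Proof. unfold clamp, Rmax, Rmin, Rabs; repeat (destruct Rle_dec); repeat (destruct Rcase_abs); lra. Qed.

Lemma conn_segment p q : conn (segment p q).
Proof.
  intros f Hf.
  assert (H : forall a b, a <= b -> f (seg p q (clamp a)) = f (seg p q (clamp b))).
  { apply (interval_induction (fun a b => f (seg p q (clamp a)) = f (seg p q (clamp b)))).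
    - intros; congruence.
    - intros x. destruct (Hf (seg p q (clamp x))) as [e [He Hn]].
      { exists (clamp x); split; auto. apply clamp_range. }
      destruct (seg_near p q e He) as [d [Hd Hs]].
      exists d; split; auto.
      assert (forall u, x - d < u < x + d -> f (seg p q (clamp u)) = f (seg p q (clamp x))).
      { intros u Hu. apply Hn.
        - exists (clamp u); split; auto. apply clamp_range.
        - apply Hs. eapply Rle_lt_trans; [apply clamp_lip|]. apply Rabs_def1; lra. }
      intros u v H1 H2 H3 H4. rewrite (H u), (H v); auto; lra. }
  intros z w [t [Ht ->]] [u [Hu ->]].
  rewrite <- (clamp_id t), <- (clamp_id u); auto.
  destruct (Rle_dec t u); [|symmetry]; apply H; lra.
Qed.

Lemma segment_l p q : segment p q p.
Proof. exists 0; split; [lra|]. rewrite seg0; auto. Qed.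
Lemma segment_r p q : segment p q q.
Proof. exists 1; split; [lra|]. rewrite seg1; auto. Qed.

Definition convex (S : pset) : Prop := forall p q, S p -> S q -> subset (segment p q) S.

Lemma conn_convex S : convex S -> conn S.
Proof.
  intros HS f Hf p q Hp Hq.
  apply (conn_segment p q f); [|apply segment_l|apply segment_r].
  apply (locc_sub S); auto.
Qed.

Lemma convex_between a b t x y : a <= x -> a <= y -> x <= b -> y <= b -> 0 <= t <= 1 ->
  a <= x + t * (y - x) <= b.
Proof. intros; split; nra. Qed.

Lemma convex_gt a t x y : a < x -> a < y -> 0 <= t <= 1 -> a < x + t * (y - x).
Proof.
  intros. destruct (Rle_dec t (1/2)).
  - assert (0 <= t * (y - a)) by nra. nra.
  - assert (0 <= (1 - t) * (x - a)) by nra. nra.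
Qed.
Lemma convex_lt a t x y : x < a -> y < a -> 0 <= t <= 1 -> x + t * (y - x) < a.
Proof. intros. assert (- a < - x + t * (- y - - x)) by (apply convex_gt; lra). lra. Qed.

Lemma convex_near e p : convex (near e p).
Proof.
  intros q r Hq Hr z [t [Ht ->]]. apply near_def in Hq, Hr. apply near_def. unfold seg; simpl.
  repeat split; (apply convex_gt || apply convex_lt); lra.
Qed.

Definition rect (a b c d : R) : pset := fun p => a <= fst p <= b /\ c <= snd p <= d.

Lemma convex_rect a b c d : convex (rect a b c d).
Proof.
  intros q r [Hq1 Hq2] [Hr1 Hr2] z [t [Ht ->]]. unfold rect, seg; simpl.
  split; apply convex_between; lra.
Qed.

Lemma convex_halfx_lt a : convex (fun p => fst p < a).
Proof. intros q r Hq Hr z [t [Ht ->]]. unfold seg; simpl in *. (apply convex_gt || apply convex_lt); lra. Qed.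
Lemma convex_halfx_gt a : convex (fun p => a < fst p).
Proof. intros q r Hq Hr z [t [Ht ->]]. unfold seg; simpl in *. (apply convex_gt || apply convex_lt); lra. Qed.
Lemma convex_halfy_lt a : convex (fun p => snd p < a).
Proof. intros q r Hq Hr z [t [Ht ->]]. unfold seg; simpl in *. (apply convex_gt || apply convex_lt); lra. Qed.
Lemma convex_halfy_gt a : convex (fun p => a < snd p).
Proof. intros q r Hq Hr z [t [Ht ->]]. unfold seg; simpl in *. (apply convex_gt || apply convex_lt); lra. Qed.

Lemma closed_rect a b c d : closed (rect a b c d).
Proof.
  repeat apply closed_inter; [apply closed_halfx_ge|apply closed_halfx_le|apply closed_halfy_ge|apply closed_halfy_le].
Qed.

Lemma cpt_rect a b c d : cpt (rect a b c d).
Proof.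
  split; [apply closed_rect|].
  exists (Rabs a + Rabs b + Rabs c + Rabs d). intros p [H1 H2].
  pose proof (Rabs_pos a); pose proof (Rabs_pos b); pose proof (Rabs_pos c); pose proof (Rabs_pos d).
  pose proof (Rle_abs b); pose proof (Rle_abs d). pose proof (Rle_abs (-a)); pose proof (Rle_abs (-c)).
  rewrite Rabs_Ropp in *.
  split; apply Rabs_le; lra.
Qed.

Lemma cpt_segment p q : cpt (segment p q).
Proof.
  split.
  - intros z Hz.
    assert (H : exists e, 0 < e /\ forall t, 0 <= t <= 1 -> ~ near e z (seg p q t)).
    { assert (Ht : 0 <= 1) by lra.
      pose (P := fun a b => exists e, 0 < e /\ forall t, a <= t <= b -> ~ near e z (seg p q (clamp t))).
      assert (HP : P 0 1).
      { apply (interval_induction P); auto.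
        - intros a b c Hc [e1 [He1 H1]] [e2 [He2 H2]].
          exists (Rmin e1 e2); split; [apply Rmin_glb_lt; auto|].
          intros t Ht' Hn. destruct (Rle_dec t c).
          + apply (H1 t); [lra|]. eapply near_le; eauto. apply Rmin_l.
          + apply (H2 t); [lra|]. eapply near_le; eauto. apply Rmin_r.
        - intros x. set (w := seg p q (clamp x)).
          assert (Hw : exists e, 0 < e /\ ~ near e z w).
          { apply NNPP; intro Hn. apply Hz. exists (clamp x). split; [apply clamp_range|].
            fold w. assert (forall e, 0 < e -> near e z w) as Hall.
            { intros e He. apply NNPP; intro; apply Hn; eauto. }
            destruct z as [zx zy], w as [wx wy]. unfold near in Hall; simpl in Hall.
            f_equal; apply Rminus_diag_uniq_sym; apply NNPP; intro Hne.
            - apply Rabs_pos_lt in Hne. destruct (Hall _ Hne); lra.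
            - apply Rabs_pos_lt in Hne. destruct (Hall _ Hne); lra. }
          destruct Hw as [e [He Hw]]. destruct (seg_near p q (e/2)) as [d [Hd Hs]]; [lra|].
          exists d; split; auto. intros u v H1 H2 H3 H4. exists (e/2); split; [lra|].
          intros t Ht' Hn. apply Hw. replace e with (e/2 + e/2) by lra.
          eapply near_trans; eauto. apply Hs. eapply Rle_lt_trans; [apply clamp_lip|].
          apply Rabs_def1; lra. }
      destruct HP as [e [He H]]. exists e; split; auto. intros t Ht'.
      rewrite <- (clamp_id t); auto. }
    destruct H as [e [He H]]. exists e; split; auto. intros r Hr [t [Ht Heq]]. subst r.
    apply (H t); auto.
  - exists (Rabs (fst p) + Rabs (fst q) + Rabs (snd p) + Rabs (snd q)).
    intros z [t [Ht ->]]. unfold seg; simpl.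
    assert (forall a b, Rabs (a + t * (b - a)) <= Rabs a + Rabs b).
    { intros a b. replace (a + t*(b-a)) with ((1-t)*a + t*b) by ring.
      eapply Rle_trans; [apply Rabs_triang|]. rewrite !Rabs_mult.
      rewrite (Rabs_right (1-t)), (Rabs_right t); try lra.
      pose proof (Rabs_pos a); pose proof (Rabs_pos b). nra. }
    pose proof (H (fst p) (fst q)); pose proof (H (snd p) (snd q)).
    pose proof (Rabs_pos (fst p)); pose proof (Rabs_pos (fst q)).
    pose proof (Rabs_pos (snd p)); pose proof (Rabs_pos (snd q)). lra.
Qed.

(** * Compactness in the plane *)

Lemma cover_rect (J : Type) (F : J -> pset) :
  (forall j, opn (F j)) -> (forall p, exists j, F j p) ->
  forall a b c d, a <= b -> c <= d ->
  exists l : list J, forall p, rect a b c d p -> exists j, In j l /\ F j p.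
Proof.
  intros HF Hc. apply rectangle_induction.
  - intros a b m c d Hm Hcd [l1 H1] [l2 H2]. exists (l1 ++ l2). intros p [Hx Hy].
    destruct (Rle_dec (fst p) m).
    + destruct (H1 p) as [j [Hj HFj]]; [split; lra|]. exists j; split; auto. apply in_or_app; auto.
    + destruct (H2 p) as [j [Hj HFj]]; [split; lra|]. exists j; split; auto. apply in_or_app; auto.
  - intros a b c d m Hab Hm [l1 H1] [l2 H2]. exists (l1 ++ l2). intros p [Hx Hy].
    destruct (Rle_dec (snd p) m).
    + destruct (H1 p) as [j [Hj HFj]]; [split; lra|]. exists j; split; auto. apply in_or_app; auto.
    + destruct (H2 p) as [j [Hj HFj]]; [split; lra|]. exists j; split; auto. apply in_or_app; auto.
  - intros x y. destruct (Hc (x, y)) as [j Hj]. destruct (HF j _ Hj) as [e [He Hn]].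
    exists e; split; auto. intros a b c d Ha Hb Hc' Hd. exists (j :: nil).
    intros p [Hx Hy]. exists j; split; [left; auto|]. apply Hn. apply near_def; simpl; lra.
Qed.

Lemma cpt_cover S : cpt S -> forall (J : Type) (F : J -> pset),
  (forall j, opn (F j)) -> (forall p, S p -> exists j, F j p) ->
  exists l : list J, forall p, S p -> exists j, In j l /\ F j p.
Proof.
  intros [Hcl [M HM]] J F HF Hc.
  destruct (classic (0 <= M)) as [HM0|HM0].
  2:{ exists nil. intros p Hp. destruct (HM p Hp). pose proof (Rabs_pos (fst p)). lra. }
  (* The complement of [S], indexed by [None], completes the cover of [S] to a cover of the
     plane. *)
  destruct (cover_rect (option J) (fun o => match o with Some j => F j | None => fun p => ~ S p end))
    with (a := - M) (b := M) (c := - M) (d := M) as [l Hl]; try lra.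
  - intros [j|]; auto.
  - intros p. destruct (classic (S p)) as [Hp|Hp].
    + destruct (Hc p Hp) as [j Hj]. exists (Some j); auto.
    + exists None; auto.
  - exists (flat_map (fun o => match o with Some j => j :: nil | None => nil end) l).
    intros p Hp. destruct (Hl p) as [[j|] [Hj HFj]].
    + destruct (HM p Hp) as [H1 H2]. apply Rabs_le_between in H1, H2. split; lra.
    + exists j; split; auto. apply in_flat_map. exists (Some j); split; simpl; auto.
    + contradiction.
Qed.

Lemma list_pos_min (l : list R) : exists m, 0 < m /\ forall e, In e l -> 0 < e -> m <= e.
Proof.
  induction l as [|a l [m [Hm IH]]].
  - exists 1; split; [lra|]. intros e [].
  - destruct (Rlt_dec 0 a).
    + exists (Rmin a m). split; [apply Rmin_glb_lt; auto|].
      intros e [->|He] Hp; [apply Rmin_l|]. eapply Rle_trans; [apply Rmin_r|]; auto.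
    + exists m; split; auto. intros e [->|He] Hp; auto; lra.
Qed.

Lemma list_max (l : list R) : exists m, 0 < m /\ forall e, In e l -> e <= m.
Proof.
  induction l as [|a l [m [Hm IH]]].
  - exists 1; split; [lra|]. intros e [].
  - exists (Rmax a m). split; [eapply Rlt_le_trans; [apply Hm|apply Rmax_r]|].
    intros e [->|He]; [apply Rmax_l|]. eapply Rle_trans; [|apply Rmax_r]; auto.
Qed.

Lemma closed_of_compact S : compact_in open2 S -> closed S.
Proof.
  intros H p Hp.
  destruct (H R (fun e q => 0 < e /\ ~ rect (fst p - e) (fst p + e) (snd p - e) (snd p + e) q)) as [l Hl].
  - intros e. apply opn_open2. intros q [He Hq].
    destruct (closed_rect _ _ _ _ q Hq) as [e' [He' Hn]]. exists e'; split; auto.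
  - intros q Hq. apply NNPP; intro Hn. apply Hp.
    assert (E : forall e, 0 < e -> rect (fst p - e) (fst p + e) (snd p - e) (snd p + e) q).
    { intros e He. apply NNPP; intro; apply Hn; eauto. }
    assert (p = q) as ->; auto.
    destruct p as [x y], q as [x' y']. unfold rect in E; simpl in E.
    f_equal; apply Rminus_diag_uniq_sym; apply NNPP; intro Hne; apply Rabs_pos_lt in Hne.
    + destruct (E (Rabs (x' - x) / 2)) as [H1 _]; [lra|]. revert H1 Hne.
      unfold Rabs; destruct Rcase_abs; lra.
    + destruct (E (Rabs (y' - y) / 2)) as [_ H1]; [lra|]. revert H1 Hne.
      unfold Rabs; destruct Rcase_abs; lra.
  - destruct (list_pos_min l) as [m [Hm Hmin]]. exists m; split; auto.
    intros q Hq HSq. destruct (Hl q HSq) as [e [He [He0 Hr]]]. specialize (Hmin e He He0).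
    apply Hr. apply near_def in Hq. split; lra.
Qed.

Lemma bounded_of_compact S : compact_in open2 S -> bounded S.
Proof.
  intros H.
  destruct (H R (fun e q => near e (0, 0) q)) as [l Hl].
  - intros e. apply opn_open2, opn_near.
  - intros q Hq. exists (Rabs (fst q) + Rabs (snd q) + 1). unfold near; simpl.
    rewrite !Rminus_0_r. pose proof (Rabs_pos (fst q)); pose proof (Rabs_pos (snd q)). lra.
  - destruct (list_max l) as [m [Hm Hmax]]. exists m. intros p Hp.
    destruct (Hl p Hp) as [e [He [H1 H2]]]. simpl in *. rewrite Rminus_0_r in *.
    specialize (Hmax e He). lra.
Qed.

Lemma cpt_compact S : cpt S <-> compact_in open2 S.
Proof.
  split.
  - intros H J F HF Hc. apply cpt_cover; auto. intro j; apply opn_open2; auto.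
  - intro H; split; [apply closed_of_compact|apply bounded_of_compact]; auto.
Qed.

Lemma cpt_inter S F : cpt S -> closed F -> cpt (fun p => S p /\ F p).
Proof.
  intros [H1 [M HM]] H2; split; [apply closed_inter; auto|]. exists M; intros p [H _]; auto.
Qed.

Lemma cpt_subset S F : cpt S -> closed F -> subset F S -> cpt F.
Proof. intros [H1 [M HM]] H2 H; split; auto. exists M; intros p Hp; auto. Qed.

Lemma cpt_union S S' : cpt S -> cpt S' -> cpt (fun p => S p \/ S' p).
Proof.
  intros [H1 [M HM]] [H2 [M' HM']]; split; [apply closed_union; auto|].
  exists (Rmax M M'). pose proof (Rmax_l M M'); pose proof (Rmax_r M M').
  intros p [H3|H3]; [apply HM in H3|apply HM' in H3]; lra.
Qed.

(** A Lebesgue number: [K] is covered by finitely many balls whose doubles miss [F], and the least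
    of their radii works. *)
Lemma cpt_gap K F : cpt K -> closed F -> (forall p, K p -> ~ F p) ->
  exists e, 0 < e /\ forall p q, K p -> near e p q -> ~ F q.
Proof.
  intros HK HF Hd.
  destruct (cpt_cover K HK {x : pt * R | 0 < snd x /\ forall q, near (snd x) (fst x) q -> ~ F q}
    (fun x p => near (snd (proj1_sig x) / 2) (fst (proj1_sig x)) p)) as [l Hl].
  - intro; apply opn_near.
  - intros p Hp. destruct (HF p (Hd p Hp)) as [e [He Hn]].
    exists (exist _ (p, e) (conj He Hn)). simpl. apply near_refl; lra.
  - destruct (list_pos_min (map (fun x => snd (proj1_sig x) / 2) l)) as [m [Hm Hmin]].
    exists m; split; auto. intros p q Hp Hq. destruct (Hl p Hp) as [[[z e] [He Hn]] [Hj Hz]].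
    simpl in *. apply Hn. replace e with (e/2 + e/2) by lra. eapply near_trans; eauto.
    eapply near_le; eauto. apply Hmin; [|lra].
    apply in_map_iff. eexists; split; [|exact Hj]; reflexivity.
Qed.

(** * Clopen pieces and quasi-components of compact sets *)

Definition clopen (K P : pset) : Prop :=
  subset P K /\ closed P /\ closed (fun p => K p /\ ~ P p).

Lemma clopen_inter K P Q : clopen K P -> clopen K Q -> clopen K (fun p => P p /\ Q p).
Proof.
  intros [H1 [H2 H3]] [H4 [H5 H6]]. split; [|split].
  - intros p [H _]; auto.
  - apply closed_inter; auto.
  - eapply closed_ext; [|apply (closed_union _ _ H3 H6)]. intro p; simpl.
    specialize (H1 p); specialize (H4 p). tauto.
Qed.

Lemma closed_empty : closed (fun _ => False).
Proof. intros p _. exists 1; split; [lra|]; auto. Qed.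

Lemma clopen_full K : closed K -> clopen K K.
Proof.
  intros H; split; [|split]; auto.
  - intros p Hp; auto.
  - eapply closed_ext; [|exact closed_empty]. intro p; simpl; tauto.
Qed.

Lemma clopen_compl K P : clopen K P -> clopen K (fun p => K p /\ ~ P p).
Proof.
  intros [H1 [H2 H3]]; split; [|split]; auto.
  - intros p [H _]; auto.
  - eapply closed_ext; [|exact H2]. intro p; simpl; specialize (H1 p). split; [tauto|].
    intros [H4 H5]. apply NNPP; tauto.
Qed.

Lemma clopen_list_inter (J : Type) K (F : J -> pset) (l : list J) : closed K ->
  (forall j, clopen K (F j)) -> clopen K (fun p => K p /\ forall j, In j l -> F j p).
Proof.
  intros HK HF. induction l as [|a l IH].
  - assert (H := clopen_full K HK). destruct H as [H1 [H2 H3]]. split; [|split].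
    + intros p [H _]; auto.
    + eapply closed_ext; [|exact H2]. intro p; simpl; tauto.
    + eapply closed_ext; [|exact H3]. intro p; simpl.
      assert (forall j : J, False -> F j p) by (intros j []). tauto.
  - destruct (clopen_inter _ _ _ (HF a) IH) as [H1 [H2 H3]].
    assert (E : forall p, (F a p /\ K p /\ forall j, In j l -> F j p) <->
                (K p /\ forall j, In j (a :: l) -> F j p)).
    { intro p; simpl; split.
      - intros [A [B C]]; split; auto. intros j [->|Hj]; auto.
      - intros [A B]; repeat split; auto. }
    split; [|split].
    + intros p [H _]; auto.
    + eapply closed_ext; [|exact H2]. auto.
    + eapply closed_ext; [|exact H3]. intro p. simpl. rewrite (E p). tauto.
Qed.

Definition quasi (K : pset) (p : pt) : pset :=
  fun q => K q /\ forall P, clopen K P -> P p -> P q.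

Lemma closed_quasi K p : closed K -> closed (quasi K p).
Proof.
  intro HK. apply closed_inter; auto.
  eapply closed_ext; [|apply (closed_Inter {P | clopen K P /\ P p} (fun x => proj1_sig x))].
  - intro q; split.
    + intros H P HP Hp. apply (H (exist _ P (conj HP Hp))).
    + intros H [P [HP Hp]]. exact (H P HP Hp).
  - intros [P HP]. simpl. apply HP.
Qed.

(** The sets [O b] are open neighbourhoods of the two fibres of [f], disjoint because the radii are
    halved. By compactness finitely many clopen sets containing [p] already intersect inside their
    union; the part of this intersection in [O false] is clopen and contains [p], hence contains the
    whole quasi-component. *)
Lemma conn_quasi K p : cpt K -> K p -> conn (quasi K p).
Proof.
  intros HK Hp f Hf.
  assert (HKc : closed K) by apply HK.
  assert (Hqp : quasi K p p) by (split; auto).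
  pose (O := fun (b : bool) z => exists r e, quasi K p r /\ xorb (f r) (f p) = b /\ near (e/2) r z /\ 0 < e /\
              forall q, quasi K p q -> near e r q -> f q = f r).
  assert (HO : forall b, opn (O b)).
  { intros b z [r [e [H1 [H2 [H3 [H4 H5]]]]]]. destruct (opn_near _ _ _ H3) as [e' [He' Hn]].
    exists e'; split; auto. intros q Hq. exists r, e; auto 10. }
  assert (Hd : forall z, O true z -> O false z -> False).
  { intros z [r [e [H1 [H2 [H3 [H4 H5]]]]]] [r' [e' [H1' [H2' [H3' [H4' H5']]]]]].
    destruct (Rle_dec e e').
    - rewrite (H5' r) in H2; auto; [congruence|].
      eapply near_le; [|eapply near_trans; [exact H3'|apply near_sym; exact H3]]. lra.
    - rewrite (H5 r') in H2'; auto; [congruence|].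
      eapply near_le; [|eapply near_trans; [exact H3|apply near_sym; exact H3']]. lra. }
  assert (Hin : forall z, quasi K p z -> O (xorb (f z) (f p)) z).
  { intros z Hz. destruct (Hf z Hz) as [e [He Hn]]. exists z, e.
    split; [exact Hz|]. split; auto. split; auto. apply near_refl; lra. }
  destruct (cpt_cover (fun z => K z /\ (~ O true z /\ ~ O false z))) with
    (J := {P | clopen K P /\ P p}) (F := fun (x : {P | clopen K P /\ P p}) z => ~ proj1_sig x z)
    as [l Hl].
  { apply cpt_inter; auto. apply closed_inter; apply closed_compl; auto. }
  { intros [P HP]. apply HP. }
  { intros z [Hz [Hn1 Hn2]]. apply NNPP; intro Hn.
    assert (Hq : quasi K p z).
    { split; auto. intros P HP HPp. apply NNPP; intro Hnz. apply Hn.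
      exists (exist _ P (conj HP HPp)). exact Hnz. }
    specialize (Hin z Hq). destruct (xorb (f z) (f p)); auto. }
  set (Ps := fun z => K z /\ forall j, In j l -> proj1_sig j z).
  assert (HPs : clopen K Ps).
  { apply (clopen_list_inter _ K (fun (x : {P | clopen K P /\ P p}) => proj1_sig x)); auto.
    intros [P HP]; apply HP. }
  assert (Hcov : forall z, Ps z -> O true z \/ O false z).
  { intros z [Hz Hz']. apply NNPP; intro Hn.
    destruct (Hl z) as [j [Hj Hjz]]; [tauto|]. apply Hjz; auto. }
  assert (HPp : Ps p).
  { split; auto. intros [P HP] _; apply HP. }
  assert (Hclo : clopen K (fun z => Ps z /\ O false z)).
  { destruct HPs as [H1 [H2 H3]]. split; [|split].
    - intros z [H _]; auto.
    - apply closed_ext with (U := fun z => Ps z /\ ~ O true z).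
      + intro z. specialize (Hd z); specialize (Hcov z). tauto.
      + apply closed_inter; auto. apply closed_compl; auto.
    - apply closed_ext with (U := fun z => (K z /\ ~ Ps z) \/ (Ps z /\ ~ O false z)).
      + intro z. specialize (H1 z). tauto.
      + apply closed_union; auto. apply closed_inter; auto. apply closed_compl; auto. }
  assert (HOp : O false p).
  { specialize (Hin p Hqp). rewrite xorb_nilpotent in Hin; auto. }
  assert (Hall : forall z, quasi K p z -> f z = f p).
  { intros z Hz. assert (Hz' := Hz). destruct Hz' as [_ Hz'].
    destruct (Hz' _ Hclo (conj HPp HOp)) as [_ Hf0].
    specialize (Hin z Hz). destruct (f z), (f p); simpl in *; auto; exfalso; eauto. }
  intros z w Hz Hw. rewrite (Hall z), (Hall w); auto.
Qed.

(** The main source of continua below. If no quasi-component meets both sets, compactness of the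
    part of [E2] in [K] separates each point of [E1] from [E2] by a clopen set, and compactness of
    the part of [E1] in [K] makes one clopen set serve all these points. *)
Lemma continuum_or_cut K E1 E2 : cpt K -> closed E1 -> closed E2 ->
  (exists L, cpt L /\ conn L /\ subset L K /\ (exists p, L p /\ E1 p) /\ (exists q, L q /\ E2 q)) \/
  (exists P, clopen K P /\ (forall p, K p -> E1 p -> P p) /\ (forall p, K p -> E2 p -> ~ P p)).
Proof.
  intros HK H1 H2.
  assert (HKc : closed K) by apply HK.
  destruct (classic (exists p q, K p /\ E1 p /\ quasi K p q /\ E2 q)) as [[p [q [Hp [Hp1 [Hq Hq2]]]]]|Hno].
  - left. exists (quasi K p). split; [|split; [|split; [|split]]].
    + apply (cpt_subset K); auto. apply closed_quasi; auto. intros z [Hz _]; auto.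
    + apply conn_quasi; auto.
    + intros z [Hz _]; auto.
    + exists p; split; auto. split; auto.
    + exists q; auto.
  - right.
    assert (Hpt : forall p, K p -> E1 p -> exists P, clopen K P /\ P p /\ forall q, K q -> E2 q -> ~ P q).
    { intros p Hp Hp1.
      destruct (cpt_cover (fun z => K z /\ E2 z)) with
        (J := {P | clopen K P /\ P p}) (F := fun (x : {P | clopen K P /\ P p}) z => ~ proj1_sig x z)
        as [l Hl].
      { apply cpt_inter; auto. }
      { intros [P HP]. apply HP. }
      { intros z [Hz Hz2]. apply NNPP; intro Hn. apply Hno. exists p, z. repeat split; auto.
        intros P HP HPp. apply NNPP; intro Hnz. apply Hn.
        exists (exist _ P (conj HP HPp)). exact Hnz. }
      exists (fun z => K z /\ forall j, In j l -> proj1_sig j z). split; [|split].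
      - apply (clopen_list_inter _ K (fun (x : {P | clopen K P /\ P p}) => proj1_sig x)); auto.
        intros [P HP]; apply HP.
      - split; auto. intros [P HP] _; apply HP.
      - intros q Hq Hq2 [_ Hall]. destruct (Hl q (conj Hq Hq2)) as [j [Hj Hjn]]. auto. }
    destruct (cpt_cover (fun z => K z /\ E1 z)) with
        (J := {P | clopen K P /\ forall q, K q -> E2 q -> ~ P q})
        (F := fun (x : {P | clopen K P /\ forall q, K q -> E2 q -> ~ P q}) z => ~ (K z /\ ~ proj1_sig x z))
        as [l Hl].
    { apply cpt_inter; auto. }
    { intros [P HP]. apply HP. }
    { intros z [Hz Hz1]. destruct (Hpt z Hz Hz1) as [P [HP [HPz HP2]]].
      exists (exist _ P (conj HP HP2)). simpl. tauto. }
    exists (fun z => K z /\ ~ (K z /\ forall j, In j l -> K z /\ ~ proj1_sig j z)).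
    split; [|split].
    + apply clopen_compl.
      apply (clopen_list_inter _ K (fun (x : {P | clopen K P /\ forall q, K q -> E2 q -> ~ P q}) z => K z /\ ~ proj1_sig x z)); auto.
      intros [P HP]; apply clopen_compl; apply HP.
    + intros p Hp Hp1. split; auto. intros [_ Hall].
      destruct (Hl p (conj Hp Hp1)) as [j [Hj Hjn]]. auto.
    + intros p Hp Hp2 [_ Hn]. apply Hn. split; auto. intros [P HP] _. simpl. split; auto. apply HP; auto.
Qed.

Lemma conn_no_clopen K P p q : conn K -> clopen K P -> P p -> K q -> ~ P q -> False.
Proof.
  intros HK [H1 [H2 H3]] Hp Hq Hn.
  assert (E : pred_bool (P p) = pred_bool (P q)).
  { apply (HK (fun z => pred_bool (P z))); auto. intros z Hz.
    destruct (classic (P z)) as [Hz'|Hz'].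
    - destruct (H3 z) as [e [He Hne]]; [tauto|]. exists e; split; auto.
      intros r Hr Hzr. apply pred_bool_iff. specialize (Hne r Hzr). split; auto.
      intros _; apply NNPP; tauto.
    - destruct (H2 z Hz') as [e [He Hne]]. exists e; split; auto.
      intros r Hr Hzr. apply pred_bool_iff. specialize (Hne r Hzr). tauto. }
  apply Hn, pred_boolP. rewrite <- E. apply pred_boolP; auto.
Qed.

(** * Double covers of the plane *)

Lemma xorb_diff a b c d u v : xorb a u = xorb b v -> xorb c u = xorb d v -> xorb a c = xorb b d.
Proof. destruct a, b, c, d, u, v; simpl; auto; discriminate. Qed.

Lemma sec_sub phi (D D' : pset) f : subset D' D -> sec phi D f -> sec phi D' f.
Proof. intros H Hf p Hp. destruct (Hf p (H p Hp)) as [e [He Hn]]. exists e; split; auto. Qed.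

Lemma sec_diff phi D f g : sec phi D f -> sec phi D g -> locc D (fun z => xorb (f z) (g z)).
Proof.
  intros Hf Hg p Hp. destruct (Hf p Hp) as [e [He Hn]], (Hg p Hp) as [e' [He' Hn']].
  exists (Rmin e e'); split; [apply Rmin_glb_lt; auto|]. intros q Hq Hpq.
  apply (xorb_diff _ _ _ _ (phi p q) (phi p p)).
  - apply Hn; auto. eapply near_min_l; eauto.
  - apply Hn'; auto. eapply near_min_r; eauto.
Qed.

Lemma sec_conn_eq phi D S f g p q : sec phi D f -> sec phi D g -> conn S -> subset S D ->
  S p -> S q -> xorb (f p) (g p) = xorb (f q) (g q).
Proof.
  intros Hf Hg HS HSD Hp Hq. apply (HS (fun z => xorb (f z) (g z))); auto.
  apply (locc_sub D); auto. apply (sec_diff phi); auto.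
Qed.

Lemma sec_shift phi D f c : sec phi D f -> sec phi D (fun z => xorb (f z) c).
Proof.
  intros Hf p Hp. destruct (Hf p Hp) as [e [He Hn]]. exists e; split; auto.
  intros q Hq Hpq. specialize (Hn q Hq Hpq). revert Hn.
  destruct (f q), (f p), (phi p q), (phi p p), c; simpl; congruence.
Qed.

Lemma sec_glue phi F1 F2 f1 f2 : closed F1 -> closed F2 -> sec phi F1 f1 -> sec phi F2 f2 ->
  (forall q, F1 q -> F2 q -> f1 q = f2 q) ->
  sec phi (fun q => F1 q \/ F2 q) (fun q => if pred_bool (F1 q) then f1 q else f2 q).
Proof.
  intros C1 C2 S1 S2 E.
  assert (E1 : forall q, F1 q -> (if pred_bool (F1 q) then f1 q else f2 q) = f1 q).
  { intros q Hq. rewrite (pred_bool_true _ Hq). auto. }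
  assert (E2 : forall q, F2 q -> (if pred_bool (F1 q) then f1 q else f2 q) = f2 q).
  { intros q Hq. destruct (pred_bool (F1 q)) eqn:Eq; auto. apply E; auto. apply pred_boolP; auto. }
  assert (L : forall (F : pset) f, closed F -> sec phi F f -> forall p, exists e, 0 < e /\
            (F p -> forall q, F q -> near e p q -> xorb (f q) (phi p q) = xorb (f p) (phi p p)) /\
            (~ F p -> forall q, near e p q -> ~ F q)).
  { intros F f HF Hf p. destruct (classic (F p)) as [Hp|Hp].
    - destruct (Hf p Hp) as [e [He Hn]]. exists e; split; [auto|]. split; [intros _; exact Hn|intro; contradiction].
    - destruct (HF p Hp) as [e [He Hn]]. exists e; split; [auto|]. split; [intro; contradiction|intros _; exact Hn]. }
  intros p Hp.
  destruct (L F1 f1 C1 S1 p) as [e1 [He1 [A1 B1]]], (L F2 f2 C2 S2 p) as [e2 [He2 [A2 B2]]].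
  exists (Rmin e1 e2); split; [apply Rmin_glb_lt; auto|]. intros q Hq Hpq.
  assert (N1 : near e1 p q) by (eapply near_min_l; eauto).
  assert (N2 : near e2 p q) by (eapply near_min_r; eauto).
  destruct (classic (F1 q)) as [Q1|Q1].
  - assert (P1 : F1 p) by (apply NNPP; intro; eapply B1; eauto).
    rewrite (E1 q), (E1 p); auto.
  - destruct Hq as [Hq|Q2]; [contradiction|].
    assert (P2 : F2 p) by (apply NNPP; intro; eapply B2; eauto).
    rewrite (E2 q), (E2 p); auto.
Qed.

(** Over the connected intersection the two sections differ by a constant, which is absorbed into
    [f2]; if the intersection is empty they can be pasted as they are. *)
Lemma sec_glue_conn phi F1 F2 f1 f2 : closed F1 -> closed F2 -> sec phi F1 f1 -> sec phi F2 f2 ->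
  conn (fun q => F1 q /\ F2 q) -> exists f, sec phi (fun q => F1 q \/ F2 q) f.
Proof.
  intros C1 C2 S1 S2 HC.
  destruct (classic (exists z, F1 z /\ F2 z)) as [[z [Hz1 Hz2]]|Hno].
  - eexists. apply (sec_glue phi F1 F2 f1 (fun q => xorb (f2 q) (xorb (f1 z) (f2 z)))); auto.
    + apply sec_shift; auto.
    + intros q H1 H2.
      assert (xorb (f1 q) (f2 q) = xorb (f1 z) (f2 z)).
      { apply (sec_conn_eq phi (fun q => F1 q /\ F2 q) (fun q => F1 q /\ F2 q)); auto.
        - eapply sec_sub; [|exact S1]. intros ? []; auto.
        - eapply sec_sub; [|exact S2]. intros ? []; auto.
        - intros ? H; exact H. }
      rewrite <- H. destruct (f1 q), (f2 q); auto.
  - eexists. apply (sec_glue phi F1 F2 f1 f2); auto. intros q H1 H2. exfalso; eauto.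
Qed.

(* The local trivializations are the charts of one double cover. *)
Definition compat (phi : pt -> pt -> bool) : Prop :=
  forall p, exists e, 0 < e /\ forall p', near e p p' -> exists e', 0 < e' /\
    forall q, near e' p' q -> xorb (phi p q) (phi p' q) = xorb (phi p p') (phi p' p').

Lemma compat_local phi p : compat phi -> exists e, 0 < e /\ forall S, subset S (near e p) -> sec phi S (phi p).
Proof.
  intros H. destruct (H p) as [e [He Hn]]. exists e; split; auto.
  intros S HS r Hr. destruct (Hn r (HS r Hr)) as [e' [He' Hn']]. exists e'; split; auto.
Qed.

Lemma rect_sec phi a b c d : compat phi -> a <= b -> c <= d -> exists f, sec phi (rect a b c d) f.
Proof.
  intros H. revert a b c d. apply rectangle_induction.
  - intros a b m c d Hm Hcd [f1 H1] [f2 H2].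
    destruct (sec_glue_conn phi (rect a m c d) (rect m b c d) f1 f2) as [f Hf]; auto using closed_rect.
    + apply conn_ext with (S := rect m m c d); [|apply conn_convex, convex_rect].
      intro p; unfold rect; split; [intros; lra|intros [H3 H4]; lra].
    + exists f. eapply sec_sub; [|exact Hf]. intros p [Hx Hy]. unfold rect.
      destruct (Rle_dec (fst p) m); [left|right]; lra.
  - intros a b c d m Hab Hm [f1 H1] [f2 H2].
    destruct (sec_glue_conn phi (rect a b c m) (rect a b m d) f1 f2) as [f Hf]; auto using closed_rect.
    + apply conn_ext with (S := rect a b m m); [|apply conn_convex, convex_rect].
      intro p; unfold rect; split; [intros; lra|intros [H3 H4]; lra].
    + exists f. eapply sec_sub; [|exact Hf]. intros p [Hx Hy]. unfold rect.
      destruct (Rle_dec (snd p) m); [left|right]; lra.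
  - intros x y. destruct (compat_local phi (x, y) H) as [e [He Hn]]. exists e; split; auto.
    intros a b c d Ha Hb Hc Hd. exists (phi (x, y)). apply Hn.
    intros p [Hx Hy]. apply near_def; simpl; lra.
Qed.

(* A section normalized at [d0] is determined along connected sets through [d0], so the choices made at different stages agree. *)
Lemma sec_exhaust phi (D : nat -> pset) d0 :
  (forall i j, (i <= j)%nat -> subset (D i) (D j)) ->
  (forall j, exists f, sec phi (D j) f) ->
  (forall p j, D j p -> exists e i, 0 < e /\ forall q, (exists k, D k q) -> near e p q ->
     exists L, conn L /\ subset L (D i) /\ L d0 /\ L q) ->
  exists f, sec phi (fun p => exists j, D j p) f.
Proof.
  intros Hmono Hsec Hloc.
  pose (V := fun z v => exists j g L, sec phi (D j) g /\ conn L /\ subset L (D j) /\ L d0 /\ L z /\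
               v = xorb (g z) (g d0)).
  assert (Huniq0 : forall z i j g h L L', (i <= j)%nat -> sec phi (D i) g -> sec phi (D j) h ->
     conn L -> subset L (D i) -> L d0 -> L z -> subset L' (D j) -> L' d0 -> L' z ->
     xorb (g z) (g d0) = xorb (h z) (h d0)).
  { intros z i j g h L L' Hij Hg Hh HL HLi Ld Lz _ _ _.
    assert (E : xorb (g z) (h z) = xorb (g d0) (h d0)).
    { apply (sec_conn_eq phi (D i) L); auto. apply (sec_sub phi (D j)); auto. }
    destruct (g z), (h z), (g d0), (h d0); simpl in *; congruence. }
  assert (Huniq : forall z v w, V z v -> V z w -> v = w).
  { intros z v w [i [g [L [H1 [H2 [H3 [H4 [H5 ->]]]]]]]] [j [h [L' [H1' [H2' [H3' [H4' [H5' ->]]]]]]]].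
    destruct (Nat.le_ge_cases i j).
    - apply (Huniq0 z i j g h L L'); auto.
    - symmetry. apply (Huniq0 z j i h g L' L); auto. }
  exists (fun z => pred_bool (V z true)).
  assert (Hval : forall z v, V z v -> pred_bool (V z true) = v).
  { intros z [|] Hv; [apply pred_bool_true; auto|].
    apply pred_bool_false. intro Ht. assert (true = false) by eauto. discriminate. }
  intros p [j Hp]. destruct (Hloc p j Hp) as [e [i [He Hn]]].
  destruct (Hsec i) as [g Hg].
  assert (Hq : forall q, (exists k, D k q) -> near e p q ->
     D i q /\ pred_bool (V q true) = xorb (g q) (g d0)).
  { intros q Hq Hpq. destruct (Hn q Hq Hpq) as [L [HL [HLi [Ld Lq]]]]. split; auto.
    apply Hval. exists i, g, L; auto 10. }
  assert (Hpp : near e p p) by (apply near_refl; auto).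
  destruct (Hq p (ex_intro _ j Hp) Hpp) as [Hpi Ep].
  destruct (sec_shift phi (D i) g (g d0) Hg p Hpi) as [e' [He' Hn']].
  exists (Rmin e e'); split; [apply Rmin_glb_lt; auto|]. intros q HDq Hpq.
  destruct (Hq q HDq) as [Hqi Eq]; [eapply near_min_l; eauto|].
  rewrite Ep, Eq. apply Hn'; auto. eapply near_min_r; eauto.
Qed.

Lemma nat_above (x : R) : exists n : nat, x <= INR n.
Proof.
  destruct (archimed x) as [H _]. exists (Z.to_nat (up x)).
  rewrite INR_IZR_INZ. apply Rlt_le, (Rlt_le_trans _ _ _ H), IZR_le. lia.
Qed.

(* Every double cover of the plane is trivial. *)
Lemma plane_sec phi : compat phi -> exists f, sec phi (fun _ => True) f.
Proof.
  intros H.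
  destruct (sec_exhaust phi (fun n => rect (- INR n) (INR n) (- INR n) (INR n)) (0, 0)) as [f Hf].
  - intros i j Hij p [Hx Hy]. apply le_INR in Hij. split; lra.
  - intros j. apply rect_sec; auto; pose proof (pos_INR j); lra.
  - intros p _ _. destruct (nat_above (Rabs (fst p) + Rabs (snd p) + 1)) as [n Hn].
    exists 1, n. split; [lra|]. intros q _ Hq.
    exists (rect (- INR n) (INR n) (- INR n) (INR n)). split; [apply conn_convex, convex_rect|].
    split; [intros z Hz; exact Hz|]. pose proof (pos_INR n). apply near_def in Hq.
    pose proof (Rle_abs (fst p)); pose proof (Rle_abs (snd p)).
    pose proof (Rle_abs (- fst p)); pose proof (Rle_abs (- snd p)). rewrite Rabs_Ropp in *.
    pose proof (Rabs_pos (fst p)); pose proof (Rabs_pos (snd p)).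
    split; split; simpl; lra.
  - exists f. eapply sec_sub; [|exact Hf]. intros p _.
    destruct (nat_above (Rabs (fst p) + Rabs (snd p))) as [n Hn]. exists n.
    pose proof (Rle_abs (fst p)); pose proof (Rle_abs (snd p)).
    pose proof (Rle_abs (- fst p)); pose proof (Rle_abs (- snd p)). rewrite Rabs_Ropp in *.
    pose proof (Rabs_pos (fst p)); pose proof (Rabs_pos (snd p)).
    split; lra.
Qed.

(** * Eilenberg's criterion and Janiszewski's theorem *)

(* The double cover of the plane branched at [a], cut open along the upward vertical ray from [a]. *)
Definition flip (a p q : pt) : bool :=
  pred_bool (fst p = fst a /\ snd a < snd p /\ fst a <= fst q).

(** The sum modulo 2 of the two covers: a loop around exactly one of [a] and [b] exchanges the
    sheets, a loop around both does not. *)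
Definition tau (a b p q : pt) : bool := xorb (flip a p q) (flip b p q).

Lemma flip_off a p q : ~ (fst p = fst a /\ snd a < snd p) -> flip a p q = false.
Proof. intro H. apply pred_bool_false. tauto. Qed.

Lemma flip_on a p q : fst p = fst a -> snd a < snd p -> flip a p q = pred_bool (fst a <= fst q).
Proof. intros H1 H2. apply pred_bool_iff. tauto. Qed.

Lemma halfx_locc a p : fst p <> a -> exists e, 0 < e /\
  forall q, near e p q -> pred_bool (a <= fst q) = pred_bool (a <= fst p).
Proof.
  intro H. exists (Rabs (fst p - a)). split; [apply Rabs_pos_lt; lra|].
  intros q Hq. apply near_def in Hq. apply pred_bool_iff. revert Hq. unfold Rabs; destruct Rcase_abs; lra.
Qed.

(** An explicit section: over the half-plane above [a], the indicator of the right side of the ray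
    trivializes the cover branched at [a]. *)
Lemma halfx_flip_locc a p : snd a < snd p -> exists e, 0 < e /\
  forall q, near e p q -> xorb (pred_bool (fst a <= fst q)) (flip a p q) =
                          xorb (pred_bool (fst a <= fst p)) (flip a p p).
Proof.
  intro H. destruct (Req_dec (fst p) (fst a)) as [E|E].
  - exists 1. split; [lra|]. intros q Hq. rewrite !flip_on, !xorb_nilpotent; auto.
  - destruct (halfx_locc (fst a) p E) as [e [He Hn]]. exists e; split; auto.
    intros q Hq. rewrite !flip_off by tauto. rewrite (Hn q Hq). auto.
Qed.

Lemma flip_compat a p : p <> a -> exists e, 0 < e /\ forall p', near e p p' -> exists e', 0 < e' /\
  forall q, near e' p' q -> xorb (flip a p q) (flip a p' q) = xorb (flip a p p') (flip a p' p').
Proof.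
  intro H.
  destruct (classic (fst p = fst a /\ snd a < snd p)) as [[E L]|Hoff].
  - exists (snd p - snd a). split; [lra|]. intros p' Hp'. apply near_def in Hp'.
    destruct (Req_dec (fst p') (fst a)) as [E'|E'].
    + exists 1; split; [lra|]. intros q Hq. rewrite !flip_on; try lra. rewrite !xorb_nilpotent; auto.
    + destruct (halfx_locc (fst a) p' E') as [e [He Hn]]. exists e; split; auto.
      intros q Hq. rewrite !(flip_off a p') by tauto. rewrite !(flip_on a p) by auto.
      rewrite (Hn q Hq). auto.
  - assert (He : exists e, 0 < e /\ forall p', near e p p' -> ~ (fst p' = fst a /\ snd a < snd p')).
    { destruct (Req_dec (fst p) (fst a)) as [E|E].
      - exists (snd a - snd p). split.
        + destruct (Rtotal_order (snd a) (snd p)) as [L|[L|L]]; [tauto| |lra].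
          exfalso; apply H. destruct p, a; simpl in *; congruence.
        + intros p' Hp'. apply near_def in Hp'. lra.
      - exists (Rabs (fst p - fst a)). split; [apply Rabs_pos_lt; lra|].
        intros p' Hp'. apply near_def in Hp'. revert Hp'. unfold Rabs; destruct Rcase_abs; lra. }
    destruct He as [e [He Hn]]. exists e; split; auto. intros p' Hp'.
    exists 1; split; [lra|]. intros q Hq.
    rewrite !(flip_off a p) by auto. rewrite !(flip_off a p') by auto. auto.
Qed.

Definition separates (X : pset) (a b : pt) : Prop :=
  exists W W', opn W /\ opn W' /\ (forall p, W p -> W' p -> False) /\
    (forall p, ~ X p -> W p \/ W' p) /\ (forall p, X p -> ~ W p /\ ~ W' p) /\ W a /\ W' b.

Lemma separates_mono (X X' : pset) a b : closed X' -> subset X X' -> ~ X' a -> ~ X' b ->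
  separates X a b -> separates X' a b.
Proof.
  intros HX' Hs Ha Hb [W [W' [H1 [H2 [H3 [H4 [H5 [H6 H7]]]]]]]].
  exists (fun p => W p /\ ~ X' p), (fun p => W' p /\ ~ X' p). repeat split; try tauto.
  - apply opn_inter; auto.
  - apply opn_inter; auto.
  - intros p [A _] [B _]; eauto.
  - intros p Hp. assert (~ X p) by (intro; apply Hp; auto). specialize (H4 p). tauto.
Qed.

Lemma separates_conn X a b a' S : separates X a b -> conn S -> (forall p, S p -> ~ X p) ->
  S a -> S a' -> separates X a' b.
Proof.
  intros [W [W' [H1 [H2 [H3 [H4 [H5 [H6 H7]]]]]]]] HS Hd Ha Ha'.
  exists W, W'. repeat split; auto; try (destruct (H5 p); auto; fail).
  assert (E : pred_bool (W a) = pred_bool (W a')).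
  { apply (HS (fun z => pred_bool (W z))); auto. intros z Hz. destruct (H4 z (Hd z Hz)) as [A|A].
    - destruct (H1 z A) as [e [He Hn]]. exists e; split; auto. intros q Hq Hzq.
      apply pred_bool_iff. split; auto.
    - destruct (H2 z A) as [e [He Hn]]. exists e; split; auto. intros q Hq Hzq.
      apply pred_bool_iff. split; intro; exfalso; eauto. }
  apply pred_boolP. rewrite <- E. apply pred_boolP; auto.
Qed.

Lemma not_separates_conn X a b S : conn S -> (forall p, S p -> ~ X p) -> S a -> S b -> ~ separates X a b.
Proof.
  intros HS Hd Ha Hb Hsep.
  destruct (separates_conn X a b b S) as [W [W' [_ [_ [H3 [_ [_ [H6 H7]]]]]]]]; eauto.
Qed.

Definition out (R : R) (p : pt) : Prop := R < Rabs (fst p) \/ R < Rabs (snd p).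

(** Triviality of the cover over [X] together with the point at infinity. For [X] bounded above, as
    in all uses, the two cuts meet [X] only inside a box, so far away a trivialization at infinity
    is just a constant. *)
Definition sec_inf (X : pset) (a b : pt) : Prop :=
  exists f R c, sec (tau a b) X f /\ forall p, X p -> out R p -> f p = c.

Lemma out_le R R' p : R <= R' -> out R' p -> out R p.
Proof. intros H [H1|H1]; [left|right]; lra. Qed.

(** The outside of a square without the part straight above it; the upward cuts from points of the
    square avoid this region. *)
Lemma conn_outer_U M : conn (fun p => fst p < - M \/ snd p < - M \/ M < fst p).
Proof.
  apply conn_ext with (S := fun p => (fst p < - M \/ snd p < - M) \/ M < fst p); [intro; tauto|].
  apply (conn_union (fun p => fst p < - M \/ snd p < - M) (fun p => M < fst p) (M + 1, - M - 1)); simpl; try lra.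
  - apply (conn_union (fun p => fst p < - M) (fun p => snd p < - M) (- M - 1, - M - 1)); simpl; try lra;
    apply conn_convex; [apply convex_halfx_lt|apply convex_halfy_lt].
  - apply conn_convex, convex_halfx_gt.
Qed.

Lemma convex_inter S S' : convex S -> convex S' -> convex (fun p => S p /\ S' p).
Proof. intros H H' p q [A B] [A' B'] z Hz. split; [exact (H p q A A' z Hz)|exact (H' p q B B' z Hz)]. Qed.

Lemma convex_halfx_ge a : convex (fun p => a <= fst p).
Proof. intros q r Hq Hr z [t [Ht ->]]. unfold seg; simpl in *. nra. Qed.

(* Going once around infinity crosses the ray exactly once. *)
Lemma no_sec_at_infinity M r k : Rabs (fst r) < M ->
  locc (fun p => fst p < - M \/ snd p < - M \/ M < fst p) k ->
  sec (flip r) (fun p => M < snd p) k -> snd r < M -> False.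
Proof.
  intros Hr H1 H2 Hr2. apply Rabs_def2 in Hr.
  assert (E1 : k (- M - 1, M + 1) = k (M + 1, M + 1)).
  { apply (conn_outer_U M k H1); simpl; lra. }
  destruct (H2 (fst r, M + 1)) as [e [He Hn]]; [simpl; lra|].
  set (q0 := (fst r - Rmin (e / 2) 1, M + 1)).
  assert (Hm : 0 < Rmin (e/2) 1 <= e/2) by (split; [apply Rmin_glb_lt; lra|apply Rmin_l]).
  assert (E2 : k (- M - 1, M + 1) = k q0).
  { apply (conn_convex (fun p => M < snd p /\ fst p < fst r)).
    - apply convex_inter; [apply convex_halfy_gt|apply convex_halfx_lt].
    - intros p [Hp1 Hp2]. destruct (H2 p Hp1) as [e' [He' Hn']]. exists e'; split; auto.
      intros q [Hq1 Hq2] Hpq. specialize (Hn' q Hq1 Hpq).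
      rewrite !flip_off, !xorb_false_r in Hn' by lra. auto.
    - simpl; lra.
    - unfold q0; simpl; lra. }
  assert (E3 : k (fst r, M + 1) = k (M + 1, M + 1)).
  { apply (conn_convex (fun p => M < snd p /\ fst r <= fst p)).
    - apply convex_inter; [apply convex_halfy_gt|apply convex_halfx_ge].
    - intros p [Hp1 Hp2]. destruct (H2 p Hp1) as [e' [He' Hn']]. exists e'; split; auto.
      intros q [Hq1 Hq2] Hpq. specialize (Hn' q Hq1 Hpq).
      replace (flip r p q) with (flip r p p) in Hn'.
      + destruct (k q), (k p), (flip r p p); auto.
      + apply pred_bool_iff. tauto.
    - simpl; lra.
    - simpl; lra. }
  assert (E4 := Hn q0). unfold q0 at 1 in E4. simpl in E4.
  rewrite !flip_on in E4; try (simpl; lra). simpl in E4.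
  rewrite (pred_bool_true (fst r <= fst r)), (pred_bool_false (fst r <= fst r - Rmin (e/2) 1)) in E4 by lra.
  rewrite <- E2, E1, E3 in E4.
  assert (xorb (k (M+1,M+1)) false = xorb (k (M+1,M+1)) true).
  { apply E4; [lra|]. apply near_def; unfold q0; simpl; lra. }
  destruct (k (M+1,M+1)); discriminate.
Qed.

(* If [X] separates [a] from [b], gluing the cover branched at [b] (on the side of [a]) to the
   cover branched at [a] (on the other side) along [X] gives an unbranched cover of the plane that is nontrivial at infinity. *)
Lemma separates_not_sec_inf X a b Y : closed X -> (forall p, X p -> snd p <= Y) ->
  separates X a b -> ~ sec_inf X a b.
Proof.
  intros HX HY [W [W' [HW [HW' [Hd [Hc [HXW [Wa W'b]]]]]]]] [f [R [c [Hf HR]]]].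
  assert (HWX : forall p, W p -> ~ X p) by (intros p A B; destruct (HXW p B); auto).
  assert (HW'X : forall p, W' p -> ~ X p) by (intros p A B; destruct (HXW p B); auto).
  assert (HM : exists M, R <= M /\ Y <= M /\ Rabs (fst a) < M /\ Rabs (snd a) < M /\
                 Rabs (fst b) < M /\ Rabs (snd b) < M).
  { exists (Rabs R + Rabs Y + Rabs (fst a) + Rabs (snd a) + Rabs (fst b) + Rabs (snd b) + 1).
    pose proof (Rle_abs R); pose proof (Rle_abs Y). pose proof (Rabs_pos R); pose proof (Rabs_pos Y).
    pose proof (Rabs_pos (fst a)); pose proof (Rabs_pos (snd a)).
    pose proof (Rabs_pos (fst b)); pose proof (Rabs_pos (snd b)). lra. }
  destruct HM as [M [HRM [HYM [Ha1 [Ha2 [Hb1 Hb2]]]]]].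
  apply Rabs_def2 in Ha1 as Ha1'. apply Rabs_def2 in Ha2 as Ha2'.
  apply Rabs_def2 in Hb1 as Hb1'. apply Rabs_def2 in Hb2 as Hb2'.
  (* The gluing constant at [p]: for [q] in [X] near [p], [flip b p q] plus [cc p] equals
     [flip a p q] plus [f q] modulo 2, so [f] is the map that glues the two covers along [X]. *)
  pose (cc := fun p => xorb (f p) (tau a b p p)).
  pose (phi := fun p q => if pred_bool (W p) then flip b p q else if pred_bool (W' p) then flip a p q
                 else if pred_bool (W q) then xorb (flip b p q) (cc p) else flip a p q).
  assert (PW : forall p q, W p -> phi p q = flip b p q).
  { intros p q Hp. unfold phi. rewrite (pred_bool_true _ Hp); auto. }
  assert (PW' : forall p q, W' p -> phi p q = flip a p q).
  { intros p q Hp. unfold phi. rewrite (pred_bool_false (W p)), (pred_bool_true _ Hp); auto.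
    intro; eauto. }
  assert (PX1 : forall p q, X p -> W q -> phi p q = xorb (flip b p q) (cc p)).
  { intros p q Hp Hq. unfold phi. destruct (HXW p Hp) as [A B].
    rewrite (pred_bool_false _ A), (pred_bool_false _ B), (pred_bool_true _ Hq); auto. }
  assert (PX2 : forall p q, X p -> ~ W q -> phi p q = flip a p q).
  { intros p q Hp Hq. unfold phi. destruct (HXW p Hp) as [A B].
    rewrite (pred_bool_false _ A), (pred_bool_false _ B), (pred_bool_false _ Hq); auto. }
  assert (Hphi : compat phi).
  { intros p. destruct (classic (X p)) as [Hp|Hp]; [|destruct (Hc p Hp) as [Hp'|Hp']].
    - destruct (flip_compat a p) as [e1 [He1 H1]]; [intros ->; eapply HWX; eauto|].
      destruct (flip_compat b p) as [e2 [He2 H2]]; [intros ->; eapply HW'X; eauto|].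
      destruct (Hf p Hp) as [e3 [He3 H3]].
      exists (Rmin (Rmin e1 e2) e3). split; [repeat apply Rmin_glb_lt; auto|].
      intros p' Hp'. assert (N3 := near_min_r _ _ _ _ Hp'). apply near_min_l in Hp'.
      assert (N2 := near_min_r _ _ _ _ Hp'). assert (N1 := near_min_l _ _ _ _ Hp').
      destruct (H1 p' N1) as [e1' [He1' K1]], (H2 p' N2) as [e2' [He2' K2]].
      destruct (classic (X p')) as [Xp'|Xp']; [|destruct (Hc p' Xp') as [Wp'|Wp']].
      + exists (Rmin e1' e2'); split; [apply Rmin_glb_lt; auto|]. intros q Hq.
        specialize (K1 q (near_min_l _ _ _ _ Hq)). specialize (K2 q (near_min_r _ _ _ _ Hq)).
        specialize (H3 p' Xp' N3). unfold tau in H3. destruct (HXW p' Xp') as [A B].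
        rewrite (PX2 p p'), (PX2 p' p') by auto.
        destruct (classic (W q)) as [Wq|Wq].
        * rewrite (PX1 p q), (PX1 p' q) by auto. unfold cc, tau. rewrite <- H3.
          revert K2. generalize (flip b p q), (flip b p' q), (flip b p p'), (flip b p' p'), (flip a p p'), (flip a p' p'), (f p').
          intros [] [] [] [] [] [] []; simpl; congruence.
        * rewrite (PX2 p q), (PX2 p' q) by auto. auto.
      + destruct (HW p' Wp') as [e4 [He4 H4]].
        exists (Rmin e2' e4); split; [apply Rmin_glb_lt; auto|]. intros q Hq.
        specialize (K2 q (near_min_l _ _ _ _ Hq)). specialize (H4 q (near_min_r _ _ _ _ Hq)).
        rewrite (PX1 p q), (PX1 p p'), !(PW p') by auto. revert K2.
        generalize (flip b p q), (flip b p' q), (flip b p p'), (flip b p' p'), (cc p).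
        intros [] [] [] [] []; simpl; congruence.
      + destruct (HW' p' Wp') as [e4 [He4 H4]].
        exists (Rmin e1' e4); split; [apply Rmin_glb_lt; auto|]. intros q Hq.
        specialize (K1 q (near_min_l _ _ _ _ Hq)). specialize (H4 q (near_min_r _ _ _ _ Hq)).
        rewrite (PX2 p q), (PX2 p p'), !(PW' p'); eauto; intro; eauto.
    - destruct (flip_compat b p) as [e1 [He1 H1]]; [intros ->; eauto|].
      destruct (HW p Hp') as [e2 [He2 H2]].
      exists (Rmin e1 e2); split; [apply Rmin_glb_lt; auto|]. intros p' Hpp'.
      destruct (H1 p' (near_min_l _ _ _ _ Hpp')) as [e' [He' K1]].
      exists e'; split; auto. intros q Hq. specialize (H2 p' (near_min_r _ _ _ _ Hpp')).
      rewrite !(PW p), !(PW p') by auto. auto.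
    - destruct (flip_compat a p) as [e1 [He1 H1]]; [intros ->; eauto|].
      destruct (HW' p Hp') as [e2 [He2 H2]].
      exists (Rmin e1 e2); split; [apply Rmin_glb_lt; auto|]. intros p' Hpp'.
      destruct (H1 p' (near_min_l _ _ _ _ Hpp')) as [e' [He' K1]].
      exists e'; split; auto. intros q Hq. specialize (H2 p' (near_min_r _ _ _ _ Hpp')).
      rewrite !(PW' p), !(PW' p') by auto. auto. }
  destruct (plane_sec phi Hphi) as [g Hg].
  (* Near infinity [f] is the constant [c], so adding [c] on [W] undoes the gluing there: [k]
     becomes locally constant outside a square, except straight above it. *)
  pose (k := fun q => if pred_bool (W q) then xorb (g q) c else g q).
  assert (kW : forall q, W q -> k q = xorb (g q) c).
  { intros q Hq; unfold k; rewrite (pred_bool_true _ Hq); auto. }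
  assert (kn : forall q, ~ W q -> k q = g q).
  { intros q Hq; unfold k; rewrite (pred_bool_false _ Hq); auto. }
  assert (kX : forall p, X p -> out M p -> exists e, 0 < e /\ forall q, near e p q -> k q = k p).
  { intros p Hp Ho. destruct (Hg p I) as [e [He Hn]]. exists e; split; auto. intros q Hq.
    specialize (Hn q I Hq).
    assert (Hoff : forall r, Rabs (fst r) < M -> Rabs (snd r) < M -> ~ (fst p = fst r /\ snd r < snd p)).
    { intros r Hr1 Hr2 [E L]. specialize (HY p Hp). apply Rabs_def2 in Hr2. destruct Ho as [Ho|Ho].
      - rewrite E in Ho. lra.
      - revert Ho. unfold Rabs; destruct Rcase_abs; lra. }
    assert (Hcc : cc p = c).
    { unfold cc, tau. rewrite !flip_off by auto. rewrite HR; auto; [destruct c; auto|].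
      eapply out_le; eauto. }
    destruct (HXW p Hp) as [A B]. rewrite (PX2 p p), (flip_off a), xorb_false_r in Hn by auto.
    rewrite (kn p A), <- Hn. destruct (classic (W q)) as [Wq|Wq].
    - rewrite (kW q Wq), (PX1 p q), (flip_off b), Hcc; auto.
    - rewrite (kn q Wq), (PX2 p q), (flip_off a), xorb_false_r; auto. }
  assert (kWs : forall p, W p -> exists e, 0 < e /\ forall q, near e p q ->
                 xorb (k q) (flip b p q) = xorb (k p) (flip b p p)).
  { intros p Hp. destruct (Hg p I) as [e [He Hn]], (HW p Hp) as [e' [He' Hn']].
    exists (Rmin e e'); split; [apply Rmin_glb_lt; auto|]. intros q Hq.
    specialize (Hn q I (near_min_l _ _ _ _ Hq)). specialize (Hn' q (near_min_r _ _ _ _ Hq)).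
    rewrite !(PW p) in Hn by auto. rewrite (kW q), (kW p) by auto.
    revert Hn. generalize (g q), (g p), (flip b p q), (flip b p p), c.
    intros [] [] [] [] []; simpl; congruence. }
  assert (kW's : forall p, W' p -> exists e, 0 < e /\ forall q, near e p q ->
                 xorb (k q) (flip a p q) = xorb (k p) (flip a p p)).
  { intros p Hp. destruct (Hg p I) as [e [He Hn]], (HW' p Hp) as [e' [He' Hn']].
    exists (Rmin e e'); split; [apply Rmin_glb_lt; auto|]. intros q Hq.
    specialize (Hn q I (near_min_l _ _ _ _ Hq)). specialize (Hn' q (near_min_r _ _ _ _ Hq)).
    rewrite !(PW' p) in Hn by auto. rewrite (kn q), (kn p); auto; intro; eauto. }
  assert (Hlow : locc (fun p => fst p < - M \/ snd p < - M \/ M < fst p) k).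
  { intros p Hp.
    assert (Ho : out M p).
    { unfold out, Rabs. repeat destruct Rcase_abs; lra. }
    assert (Hoff : forall r, Rabs (fst r) < M -> Rabs (snd r) < M -> ~ (fst p = fst r /\ snd r < snd p)).
    { intros r Hr1 Hr2 [E L]. apply Rabs_def2 in Hr1, Hr2. lra. }
    destruct (classic (X p)) as [Xp|Xp]; [|destruct (Hc p Xp) as [Wp|Wp]].
    - destruct (kX p Xp Ho) as [e [He Hn]]. exists e; split; auto.
    - destruct (kWs p Wp) as [e [He Hn]]. exists e; split; auto. intros q _ Hq.
      specialize (Hn q Hq). rewrite !flip_off, !xorb_false_r in Hn by auto. auto.
    - destruct (kW's p Wp) as [e [He Hn]]. exists e; split; auto. intros q _ Hq.
      specialize (Hn q Hq). rewrite !flip_off, !xorb_false_r in Hn by auto. auto. }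
  assert (Htop : forall p, M < snd p -> ~ X p).
  { intros p Hp Xp. specialize (HY p Xp). lra. }
  assert (Htopc : conn (fun p => M < snd p)) by apply conn_convex, convex_halfy_gt.
  (* There is no point of [X] above [M], so a single one of the two branched covers is used there,
     and [k] would trivialize it all around infinity. *)
  assert (Hside : (forall p, M < snd p -> W p) \/ (forall p, M < snd p -> W' p)).
  { assert (L : forall p q, M < snd p -> M < snd q -> W p -> W q).
    { intros p q Hp Hq HWp.
      assert (E : pred_bool (W p) = pred_bool (W q)).
      { apply (Htopc (fun z => pred_bool (W z))); auto. intros z Hz.
        destruct (Hc z (Htop z Hz)) as [A|A].
        - destruct (HW z A) as [e [He Hn]]. exists e; split; auto. intros r _ Hr.
          apply pred_bool_iff. split; auto.
        - destruct (HW' z A) as [e [He Hn]]. exists e; split; auto. intros r _ Hr.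
          apply pred_bool_iff. split; intro; exfalso; eauto. }
      apply pred_boolP. rewrite <- E. apply pred_boolP; auto. }
    destruct (classic (W (0, M + 1))) as [A|A].
    - left. intros p Hp. apply (L (0, M + 1)); auto. simpl; lra.
    - right. intros p Hp. destruct (Hc p (Htop p Hp)); auto. exfalso; apply A.
      apply (L p); auto. simpl; lra. }
  destruct Hside as [Hs|Hs].
  - apply (no_sec_at_infinity M b k); auto; try lra. intros p Hp.
    destruct (kWs p (Hs p Hp)) as [e [He Hn]]. exists e; split; auto.
  - apply (no_sec_at_infinity M a k); auto; try lra. intros p Hp.
    destruct (kW's p (Hs p Hp)) as [e [He Hn]]. exists e; split; auto.
Qed.

Lemma tau_diag a p q : tau a a p q = false.
Proof. apply xorb_nilpotent. Qed.

(* Moving the branch point from [a] to [a'] inside a ball around [z] changes the cut by the vertical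
   strip between the two rays; a set missing the ball meets this strip only above or below it. *)
Definition shift_term (z a a' q : pt) : bool :=
  andb (pred_bool (snd z < snd q))
    (xorb (pred_bool (fst a <= fst q)) (pred_bool (fst a' <= fst q))).

Lemma sec_move X a a' b z e f : near e z a -> near e z a' -> (forall q, near e z q -> ~ X q) ->
  sec (tau a b) X f -> sec (tau a' b) X (fun q => xorb (f q) (shift_term z a a' q)).
Proof.
  intros Ha Ha' HX Hf p Hp.
  destruct (Hf p Hp) as [e1 [He1 H1]].
  assert (G : exists e2, 0 < e2 /\ forall q, near e2 p q ->
     xorb (shift_term z a a' q) (xorb (flip a p q) (flip a' p q)) =
     xorb (shift_term z a a' p) (xorb (flip a p p) (flip a' p p))).
  { assert (Hout : ~ near e z p) by (intro A; apply (HX p A Hp)).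
    apply near_def in Ha, Ha'.
    (* In the vertical strip of the ball: below the ball neither ray is met, and above it both
       half-plane indicators are sections. Outside the strip both rays are avoided and the
       indicators agree. *)
    destruct (Rlt_dec (Rabs (fst p - fst z)) e) as [Hx|Hx].
    - assert (Hy : e <= Rabs (snd p - snd z)).
      { apply Rnot_lt_le. intro. apply Hout. split; auto. }
      unfold Rabs in Hy. destruct Rcase_abs in Hy.
      + exists e. split; [lra|]. intros q Hq. apply near_def in Hq.
        unfold shift_term.
        rewrite (pred_bool_false (snd z < snd q)), (pred_bool_false (snd z < snd p)) by lra.
        rewrite !flip_off by lra. auto.
      + destruct (halfx_flip_locc a p) as [e2 [He2 H2]]; [lra|].
        destruct (halfx_flip_locc a' p) as [e3 [He3 H3]]; [lra|].
        exists (Rmin (Rmin e2 e3) e). split; [repeat apply Rmin_glb_lt; lra|].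
        intros q Hq. assert (N := near_min_r _ _ _ _ Hq). apply near_min_l in Hq.
        specialize (H2 q (near_min_l _ _ _ _ Hq)). specialize (H3 q (near_min_r _ _ _ _ Hq)).
        apply near_def in N. unfold shift_term.
        rewrite (pred_bool_true (snd z < snd q)), (pred_bool_true (snd z < snd p)) by lra.
        revert H2 H3. simpl. destruct (pred_bool (fst a <= fst q)), (pred_bool (fst a' <= fst q)),
          (pred_bool (fst a <= fst p)), (pred_bool (fst a' <= fst p)), (flip a p q), (flip a' p q),
          (flip a p p), (flip a' p p); simpl; congruence.
    - apply Rnot_lt_le in Hx.
      exists (Rmin (Rabs (fst p - fst a)) (Rabs (fst p - fst a'))).
      assert (fst p <> fst a /\ fst p <> fst a') as [N1 N2].
      { revert Hx; unfold Rabs; destruct Rcase_abs; lra. }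
      split; [apply Rmin_glb_lt; apply Rabs_pos_lt; lra|].
      intros q Hq. assert (M1 := near_min_l _ _ _ _ Hq). assert (M2 := near_min_r _ _ _ _ Hq).
      apply near_def in M1, M2. rewrite !flip_off by tauto.
      assert (E : forall w, w = p \/ w = q -> shift_term z a a' w = false).
      { intros w Hw. unfold shift_term.
        replace (pred_bool (fst a <= fst w)) with (pred_bool (fst a' <= fst w));
          [rewrite xorb_nilpotent; apply andb_false_r|].
        apply pred_bool_iff. revert Hx M1 M2.
        destruct Hw as [-> | ->]; unfold Rabs; repeat destruct Rcase_abs; lra. }
      rewrite !E; auto. }
  destruct G as [e2 [He2 H2]]. exists (Rmin e1 e2); split; [apply Rmin_glb_lt; auto|].
  intros q HXq Hq. specialize (H1 q HXq (near_min_l _ _ _ _ Hq)).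
  specialize (H2 q (near_min_r _ _ _ _ Hq)). revert H1 H2. unfold tau.
  destruct (f q), (f p), (shift_term z a a' q), (shift_term z a a' p), (flip a p q), (flip a p p),
    (flip a' p q), (flip a' p p), (flip b p q), (flip b p p); simpl; congruence.
Qed.

Lemma sec_inf_move X a a' b Y z e : (forall p, X p -> snd p <= Y) ->
  near e z a -> near e z a' -> (forall q, near e z q -> ~ X q) ->
  sec_inf X a b -> sec_inf X a' b.
Proof.
  intros HY Ha Ha' HX [f [R [c [Hf HR]]]].
  (* A point of [X] outside the box [M], being no higher than [Y], is either not above [z] or
     outside the vertical strip of the ball; in both cases [shift_term] vanishes. *)
  pose (M := Rmax R (Rabs (fst z) + e + Rabs (snd z) + Rabs Y)).
  exists (fun q => xorb (f q) (shift_term z a a' q)), M, c.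
  split; [apply (sec_move X a a' b z e); auto|].
  intros p Hp Ho. rewrite HR; auto; [|eapply out_le; [apply Rmax_l|exact Ho]].
  assert (E : shift_term z a a' p = false); [|rewrite E; apply xorb_false_r].
  apply (out_le _ _ _ (Rmax_r R _)) in Ho. specialize (HY p Hp).
  apply near_def in Ha, Ha'.
  unfold shift_term. destruct (Rlt_dec (snd z) (snd p)) as [Hs|Hs].
  - replace (pred_bool (fst a <= fst p)) with (pred_bool (fst a' <= fst p));
      [rewrite xorb_nilpotent; apply andb_false_r|].
    apply pred_bool_iff. revert Ho. unfold out, Rabs; repeat destruct Rcase_abs; lra.
  - rewrite (pred_bool_false _ Hs); auto.
Qed.

(** By [sec_inf_move] the points [p] for which the cover branched at [p] and [b] is trivial over [X]
    form an open and closed part of the complement of [X]. It contains [b], where the two branchings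
    cancel; if it did not contain [a], this partition would separate [a] from [b]. *)
Lemma not_separates_sec_inf X a b Y : closed X -> (forall p, X p -> snd p <= Y) ->
  ~ X a -> ~ X b -> ~ separates X a b -> sec_inf X a b.
Proof.
  intros HX HY Ha Hb Hs. apply NNPP; intro Hn. apply Hs.
  assert (Hstep : forall p, ~ X p -> exists e, 0 < e /\ (forall q, near e p q -> ~ X q) /\
            forall q, near e p q -> (sec_inf X p b <-> sec_inf X q b)).
  { intros p Hp. destruct (HX p Hp) as [e [He Hne]]. exists e; split; auto. split; auto.
    intros q Hq. assert (near e p p) by (apply near_refl; auto).
    split; eapply sec_inf_move; eauto. }
  exists (fun p => ~ X p /\ ~ sec_inf X p b), (fun p => ~ X p /\ sec_inf X p b).
  split; [|split; [|repeat split; try tauto]].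
  - intros p [H1 H2]. destruct (Hstep p H1) as [e [He [H3 H4]]]. exists e; split; auto.
    intros q Hq. split; auto. rewrite <- (H4 q Hq). auto.
  - intros p [H1 H2]. destruct (Hstep p H1) as [e [He [H3 H4]]]. exists e; split; auto.
    intros q Hq. split; auto. rewrite <- (H4 q Hq). auto.
  - intros p Hp. destruct (classic (sec_inf X p b)); auto.
  - exists (fun _ => false), 0, false. split; auto.
    intros p Hp. exists 1; split; [lra|]. intros q _ _. rewrite !tau_diag; auto.
Qed.

(* Janiszewski's first theorem; the second alternative says that the intersection is
   connected together with the point at infinity. *)
Lemma union_not_separates X1 X2 a b Y : closed X1 -> closed X2 ->
  (forall p, X1 p -> snd p <= Y) -> (forall p, X2 p -> snd p <= Y) ->
  ~ X1 a -> ~ X1 b -> ~ X2 a -> ~ X2 b ->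
  ~ separates X1 a b -> ~ separates X2 a b ->
  (forall p, X1 p -> X2 p -> False) \/
  (conn (fun p => X1 p /\ X2 p) /\ forall R, exists p, X1 p /\ X2 p /\ out R p) ->
  ~ separates (fun p => X1 p \/ X2 p) a b.
Proof.
  intros C1 C2 B1 B2 A1 A2 A3 A4 S1 S2 Hcase Hsep.
  assert (BY : forall p, X1 p \/ X2 p -> snd p <= Y) by (intros p [|]; auto).
  apply (separates_not_sec_inf _ a b Y (closed_union _ _ C1 C2) BY Hsep).
  destruct (not_separates_sec_inf X1 a b Y) as [f1 [R1 [c1 [F1 G1]]]]; auto.
  destruct (not_separates_sec_inf X2 a b Y) as [f2 [R2 [c2 [F2 G2]]]]; auto.
  (* The shift makes the two values at infinity equal, so the sections agree on an intersection that
     is connected and reaches infinity. *)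
  pose (h2 := fun q => xorb (f2 q) (xorb c1 c2)).
  exists (fun q => if pred_bool (X1 q) then f1 q else h2 q), (Rmax R1 R2), c1.
  split.
  - apply sec_glue; auto; [apply sec_shift; auto|].
    intros q H1 H2. destruct Hcase as [Hd|[HC HU]]; [exfalso; eauto|].
    destruct (HU (Rmax R1 R2)) as [p [P1 [P2 Ho]]].
    assert (E : xorb (f1 q) (f2 q) = xorb (f1 p) (f2 p)).
    { apply (sec_conn_eq (tau a b) (fun p => X1 p /\ X2 p) (fun p => X1 p /\ X2 p)); auto.
      - eapply sec_sub; [|exact F1]. intros ? []; auto.
      - eapply sec_sub; [|exact F2]. intros ? []; auto.
      - intros ? H; exact H. }
    rewrite (G1 p P1), (G2 p P2) in E.
    + unfold h2. rewrite <- E. destruct (f1 q), (f2 q); auto.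
    + eapply out_le; [apply Rmax_r|eauto].
    + eapply out_le; [apply Rmax_l|eauto].
  - intros p Hp Ho. destruct (pred_bool (X1 p)) eqn:E.
    + apply G1; [apply pred_boolP; auto|]. eapply out_le; [apply Rmax_l|eauto].
    + destruct Hp as [Hp|Hp]; [rewrite (pred_bool_true _ Hp) in E; discriminate|].
      unfold h2. rewrite (G2 p Hp); [destruct c1, c2; auto|]. eapply out_le; [apply Rmax_r|eauto].
Qed.

(** On [X] the cut from [b] is never met, and a section plus the indicator of [fst v <= fst z] is
    constant. A section therefore takes different values at the far left and the far right, whereas
    one that is trivial at infinity takes the same. *)
Lemma strip_separates X v b Y : closed X -> conn X -> (forall p, X p -> - Y <= snd p <= Y) ->
  snd v < - Y -> Y < snd b ->
  (forall R, exists p, X p /\ fst p < R) -> (forall R, exists p, X p /\ R < fst p) ->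
  separates X v b.
Proof.
  intros HX HC HY Hv Hb HL HR. apply NNPP; intro Hn.
  destruct (not_separates_sec_inf X v b Y) as [f [M [c [Hf Hc]]]]; auto.
  - intros p Hp; apply HY; auto.
  - intro A; apply HY in A; lra.
  - intro A; apply HY in A; lra.
  - destruct (HL (- (Rabs M + Rabs (fst v)) - 1)) as [p [Hp Lp]].
    destruct (HR (Rabs M + Rabs (fst v) + 1)) as [q [Hq Lq]].
    assert (H1 := Rle_abs M). assert (H2 := Rle_abs (fst v)). assert (H3 := Rle_abs (- fst v)).
    rewrite Rabs_Ropp in H3. assert (H4 := Rabs_pos (fst v)). assert (H5 := Rabs_pos M).
    assert (E : xorb (f p) (pred_bool (fst v <= fst p)) = xorb (f q) (pred_bool (fst v <= fst q))).
    { apply (HC (fun z => xorb (f z) (pred_bool (fst v <= fst z)))); auto.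
      intros z Hz. destruct (Hf z Hz) as [e [He Hne]].
      assert (Bz := HY z Hz).
      destruct (halfx_flip_locc v z) as [e' [He' Hne']]; [lra|].
      exists (Rmin e e'); split; [apply Rmin_glb_lt; auto|]. intros w Hw Hzw.
      specialize (Hne w Hw (near_min_l _ _ _ _ Hzw)). specialize (Hne' w (near_min_r _ _ _ _ Hzw)).
      unfold tau in Hne. rewrite !(flip_off b) in Hne by lra. revert Hne Hne'.
      destruct (f w), (f z), (flip v z w), (flip v z z), (pred_bool (fst v <= fst w)),
        (pred_bool (fst v <= fst z)); simpl; congruence. }
    rewrite (Hc p Hp), (Hc q Hq), (pred_bool_false (fst v <= fst p)), (pred_bool_true (fst v <= fst q)) in E;
      try lra.
    + destruct c; discriminate.
    + left. unfold Rabs; destruct Rcase_abs; lra.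
    + left. unfold Rabs; destruct Rcase_abs; lra.
Qed.

(** * Joining points by continua in open sets *)

Definition reach (D : pset) (a z : pt) : Prop :=
  exists L, cpt L /\ conn L /\ subset L D /\ L a /\ L z.

Lemma reach_step D a : opn D -> forall p, D p -> exists e, 0 < e /\
  (forall q, near e p q -> D q) /\ forall q, near e p q -> (reach D a p <-> reach D a q).
Proof.
  intros HD p Hp. destruct (HD p Hp) as [e [He Hn]]. exists e; split; auto. split; auto.
  assert (H : forall q r, near e p q -> near e p r -> reach D a q -> reach D a r).
  { intros q r Hq Hr [L [H1 [H2 [H3 [H4 H5]]]]].
    exists (fun z => L z \/ segment q r z). split; [|split; [|split; [|split]]]; auto.
    - apply cpt_union; auto. apply cpt_segment.
    - apply (conn_union _ _ q); auto; [apply conn_segment|apply segment_l].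
    - intros z [Hz|Hz]; auto. apply Hn. eapply convex_near; [exact Hq|exact Hr|exact Hz].
    - right. apply segment_r. }
  intros q Hq. assert (near e p p) by (apply near_refl; auto). split; eauto.
Qed.

Lemma reach_refl (D : pset) a : D a -> reach D a a.
Proof.
  intro H. exists (fun p => p = a). repeat split; auto.
  - eapply closed_ext; [|exact (proj1 (cpt_segment a a))]. intro p; split.
    + intros [t [_ ->]]. destruct a; unfold seg; simpl. f_equal; ring.
    + intros ->. apply segment_l.
  - exists (Rmax (Rabs (fst a)) (Rabs (snd a))). intros p ->. split; [apply Rmax_l|apply Rmax_r].
  - apply conn_point.
  - intros p ->; auto.
Qed.

Lemma conn_reach D a b : opn D -> conn D -> D a -> D b -> reach D a b.
Proof.
  intros HD HC Ha Hb.
  assert (E : pred_bool (reach D a a) = pred_bool (reach D a b)).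
  { apply (HC (fun z => pred_bool (reach D a z))); auto. intros z Hz.
    destruct (reach_step D a HD z Hz) as [e [He [H1 H2]]]. exists e; split; auto.
    intros q _ Hq. apply pred_bool_iff. symmetry; auto. }
  apply pred_boolP. rewrite <- E. apply pred_boolP. apply reach_refl; auto.
Qed.

Lemma not_separates_reach X a b : closed X -> ~ X a -> ~ X b -> ~ separates X a b ->
  reach (fun p => ~ X p) a b.
Proof.
  intros HX Ha Hb Hs. apply NNPP; intro Hn. apply Hs.
  assert (Hstep := reach_step (fun p => ~ X p) a HX).
  exists (fun p => ~ X p /\ reach (fun p => ~ X p) a p), (fun p => ~ X p /\ ~ reach (fun p => ~ X p) a p).
  split; [|split; [|repeat split; try tauto]].
  - intros p [H1 H2]. destruct (Hstep p H1) as [e [He [H3 H4]]]. exists e; split; auto.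
    intros q Hq. split; [apply H3; auto|]. apply (H4 q Hq). auto.
  - intros p [H1 H2]. destruct (Hstep p H1) as [e [He [H3 H4]]]. exists e; split; auto.
    intros q Hq. split; [apply H3; auto|]. rewrite <- (H4 q Hq). auto.
  - intros p Hp. destruct (classic (reach (fun p => ~ X p) a p)); auto.
  - apply reach_refl; auto.
Qed.

Lemma inv_nat_below e : 0 < e -> exists n, / INR (S n) < e.
Proof.
  intro He. destruct (nat_above (/ e)) as [n Hn]. exists n.
  rewrite <- (Rinv_inv e). apply Rinv_lt_contravar.
  - apply Rmult_lt_0_compat; [apply Rinv_0_lt_compat; auto|apply lt_0_INR; lia].
  - rewrite S_INR. lra.
Qed.

(** Over the points of [D] at a definite distance from [K], the branch point [m] can be moved along
    the connected set [K], in steps shorter than this distance, until it cancels [n]. The sets [Dj]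
    of such points exhaust [D]. *)
Lemma sec_off_continuum K D m n : closed K -> conn K -> K m -> K n -> opn D -> conn D ->
  (forall p, D p -> ~ K p) -> exists f, sec (tau m n) D f.
Proof.
  intros HK KC Km Kn HD DC Hd.
  destruct (classic (exists d0, D d0)) as [[d0 Hd0]|Hno].
  2:{ exists (fun _ => false). intros p Hp. exfalso; eauto. }
  pose (Dj := fun (j : nat) z => D z /\ forall k, K k -> ~ near (/ INR (S j)) z k).
  assert (Hpos : forall j, 0 < / INR (S j)) by (intro; apply Rinv_0_lt_compat, lt_0_INR; lia).
  destruct (sec_exhaust (tau m n) Dj d0) as [f Hf].
  - intros i j Hij p [H1 H2]. split; auto. intros k Hk Hn. apply (H2 k Hk).
    eapply near_le; [|exact Hn]. apply Rinv_le_contravar; [apply lt_0_INR; lia|apply le_INR; lia].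
  - intros j.
    assert (Hstep : forall k k', K k -> near (/ INR (S j)) k k' ->
              (exists f, sec (tau k n) (Dj j) f) <-> (exists f, sec (tau k' n) (Dj j) f)).
    { intros k k' Hk Hkk'.
      assert (A : forall q, near (/ INR (S j)) k q -> ~ Dj j q).
      { intros q Hq [_ H]. apply (H k Hk). apply near_sym; auto. }
      assert (B := near_refl (/ INR (S j)) k (Hpos j)).
      split; intros [f Hf]; eexists.
      - apply (sec_move (Dj j) k k' n k (/ INR (S j)) f); auto.
      - apply (sec_move (Dj j) k' k n k (/ INR (S j)) f); auto. }
    assert (E : pred_bool (exists f, sec (tau n n) (Dj j) f) = pred_bool (exists f, sec (tau m n) (Dj j) f)).
    { apply (KC (fun z => pred_bool (exists f, sec (tau z n) (Dj j) f))); auto.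
      intros k Hk. exists (/ INR (S j)); split; auto. intros k' Hk' Hn.
      apply pred_bool_iff. symmetry. apply Hstep; auto. }
    apply pred_boolP. rewrite <- E. apply pred_boolP. exists (fun _ => false).
    intros p _. exists 1; split; [lra|]. intros q _ _. rewrite !tau_diag; auto.
  - intros p j [Hp _].
    destruct (HD p Hp) as [e [He Hn]].
    (* A continuum from [d0] to [p] in [D] is at positive distance from [K], hence contained in a
       single [Dj]. *)
    destruct (conn_reach D d0 p HD DC Hd0 Hp) as [L [L1 [L2 [L3 [L4 L5]]]]].
    destruct (cpt_gap L K L1 HK) as [e' [He' Hn']]; [intros q Hq; auto|].
    destruct (inv_nat_below (Rmin (e / 2) e')) as [i Hi]; [apply Rmin_glb_lt; lra|].
    exists (e / 2), i. split; [lra|]. intros q _ Hq.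
    exists (fun z => L z \/ near (e / 2) p z). split; [|split; [|split]]; auto.
    + apply (conn_union _ _ p); auto; [apply conn_convex, convex_near|apply near_refl; lra].
    + intros z [Hz|Hz]; split; auto.
      * intros k Hk Hzk. apply (Hn' z k Hz); auto. eapply near_le; [|exact Hzk].
        eapply Rle_trans; [apply Rlt_le, Hi|apply Rmin_r].
      * apply Hn. eapply near_le; [|exact Hz]. lra.
      * intros k Hk Hzk. apply (Hd k); auto. apply Hn. replace e with (e/2 + e/2) by lra.
        eapply near_trans; [exact Hz|]. eapply near_le; [|exact Hzk].
        eapply Rle_trans; [apply Rlt_le, Hi|apply Rmin_l].
  - exists f. eapply sec_sub; [|exact Hf]. intros p Hp.
    destruct (HK p (Hd p Hp)) as [e [He Hn]]. destruct (inv_nat_below e He) as [j Hj].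
    exists j; split; auto. intros k Hk Hpk. apply (Hn k); auto. eapply near_le; [|exact Hpk]. lra.
Qed.

(** * The lift of a thin essential annular continuum *)

Lemma first_hit F p x : closed F -> ~ F p -> F x ->
  exists t, 0 <= t <= 1 /\ F (seg p x t) /\ forall s, 0 <= s < t -> ~ F (seg p x s).
Proof.
  intros HF Hp Hx.
  pose (E := fun s => 0 <= s <= 1 /\ forall u, 0 <= u <= s -> ~ F (seg p x u)).
  assert (E0 : E 0).
  { split; [lra|]. intros u Hu. replace u with 0 by lra. rewrite seg0; auto. }
  destruct (completeness E) as [t [Hub Hlub]].
  - exists 1. intros s [Hs _]; lra.
  - exists 0; auto.
  - assert (Ht0 : 0 <= t) by (apply Hub; auto).
    assert (Ht1 : t <= 1) by (apply Hlub; intros s [Hs _]; lra).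
    assert (Hbelow : forall s, 0 <= s < t -> ~ F (seg p x s)).
    { intros s Hs Hn. assert (t <= s); [|lra]. apply Hlub. intros u [Hu Hu'].
      apply Rnot_lt_le; intro. apply (Hu' s); auto; lra. }
    exists t. split; [lra|]. split; auto. apply NNPP; intro Hn.
    destruct (HF _ Hn) as [e [He Hne]]. destruct (seg_near p x e He) as [d [Hd Hs]].
    destruct (Req_dec t 1) as [->|Ht]; [rewrite seg1 in Hn; auto|].
    assert (Hm : 0 < Rmin (d/2) (1 - t)) by (apply Rmin_glb_lt; lra).
    pose proof (Rmin_l (d/2) (1-t)). pose proof (Rmin_r (d/2) (1-t)).
    assert (E (t + Rmin (d/2) (1 - t))).
    { split; [lra|]. intros u Hu. destruct (Rlt_dec u t); [apply Hbelow; lra|].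
      apply Hne. apply Hs. apply Rabs_def1; lra. }
    assert (t + Rmin (d/2) (1-t) <= t) by (apply Hub; auto). lra.
Qed.

Definition sh (n : Z) (p : pt) : pt := (fst p + IZR n, snd p).

Lemma sh_sh m n p : sh m (sh n p) = sh (n + m) p.
Proof. unfold sh; simpl. rewrite plus_IZR. f_equal; ring. Qed.

Lemma sh_0 p : sh 0 p = p.
Proof. destruct p; unfold sh; simpl. f_equal; ring. Qed.

Lemma sh_near n e p q : near e (sh n p) (sh n q) <-> near e p q.
Proof. rewrite !near_def. unfold sh; simpl. split; intros; lra. Qed.

Lemma sh_inv n p : sh n (sh (- n) p) = p.
Proof. rewrite sh_sh, Z.add_opp_diag_l, sh_0; auto. Qed.

Lemma Tinv_sh S : Tinv S <-> forall n p, S p <-> S (sh n p).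
Proof.
  split.
  - intros H.
    assert (Hpos : forall n : nat, forall p, S p <-> S (sh (Z.of_nat n) p)).
    { induction n as [|n IH]; intro p.
      - simpl. rewrite sh_0; tauto.
      - rewrite (H p), IH. replace (sh (Z.of_nat n) (T p)) with (sh (Z.of_nat (Datatypes.S n)) p); [tauto|].
        unfold sh, T; simpl fst; simpl snd. rewrite Nat2Z.inj_succ, succ_IZR. f_equal; ring. }
    intros n p. destruct (Z_le_dec 0 n) as [Hn|Hn].
    + rewrite <- (Z2Nat.id n) by lia. apply Hpos.
    + rewrite (Hpos (Z.to_nat (- n)) (sh n p)), sh_sh, Z2Nat.id by lia.
      replace (n + - n)%Z with 0%Z by lia. rewrite sh_0; tauto.
  - intros H p. rewrite (H 1%Z p). unfold sh, T. tauto.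
Qed.

Lemma opn_sh n U : opn U -> opn (fun p => U (sh n p)).
Proof.
  intros HU p Hp. destruct (HU _ Hp) as [e [He Hn]]. exists e; split; auto.
  intros q Hq. apply Hn. apply sh_near; auto.
Qed.

Lemma closed_sh n F : closed F -> closed (fun p => F (sh n p)).
Proof. exact (opn_sh n (fun p => ~ F p)). Qed.

Lemma conn_sh n S : conn S -> conn (fun p => S (sh n p)).
Proof.
  intros HS f Hf p q Hp Hq.
  rewrite <- (sh_inv (- n) p), <- (sh_inv (- n) q), Z.opp_involutive.
  apply (HS (fun z => f (sh (- n) z))); auto.
  intros z Hz. destruct (Hf (sh (- n) z)) as [e [He Hn]]; [rewrite sh_inv; auto|].
  exists e; split; auto. intros w Hw Hzw. apply Hn; [rewrite sh_inv; auto|apply sh_near; auto].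
Qed.

Lemma cpt_sh n S : cpt S -> cpt (fun p => S (sh n p)).
Proof.
  intros [H1 [M HM]]; split; [apply closed_sh; auto|].
  exists (M + Rabs (IZR n)). intros p Hp. destruct (HM _ Hp) as [A B]. unfold sh in *; simpl in *.
  pose proof (Rabs_pos (IZR n)). split; [|lra].
  replace (fst p) with ((fst p + IZR n) + - IZR n) by ring.
  eapply Rle_trans; [apply Rabs_triang|]. rewrite Rabs_Ropp. lra.
Qed.

Lemma cl_sh S n p : Tinv S -> cl S p <-> cl S (sh n p).
Proof.
  intro HS. assert (H := proj1 (Tinv_sh S) HS). split; intros Hc e He.
  - destruct (Hc e He) as [q [Hq HSq]]. exists (sh n q). split; [apply sh_near; auto|apply H; auto].
  - destruct (Hc e He) as [q [Hq HSq]]. exists (sh (- n) q). split.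
    + apply (sh_near n). rewrite sh_inv; auto.
    + apply H; auto.
Qed.

Lemma Tinv_cl S : Tinv S -> Tinv (cl S).
Proof. intros H. apply Tinv_sh. intros; apply cl_sh; auto. Qed.

(* [Up] and [Um] are the lifts of the two complementary components. *)
Record annular (Up Um A : pset) (Y : R) : Prop := {
  an_Up : opn Up; an_Um : opn Um; an_Upc : conn Up; an_Umc : conn Um;
  an_UpT : Tinv Up; an_UmT : Tinv Um;
  an_disj : forall p, Up p -> Um p -> False;
  an_A : forall p, A p <-> ~ Up p /\ ~ Um p;
  an_dense : forall p e, 0 < e -> exists q, near e p q /\ (Up q \/ Um q);
  an_Y : 0 < Y;
  an_top : forall p, Y < snd p -> Up p;
  an_bot : forall p, snd p < - Y -> Um p;
  an_conn : forall P, Tinv P -> clopen A P -> (exists p, P p) -> subset A P }.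

Definition core (Up Um : pset) : pset := fun p => cl Up p /\ cl Um p.
(** [off Um] is [Up] together with the spikes above the core, [off Up] is [Um] together with those
    below. *)
Definition off (U : pset) : pset := fun p => ~ cl U p.

Section Annular_facts.
Context (Up Um A : pset) (Y : R) (H : annular Up Um A Y).

Lemma an_cover p : cl Up p \/ cl Um p.
Proof.
  apply NNPP; intro Hn. apply not_or_and in Hn. destruct Hn as [H1 H2].
  destruct (closed_cl Up p H1) as [e1 [He1 N1]], (closed_cl Um p H2) as [e2 [He2 N2]].
  destruct (an_dense _ _ _ _ H p (Rmin e1 e2)) as [q [Hq Hq']]; [apply Rmin_glb_lt; auto|].
  destruct Hq' as [Hq'|Hq'].
  - apply (N1 q); [eapply near_min_l; eauto|apply cl_incl; auto].
  - apply (N2 q); [eapply near_min_r; eauto|apply cl_incl; auto].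
Qed.

Lemma an_Up_off p : Up p -> off Um p.
Proof.
  intros Hp Hc. destruct (an_Up _ _ _ _ H p Hp) as [e [He Hn]].
  destruct (Hc e He) as [q [Hq Hq']]. eapply (an_disj _ _ _ _ H q); eauto.
Qed.

Lemma an_Um_off p : Um p -> off Up p.
Proof.
  intros Hp Hc. destruct (an_Um _ _ _ _ H p Hp) as [e [He Hn]].
  destruct (Hc e He) as [q [Hq Hq']]. eapply (an_disj _ _ _ _ H q); eauto.
Qed.

Lemma an_off_Up p : off Um p -> cl Up p.
Proof. intro Hp. destruct (an_cover p); auto. contradiction. Qed.
Lemma an_off_Um p : off Up p -> cl Um p.
Proof. intro Hp. destruct (an_cover p); auto. contradiction. Qed.

Lemma opn_off U : opn (off U).
Proof. apply closed_cl. Qed.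

Lemma an_offUm_conn : conn (off Um).
Proof. apply (conn_between Up); [apply (an_Upc _ _ _ _ H)|intro; apply an_Up_off|intro; apply an_off_Up]. Qed.
Lemma an_offUp_conn : conn (off Up).
Proof. apply (conn_between Um); [apply (an_Umc _ _ _ _ H)|intro; apply an_Um_off|intro; apply an_off_Um]. Qed.

Lemma conn_cl S : conn S -> conn (cl S).
Proof. intro HS. apply (conn_between S); auto; intros p Hp; auto. apply cl_incl; auto. Qed.

Lemma an_trichotomy p : off Um p \/ off Up p \/ core Up Um p.
Proof. unfold off, core. destruct (classic (cl Up p)), (classic (cl Um p)); auto. Qed.

Lemma an_core_A : subset (core Up Um) A.
Proof.
  intros p [H1 H2]. apply (an_A _ _ _ _ H). split; intro Hp.
  - apply (an_Up_off p); auto.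
  - apply (an_Um_off p); auto.
Qed.

Lemma closed_core : closed (core Up Um).
Proof. apply closed_inter; apply closed_cl. Qed.

Lemma closed_A : closed A.
Proof.
  apply closed_ext with (U := fun p => ~ Up p /\ ~ Um p).
  - intro p; symmetry; apply (an_A _ _ _ _ H).
  - apply closed_inter; apply closed_compl; [apply (an_Up _ _ _ _ H)|apply (an_Um _ _ _ _ H)].
Qed.

Lemma an_A_bound p : A p -> - Y <= snd p <= Y.
Proof.
  intro Hp. apply (an_A _ _ _ _ H) in Hp. destruct Hp as [H1 H2].
  split; apply Rnot_lt_le; intro L; [apply H2, (an_bot _ _ _ _ H)|apply H1, (an_top _ _ _ _ H)]; auto.
Qed.

Lemma Tinv_A : Tinv A.
Proof.
  intro p. rewrite !(an_A _ _ _ _ H), <- (an_UpT _ _ _ _ H p), <- (an_UmT _ _ _ _ H p). tauto.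
Qed.

Lemma Tinv_core : Tinv (core Up Um).
Proof.
  intro p. unfold core. rewrite <- (Tinv_cl Up (an_UpT _ _ _ _ H) p).
  rewrite <- (Tinv_cl Um (an_UmT _ _ _ _ H) p). tauto.
Qed.

Lemma Tinv_off U : Tinv U -> Tinv (off U).
Proof. intros HU p. unfold off. rewrite <- (Tinv_cl U HU p). tauto. Qed.

(** Before its first point in [cl Um] the segment runs in [off Um], hence in [cl Up]; so this first
    point belongs to the core. *)
Lemma an_first_core p x : off Um p -> cl Um x -> exists c,
  core Up Um c /\ subset (segment p c) (segment p x) /\
  forall z, segment p c z -> z = c \/ off Um z.
Proof.
  intros Hp Hx. destruct (first_hit (cl Um) p x (closed_cl Um) Hp Hx) as [t [Ht [Ft Fs]]].
  exists (seg p x t).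
  assert (Hseg : forall s, seg p (seg p x t) s = seg p x (t * s)).
  { intro s. unfold seg; simpl. f_equal; ring. }
  split; [split; auto|split].
  - intros e He. destruct (seg_near p x (e/2)) as [d [Hd Hs]]; [lra|].
    assert (0 < t).
    { destruct (Req_dec t 0) as [->|]; [|lra]. rewrite seg0 in Ft. contradiction. }
    assert (Hm : 0 < Rmin d t) by (apply Rmin_glb_lt; lra).
    pose proof (Rmin_l d t); pose proof (Rmin_r d t).
    assert (Hoff : off Um (seg p x (t - Rmin d t / 2))) by (apply Fs; lra).
    destruct (an_off_Up _ Hoff (e/2)) as [q [Hq HUq]]; [lra|].
    exists q; split; auto. replace e with (e/2+e/2) by lra. eapply near_trans; [|exact Hq].
    apply Hs. apply Rabs_def1; lra.
  - intros z [s [Hs ->]]. rewrite Hseg. exists (t * s). split; auto. nra.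
  - intros z [s [Hs ->]]. rewrite Hseg. destruct (Req_dec (t * s) t) as [->|]; auto.
    right. apply Fs. nra.
Qed.

Lemma an_core_at x : exists c, core Up Um c /\ fst c = x.
Proof.
  assert (HY := an_Y _ _ _ _ H).
  destruct (an_first_core (x, Y + 1) (x, - Y - 1)) as [c [H1 [H2 _]]].
  - apply an_Up_off, (an_top _ _ _ _ H). simpl; lra.
  - apply cl_incl, (an_bot _ _ _ _ H). simpl; lra.
  - exists c; split; auto. destruct (H2 c (segment_r _ _)) as [t [_ ->]]. unfold seg; simpl. ring.
Qed.

Lemma closed_locc_fiber S f b : closed S -> locc S f -> closed (fun p => S p /\ f p = b).
Proof.
  intros HS Hf p Hp. destruct (classic (S p)) as [Sp|Sp].
  - destruct (Hf p Sp) as [e [He Hn]]. exists e; split; auto. intros q Hq [Sq Eq].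
    apply Hp. split; auto. rewrite <- Eq. symmetry; auto.
  - destruct (HS p Sp) as [e [He Hn]]. exists e; split; auto. intros q Hq [Sq Eq]. apply (Hn q); auto.
Qed.

(* If [K] met the core in two separated pieces containing [m] and [n], the double cover branched
   at [m] and [n] would be trivial off [K] and on each side of the core; density of [Up] and [Um] makes
   these trivializations agree, so the cover is trivial on a curve separating [m] from [n]. *)
Lemma conn_continuum_core K : cpt K -> conn K -> subset K A -> conn (fun p => K p /\ core Up Um p).
Proof.
  intros HK KC KA f Hf m n [Km Cm] [Kn Cn]. apply NNPP; intro Hne.
  assert (Kcl : closed K) by apply HK.
  assert (HKC : cpt (fun p => K p /\ core Up Um p)) by (apply cpt_inter; auto; apply closed_core).
  set (M := fun p => (K p /\ core Up Um p) /\ f p = f m).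
  set (N := fun p => (K p /\ core Up Um p) /\ f p = negb (f m)).
  assert (HM : cpt M).
  { apply (cpt_subset _ _ HKC); [apply closed_locc_fiber; auto; apply HKC|intros p [Hp _]; auto]. }
  assert (HN : closed N) by (apply closed_locc_fiber; auto; apply HKC).
  destruct (cpt_gap M N HM HN) as [eta [Heta Hgap]].
  { intros p [_ E1] [_ E2]. rewrite E1 in E2. destruct (f m); discriminate. }
  assert (Mm : M m) by (repeat split; auto; apply Cm).
  assert (Nn : N n).
  { repeat split; auto; try apply Cn. destruct (f m), (f n); simpl in *; congruence. }
  assert (HMN : forall p, K p -> core Up Um p -> M p \/ N p).
  { intros p H1 H2. unfold M, N. destruct (f p), (f m); simpl; tauto. }
  (* The frontier [X] of the neighbourhood [O] of [M] plays the role of the curve: it is closed and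
     bounded, and its points in [K] are off the core. *)
  set (O := fun z => exists m', M m' /\ near (eta / 2) m' z).
  assert (HO : opn O).
  { intros z [m' [H1 H2]]. destruct (opn_near _ _ _ H2) as [e [He Hn]]. exists e; split; auto.
    intros q Hq. exists m'; auto. }
  set (X := fun z => cl O z /\ ~ O z).
  assert (HX : closed X) by (apply closed_inter; [apply closed_cl|apply closed_compl; auto]).
  assert (XN : forall z, cl O z -> ~ N z).
  { intros z Hz Nz. destruct (Hz (eta/2)) as [q [Hq [m' [Hm' Hq']]]]; [lra|].
    apply (Hgap m' z Hm'); auto. replace eta with (eta/2 + eta/2) by lra.
    eapply near_trans; [exact Hq'|]. apply near_sym; auto. }
  assert (MO : forall z, M z -> O z).
  { intros z Hz. exists z; split; auto. apply near_refl; lra. }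
  assert (XB : exists B, forall p, X p -> Rabs (fst p) <= B /\ Rabs (snd p) <= B).
  { destruct HM as [_ [B HB]]. exists (B + eta). intros p [Hp _].
    destruct (Hp (eta/2)) as [q [Hq [m' [Hm' Hq']]]]; [lra|].
    assert (Hn : near eta m' p).
    { replace eta with (eta/2 + eta/2) by lra. eapply near_trans; [exact Hq'|apply near_sym; auto]. }
    destruct (HB m' Hm') as [B1 B2]. apply near_def in Hn. revert B1 B2.
    unfold Rabs; repeat destruct Rcase_abs; lra. }
  destruct XB as [B XB].
  assert (Hsep : separates X m n).
  { exists O, (fun z => ~ cl O z). repeat split; auto.
    - apply closed_cl.
    - intros p H1 H2. apply H2, cl_incl; auto.
    - intros p Hp. unfold X in Hp. destruct (classic (O p)); [auto|right; tauto].
    - match goal with HXp : X _ |- _ => apply HXp end.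
    - match goal with HXp : X _ |- _ => intro A1; apply A1, HXp end.
    - intro A1. apply (XN n); auto. }
  assert (XU : forall p, X p -> Rabs (snd p) <= B) by (intros p Hp; apply (XB p Hp)).
  apply (separates_not_sec_inf X m n B HX); auto.
  { intros p Hp. specialize (XU p Hp). apply Rabs_le_between in XU. lra. }
  assert (KUp : forall p, Up p -> ~ K p).
  { intros p Hp Hk. apply KA, (an_A _ _ _ _ H) in Hk. tauto. }
  assert (KUm : forall p, Um p -> ~ K p).
  { intros p Hp Hk. apply KA, (an_A _ _ _ _ H) in Hk. tauto. }
  (* As [K] is bounded, some core point lies outside it; this point links the parts of [cl Up] and
     [cl Um] outside [K]. *)
  assert (Hr : exists r, core Up Um r /\ ~ K r).
  { destruct HK as [_ [R HR]]. destruct (an_core_at (Rabs R + 1)) as [r [Hr Er]].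
    exists r; split; auto. intro Hk. destruct (HR r Hk) as [H1 _]. rewrite Er in H1.
    revert H1. unfold Rabs; repeat destruct Rcase_abs; lra. }
  destruct Hr as [r [[Cr1 Cr2] Kr]].
  assert (KcC : conn (fun p => ~ K p)).
  { apply conn_ext with (S := fun p => (cl Up p /\ ~ K p) \/ (cl Um p /\ ~ K p)).
    { intro p. assert (G := an_cover p). tauto. }
    apply (conn_union _ _ r); auto.
    - apply (conn_between Up); [apply (an_Upc _ _ _ _ H)| |intros p [Hp _]; auto].
      intros p Hp; split; [apply cl_incl|]; auto.
    - apply (conn_between Um); [apply (an_Umc _ _ _ _ H)| |intros p [Hp _]; auto].
      intros p Hp; split; [apply cl_incl|]; auto. }
  destruct (sec_off_continuum K (fun p => ~ K p) m n) as [f1 F1]; auto.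
  destruct (sec_off_continuum (cl Um) (off Um) m n) as [f2 F2]; auto.
  { apply closed_cl. } { apply conn_cl, (an_Umc _ _ _ _ H). } { apply Cm. } { apply Cn. }
  { apply opn_off. } { apply an_offUm_conn. }
  destruct (sec_off_continuum (cl Up) (off Up) m n) as [f3 F3]; auto.
  { apply closed_cl. } { apply conn_cl, (an_Upc _ _ _ _ H). } { apply Cm. } { apply Cn. }
  { apply opn_off. } { apply an_offUp_conn. }
  (* [Up] is connected and dense in [off Um] minus [K], so a single constant compares the two
     sections there. *)
  assert (G2 : exists c2, forall p, off Um p -> ~ K p -> f1 p = xorb (f2 p) c2).
  { exists (xorb (f1 (0, Y + 1)) (f2 (0, Y + 1))). intros p Hp Hk.
    assert (U0 : Up (0, Y+1)) by (apply (an_top _ _ _ _ H); simpl; lra).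
    assert (E : xorb (f1 p) (f2 p) = xorb (f1 (0, Y + 1)) (f2 (0, Y + 1))).
    { apply (sec_conn_eq (tau m n) (fun p => off Um p /\ ~ K p) (fun p => off Um p /\ ~ K p)); auto.
      - eapply sec_sub; [|exact F1]. intros ? []; auto.
      - eapply sec_sub; [|exact F2]. intros ? []; auto.
      - apply (conn_between Up); [apply (an_Upc _ _ _ _ H)| |].
        + intros q Hq. split; [apply an_Up_off|]; auto.
        + intros q [Hq _]. apply an_off_Up; auto.
      - intros ? G; exact G.
      - split; [apply an_Up_off|]; auto. }
    rewrite <- E. destruct (f1 p), (f2 p); auto. }
  assert (G3 : exists c3, forall p, off Up p -> ~ K p -> f1 p = xorb (f3 p) c3).
  { exists (xorb (f1 (0, - Y - 1)) (f3 (0, - Y - 1))). intros p Hp Hk.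
    assert (U0 : Um (0, - Y - 1)) by (apply (an_bot _ _ _ _ H); simpl; lra).
    assert (E : xorb (f1 p) (f3 p) = xorb (f1 (0, - Y - 1)) (f3 (0, - Y - 1))).
    { apply (sec_conn_eq (tau m n) (fun p => off Up p /\ ~ K p) (fun p => off Up p /\ ~ K p)); auto.
      - eapply sec_sub; [|exact F1]. intros ? []; auto.
      - eapply sec_sub; [|exact F3]. intros ? []; auto.
      - apply (conn_between Um); [apply (an_Umc _ _ _ _ H)| |].
        + intros q Hq. split; [apply an_Um_off|]; auto.
        + intros q [Hq _]. apply an_off_Um; auto.
      - intros ? G; exact G.
      - split; [apply an_Um_off|]; auto. }
    rewrite <- E. destruct (f1 p), (f3 p); auto. }
  destruct G2 as [c2 G2], G3 as [c3 G3].
  pose (h := fun p => if pred_bool (off Um p) then xorb (f2 p) c2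
                else if pred_bool (off Up p) then xorb (f3 p) c3 else f1 p).
  assert (h2 : forall p, off Um p -> h p = xorb (f2 p) c2).
  { intros p Hp. unfold h. rewrite (pred_bool_true _ Hp); auto. }
  assert (h3 : forall p, off Up p -> h p = xorb (f3 p) c3).
  { intros p Hp. unfold h. rewrite (pred_bool_false (off Um p)), (pred_bool_true _ Hp); auto.
    intro Hq. destruct (an_cover p); auto. }
  assert (h1 : forall p, ~ K p -> h p = f1 p).
  { intros p Hp. unfold h. destruct (pred_bool (off Um p)) eqn:E2.
    - symmetry; apply G2; auto. apply pred_boolP; auto.
    - destruct (pred_bool (off Up p)) eqn:E3; auto. symmetry; apply G3; auto. apply pred_boolP; auto. }
  assert (L : forall D g p, opn D -> sec (tau m n) D g -> (forall q, D q -> h q = g q) -> D p ->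
     exists e, 0 < e /\ forall q, X q -> near e p q -> xorb (h q) (tau m n p q) = xorb (h p) (tau m n p p)).
  { intros D g p HD Hg E Hp. destruct (HD p Hp) as [e1 [He1 N1]], (Hg p Hp) as [e2 [He2 N2]].
    exists (Rmin e1 e2); split; [apply Rmin_glb_lt; auto|]. intros q _ Hq.
    assert (Dq : D q) by (apply N1; eapply near_min_l; eauto).
    rewrite (E p Hp), (E q Dq). apply N2; auto. eapply near_min_r; eauto. }
  (* No point of the bounded set [X] is outside the box [B], so the condition at infinity is
     vacuous. *)
  exists h, B, false. split.
  - intros p Hp. destruct (classic (K p)) as [Kp|Kp].
    + destruct (an_trichotomy p) as [Tp|[Tp|Tp]].
      * apply (L (off Um) (fun q => xorb (f2 q) c2)); auto; [apply opn_off|apply sec_shift; auto].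
      * apply (L (off Up) (fun q => xorb (f3 q) c3)); auto; [apply opn_off|apply sec_shift; auto].
      * exfalso. destruct Hp as [Hp1 Hp2]. destruct (HMN p Kp Tp) as [Mp|Np]; [auto|].
        apply (XN p); auto.
    + apply (L (fun p => ~ K p) f1); auto.
  - intros p Hp [Ho|Ho]; destruct (XB p Hp); lra.
Qed.
End Annular_facts.

(** * Generators of the core and its tails *)

Lemma closed_Union_sh G (P : Z -> Prop) : cpt G -> closed (fun p => exists n, P n /\ G (sh (- n) p)).
Proof.
  intros [HG [M HM]].
  (* Local finiteness: since [G] is bounded, only finitely many translates come near a given
     point. *)
  assert (Hfin : forall N : nat, opn (fun z => forall n, (Z.abs n <= Z.of_nat N)%Z -> P n -> ~ G (sh (- n) z))).
  { assert (H1 : forall n, opn (fun z => P n -> ~ G (sh (- n) z))).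
    { intro n. destruct (classic (P n)) as [Hn|Hn].
      - eapply opn_ext; [|exact (closed_sh (- n) G HG)]. intro p; simpl; tauto.
      - intros p _. exists 1; split; [lra|]. intros q _ Hq. contradiction. }
    induction N as [|N IH].
    - eapply opn_ext; [|exact (H1 0%Z)]. intro p; simpl; split.
      + intros A n Hn. replace n with 0%Z by lia. auto.
      + intros A. apply A. lia.
    - eapply opn_ext; [|exact (opn_inter _ _ IH (opn_inter _ _ (H1 (Z.of_nat (S N))) (H1 (- Z.of_nat (S N))%Z)))].
      intro p; simpl; split.
      + intros [A [B C]] n Hn. destruct (Z_le_dec (Z.abs n) (Z.of_nat N)); [auto|].
        destruct (Z_le_dec 0 n).
        * replace n with (Z.of_nat (S N)) by lia. exact B.
        * replace n with (- Z.of_nat (S N))%Z by lia. exact C.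
      + intros A. split; [intros n Hn; apply A; lia|]. split; apply A; lia. }
  intros p Hp. destruct (nat_above (Rabs (fst p) + Rabs M + 1)) as [N HN].
  destruct (Hfin N p) as [e [He Hn]].
  { intros n _ Hn HGn. apply Hp. eauto. }
  exists (Rmin e 1). split; [apply Rmin_glb_lt; lra|]. intros q Hq [n [HPn HGn]].
  apply (Hn q (near_min_l _ _ _ _ Hq) n); auto.
  apply near_min_r in Hq. apply near_def in Hq. destruct (HM _ HGn) as [B _]. unfold sh in B; simpl in B.
  apply Rabs_le_between in B. rewrite opp_IZR in B.
  assert (- INR N <= IZR n <= INR N).
  { pose proof (Rle_abs (fst p)); pose proof (Rle_abs (- fst p)); pose proof (Rle_abs M).
    rewrite Rabs_Ropp in *. lra. }
  rewrite INR_IZR_INZ, <- opp_IZR in H. destruct H as [H1 H2]. apply le_IZR in H1, H2. lia.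
Qed.

Lemma conn_chain (F : nat -> pset) : (forall i, conn (F i)) -> (forall i, exists z, F i z /\ F (S i) z) ->
  conn (fun p => exists i, F i p).
Proof.
  intros HF HL f Hf. destruct (HL 0%nat) as [z0 [Hz0 _]].
  assert (Hl : forall i, locc (F i) f) by (intro i; eapply locc_sub; [|exact Hf]; intros z Hz; eauto).
  assert (E : forall i z, F i z -> f z = f z0).
  { induction i as [|i IH]; intros z Hz.
    - apply (HF 0%nat); auto.
    - destruct (HL i) as [w [Hw1 Hw2]]. rewrite <- (IH w Hw1). apply (HF (S i)); auto. }
  intros p q [i Hi] [j Hj]. rewrite (E i p), (E j q); auto.
Qed.

(** The abscissa measured to the right for [true] and to the left for [false], so that the two
    directions share one proof. *)
Definition side (s : bool) (p : pt) : R := if s then fst p else - fst p.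

Lemma side_near s e p q : near e p q -> side s p - e < side s q < side s p + e.
Proof. intro H. apply near_def in H. destruct s; simpl; lra. Qed.

Lemma closed_side_ge s a : closed (fun p => a <= side s p).
Proof.
  intros p Hp. exists (a - side s p). split; [lra|]. intros q Hq. apply (side_near s) in Hq. lra.
Qed.
Lemma closed_side_le s a : closed (fun p => side s p <= a).
Proof.
  intros p Hp. exists (side s p - a). split; [lra|]. intros q Hq. apply (side_near s) in Hq. lra.
Qed.

Section Upper.
Context (Up Um A : pset) (Y : R) (H : annular Up Um A Y).
Notation C := (core Up Um).

Lemma core_separates : separates C (0, - Y - 1) (0, Y + 1).
Proof.
  exists (off Up), (off Um). split; [apply opn_off|]. split; [apply opn_off|].
  split; [|split; [|split; [|split]]].
  - intros p H1 H2. destruct (an_cover _ _ _ _ H p); auto.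
  - intros p Hp. destruct (an_trichotomy Up Um p) as [G|[G|G]]; auto. contradiction.
  - intros p [H1 H2]. unfold off. tauto.
  - apply (an_Um_off _ _ _ _ H), (an_bot _ _ _ _ H). simpl; lra.
  - apply (an_Up_off _ _ _ _ H), (an_top _ _ _ _ H). simpl; lra.
Qed.

(* Any core point links the two sides, so no proper closed piece of the core separates them. *)
Lemma core_conn : conn C.
Proof.
  intros f Hf.
  assert (L : forall p q, C p -> C q -> f p = true -> f q = false -> False).
  { intros p q Hp Hq Ep Eq.
    assert (HS : forall r, C r -> conn (fun z => (Up z \/ z = r) \/ (Um z \/ z = r))).
    { intros r [R1 R2]. apply (conn_union _ _ r); auto.
      - apply (conn_between Up); [apply (an_Upc _ _ _ _ H)|intros z; auto|].
        intros z [Hz| ->]; auto. apply cl_incl; auto.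
      - apply (conn_between Um); [apply (an_Umc _ _ _ _ H)|intros z; auto|].
        intros z [Hz| ->]; auto. apply cl_incl; auto. }
    assert (HUC : forall z, Up z -> ~ C z).
    { intros z Hz [_ Hc]. apply (an_Up_off _ _ _ _ H z); auto. }
    assert (HMC : forall z, Um z -> ~ C z).
    { intros z Hz [Hc _]. apply (an_Um_off _ _ _ _ H z); auto. }
    assert (Ub : Um (0, - Y - 1)) by (apply (an_bot _ _ _ _ H); simpl; lra).
    assert (Ut : Up (0, Y + 1)) by (apply (an_top _ _ _ _ H); simpl; lra).
    assert (HY : forall z, C z -> snd z <= Y).
    { intros z Hz. apply (an_A_bound _ _ _ _ H), (an_core_A _ _ _ _ H z Hz). }
    apply (union_not_separates (fun z => C z /\ f z = true) (fun z => C z /\ f z = false)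
             (0, - Y - 1) (0, Y + 1) Y).
    - apply closed_locc_fiber; auto. apply closed_core.
    - apply closed_locc_fiber; auto. apply closed_core.
    - intros z [Hz _]; auto.
    - intros z [Hz _]; auto.
    - intros [Hz _]. apply (HMC _ Ub Hz).
    - intros [Hz _]. apply (HUC _ Ut Hz).
    - intros [Hz _]. apply (HMC _ Ub Hz).
    - intros [Hz _]. apply (HUC _ Ut Hz).
    - apply (not_separates_conn _ _ _ _ (HS q Hq)); auto.
      intros z [[Hz| ->]|[Hz| ->]] [Cz Fz]; try congruence; [apply (HUC z)|apply (HMC z)]; auto.
    - apply (not_separates_conn _ _ _ _ (HS p Hp)); auto.
      intros z [[Hz| ->]|[Hz| ->]] [Cz Fz]; try congruence; [apply (HUC z)|apply (HMC z)]; auto.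
    - left. intros z [_ E1] [_ E2]. congruence.
    - apply (separates_mono C); auto using core_separates.
      + apply closed_union; apply closed_locc_fiber; auto; apply closed_core.
      + intros z Hz. destruct (f z) eqn:E; auto.
      + intros [[Hz _]|[Hz _]]; apply (HMC _ Ub Hz).
      + intros [[Hz _]|[Hz _]]; apply (HUC _ Ut Hz). }
  intros p q Hp Hq. destruct (f p) eqn:Ep, (f q) eqn:Eq; auto; exfalso; eauto.
Qed.

Definition generates (G S : pset) : Prop :=
  cpt G /\ conn G /\ subset G S /\ forall p, S p -> exists n, G (sh (- n) p).

Lemma generates_incl G S n p : Tinv S -> subset G S -> G (sh n p) -> S p.
Proof. intros HS HG Hp. apply (proj1 (Tinv_sh S) HS n). auto. Qed.

(** A generator that meets its translate is needed to make unions of consecutive translates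
    connected. [I n] says that [G0] and its translate by [n] lie in a common continuum of the core.
    The translates with [I n] and those without cover disjoint closed parts of the connected core,
    so [I 1] holds, and its witness is the new generator. *)
Lemma chain_generator G0 : generates G0 C ->
  exists G, generates G C /\ exists z, G z /\ G (sh (-1) z).
Proof.
  intros [H1 [H2 [H3 H4]]].
  pose (I := fun n : Z => exists K, cpt K /\ conn K /\ subset K C /\ subset G0 K /\
                subset (fun p => G0 (sh (- n) p)) K).
  assert (HCT := Tinv_core _ _ _ _ H).
  destruct (an_core_at _ _ _ _ H 0) as [c0 [Hc0 _]]. destruct (H4 c0 Hc0) as [n0 Hn0].
  set (g0 := sh (- n0) c0) in *.
  assert (Hstep : forall m n z, I m -> G0 (sh (- m) z) -> G0 (sh (- n) z) -> I n).
  { intros m n z [K [K1 [K2 [K3 [K4 K5]]]]] Hm Hn.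
    exists (fun p => K p \/ G0 (sh (- n) p)). split; [|split; [|split; [|split]]].
    - apply cpt_union; auto. apply cpt_sh; auto.
    - apply (conn_union _ _ z); auto. apply conn_sh; auto.
    - intros p [Hp|Hp]; auto. eapply generates_incl; eauto.
    - intros p Hp; auto.
    - intros p Hp; auto. }
  assert (I0 : I 0%Z).
  { exists G0. split; [auto|]. split; [auto|]. split; [auto|]. split; intros p Hp; auto.
    rewrite sh_0 in Hp; auto. }
  assert (I1 : I 1%Z).
  { apply NNPP; intro Hno.
    assert (Hclo : clopen C (fun p => exists n, I n /\ G0 (sh (- n) p))).
    { split; [|split].
      - intros p [n [_ Hn]]. eapply generates_incl; eauto.
      - apply closed_Union_sh; auto.
      - apply closed_ext with (U := fun p => exists n, ~ I n /\ G0 (sh (- n) p)).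
        + intro p; split.
          * intros [n [Hn Hp]]. split; [eapply generates_incl; eauto|].
            intros [m [Hm Hp']]. apply Hn. eapply Hstep; eauto.
          * intros [Hp Hnp]. destruct (H4 p Hp) as [n Hn]. exists n; split; auto.
            intro HI. apply Hnp; eauto.
        + apply closed_Union_sh; auto. }
    apply (conn_no_clopen C _ g0 (sh 1 g0) core_conn Hclo).
    - exists 0%Z. split; auto. rewrite sh_0; auto.
    - apply H3 in Hn0. apply (proj1 (Tinv_sh C) HCT 1%Z g0); auto.
    - intros [m [Hm Hp]]. apply Hno. apply (Hstep m 1%Z (sh 1 g0)); auto.
      rewrite sh_sh. replace (1 + - (1))%Z with 0%Z by lia. rewrite sh_0; auto. }
  destruct I1 as [K [K1 [K2 [K3 [K4 K5]]]]]. exists K. split.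
  - split; [auto|]. split; [auto|]. split; [auto|]. intros p Hp. destruct (H4 p Hp) as [n Hn]. eauto.
  - exists (sh 1 g0).
    assert (E : sh (-1) (sh 1 g0) = g0).
    { rewrite sh_sh. replace (1 + - (1))%Z with 0%Z by lia. apply sh_0. }
    split; [apply K5; change (G0 (sh (-1) (sh 1 g0)))|]; rewrite E; auto.
Qed.

Context (G : pset) (HG : generates G C) (HGG : exists z, G z /\ G (sh (-1) z)).
Context (g : R) (Hg : forall p, G p -> Rabs (fst p) <= g).

Definition sgn (s : bool) (n : Z) : Z := if s then n else (- n)%Z.

(** A tail of the core in direction [s]. It is connected because [G] meets its translate, it
    contains every core point beyond [k + g], and it stays beyond [k - g]. *)
Definition ray (s : bool) (k : Z) : pset := fun p => exists n, (k <= sgn s n)%Z /\ G (sh (- n) p).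

Lemma sgn_invol s n : sgn s (sgn s n) = n.
Proof. destruct s; simpl; lia. Qed.

Lemma ray_closed s k : closed (ray s k).
Proof. apply closed_Union_sh. apply HG. Qed.

Lemma ray_core s k : subset (ray s k) C.
Proof.
  intros p [n [_ Hn]]. eapply generates_incl; [apply (Tinv_core _ _ _ _ H)|apply HG|exact Hn].
Qed.

Lemma ray_side s k p : ray s k p -> IZR k - g <= side s p.
Proof.
  intros [n [Hk Hn]]. apply Hg, Rabs_le_between in Hn. unfold sh in Hn; simpl in Hn.
  apply IZR_le in Hk. rewrite opp_IZR in Hn. destruct s; simpl in *; rewrite ?opp_IZR in *; lra.
Qed.

Lemma ray_covers s k p : C p -> IZR k + g <= side s p -> ray s k p.
Proof.
  intros Hp Hs. destruct HG as [_ [_ [_ G4]]]. destruct (G4 p Hp) as [n Hn]. exists n; split; auto.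
  apply Hg, Rabs_le_between in Hn. unfold sh in Hn; simpl in Hn.
  apply le_IZR. rewrite opp_IZR in Hn. destruct s; simpl in *; rewrite ?opp_IZR in *; lra.
Qed.

Lemma ray_conn s k : conn (ray s k).
Proof.
  apply conn_ext with (S := fun p => exists i, G (sh (- sgn s (k + Z.of_nat i)) p)).
  - intro p; split.
    + intros [i Hi]. exists (sgn s (k + Z.of_nat i)). rewrite sgn_invol. split; auto. lia.
    + intros [n [Hk Hn]]. exists (Z.to_nat (sgn s n - k)). rewrite Z2Nat.id by lia.
      replace (k + (sgn s n - k))%Z with (sgn s n) by lia. rewrite sgn_invol; auto.
  - apply conn_chain.
    + intro i. apply conn_sh, HG.
    + intro i. destruct HGG as [z [Hz1 Hz2]]. rewrite Nat2Z.inj_succ.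
      set (n := (k + Z.of_nat i)%Z). replace (k + Z.succ (Z.of_nat i))%Z with (n + 1)%Z by lia.
      destruct s; unfold sgn.
      * exists (sh n z). rewrite !sh_sh. replace (n + - n)%Z with 0%Z by lia.
        replace (n + - (n + 1))%Z with (-1)%Z by lia. rewrite sh_0; auto.
      * exists (sh (- (n + 1)) z). rewrite !sh_sh. replace (- (n + 1) + - - n)%Z with (-1)%Z by lia.
        replace (- (n + 1) + - - (n + 1))%Z with 0%Z by lia. rewrite sh_0; auto.
Qed.

Lemma ray_far s k R : exists p, ray s k p /\ R < side s p.
Proof.
  destruct (an_core_at _ _ _ _ H (if s then Rabs (IZR k) + Rabs g + Rabs R + 1
     else - (Rabs (IZR k) + Rabs g + Rabs R + 1))) as [c [Hc Ec]].
  pose proof (Rle_abs (IZR k)); pose proof (Rle_abs g); pose proof (Rle_abs R).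
  pose proof (Rabs_pos (IZR k)); pose proof (Rabs_pos g); pose proof (Rabs_pos R).
  exists c. split; [apply ray_covers; auto|]; destruct s; simpl; rewrite Ec; lra.
Qed.

Lemma int_above x : exists k : Z, x < IZR k <= x + 1.
Proof. exists (up x). destruct (archimed x). lra. Qed.

Lemma clUm_bound p : cl Um p -> snd p <= Y.
Proof.
  intro Hc. apply Rnot_lt_le; intro L.
  apply (an_Up_off _ _ _ _ H p); auto. apply (an_top _ _ _ _ H); auto.
Qed.

Lemma clUm_out R : exists p, cl Um p /\ out R p.
Proof.
  exists (0, - Y - Rabs R - 1). assert (HY := an_Y _ _ _ _ H).
  pose proof (Rabs_pos R); pose proof (Rle_abs R). split.
  - apply cl_incl, (an_bot _ _ _ _ H). simpl; lra.
  - right; simpl. unfold Rabs at 1; destruct Rcase_abs; lra.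
Qed.

(* Janiszewski's theorem for [cl Um] and the half-plane [a <= side s], to which a [ray] is added in
   order to make the intersection connected. *)
Lemma escape s t a : off Um t -> side s t < a - 2 * g - 2 ->
  exists L, cpt L /\ conn L /\ subset L (off Um) /\ L t /\ (exists b, L b /\ Y + 2 < snd b) /\
    forall z, L z -> snd z <= Y -> side s z < a.
Proof.
  intros Ht Hs.
  (* With [a - g - 1 < k <= a - g] the ray contains the part of the core in [a <= side s] and stays
     beyond [a - 2 * g - 1], so it misses the vertical line through [t]. *)
  destruct (int_above (a - g - 1)) as [k [Hk1 Hk2]].
  (* The half-plane is cut off at [Y + 1]: [E] is then bounded above, and [F] still contains every
     point of [cl Um] in the half-plane. *)
  pose (F := fun p => a <= side s p /\ snd p <= Y + 1).
  pose (E := fun p => F p \/ ray s k p).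
  pose (b := (fst t, Rabs (snd t) + Y + 4)).
  assert (HY := an_Y _ _ _ _ H).
  assert (Hb : Y + 2 < snd b) by (unfold b; simpl; pose proof (Rabs_pos (snd t)); lra).
  assert (Ub : Up b) by (apply (an_top _ _ _ _ H); lra).
  assert (Eline : forall z, fst z = fst t -> ~ E z).
  { intros z Hz. assert (Ez : side s z = side s t) by (destruct s; simpl; rewrite Hz; auto).
    intros [[A1 _]|A1].
    - assert (0 <= g); [|lra]. destruct HGG as [w [Hw _]]. apply Hg in Hw. pose proof (Rabs_pos (fst w)). lra.
    - apply ray_side in A1. lra. }
  assert (EY : forall z, E z -> snd z <= Y + 1).
  { intros z [[_ A1]|A1]; auto. apply ray_core in A1. destruct A1 as [_ A1]. apply clUm_bound in A1. lra. }
  assert (CF : closed F) by (apply closed_inter; [apply closed_side_ge|apply closed_halfy_le]).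
  assert (CE : closed E) by (apply closed_union; auto; apply ray_closed).
  assert (Hns : ~ separates (fun p => cl Um p \/ E p) t b).
  { apply (union_not_separates (cl Um) E t b (Y + 1)); auto.
    - apply closed_cl.
    - intros p Hp. apply clUm_bound in Hp. lra.
    - intro A1. apply clUm_bound in A1. lra.
    - apply (not_separates_conn _ _ _ (off Um)); auto.
      + apply (an_offUm_conn _ _ _ _ H).
      + apply (an_Up_off _ _ _ _ H); auto.
    - apply (not_separates_conn _ _ _ (fun z => fst z = fst t)); auto.
      apply conn_convex. intros p q Hp Hq z [u [Hu ->]]. unfold seg; simpl. rewrite Hp, Hq. ring.
    - right. split.
      + apply (conn_attach (ray s k)); [apply ray_conn| |].
        * intros p Hp. split; [apply ray_core in Hp; apply Hp|right; auto].
        * intros p [P1 [P2|P2]].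
          2:{ exists (fun z => z = p). split; [apply conn_point|]. split.
              - intros z ->. split; auto. right; auto.
              - split; auto. exists p; auto. }
          destruct (classic (cl Up p)) as [P3|P3].
          { exists (fun z => z = p). split; [apply conn_point|]. split.
            - intros z ->. split; auto. left; auto.
            - split; auto. exists p; split; auto. apply ray_covers; [split; auto|].
              destruct P2; lra. }
          (* The vertical segment up to [cl Up] stays in [cl Um] and ends at a core point with the
             same abscissa, which the ray contains. *)
          destruct (first_hit (cl Up) p (fst p, Y + 1)) as [u [Hu [Fu Fs]]]; auto.
          { apply closed_cl. }
          { apply cl_incl, (an_top _ _ _ _ H). simpl; lra. }
          set (c := seg p (fst p, Y + 1) u) in *.
          assert (Hseg : forall z, segment p c z -> fst z = fst p /\ snd z <= Y + 1 /\ (z = c \/ off Up z)).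
          { intros z [v [Hv ->]].
            assert (Ec : seg p c v = seg p (fst p, Y + 1) (u * v)).
            { unfold c, seg; simpl. f_equal; ring. }
            rewrite Ec. split; [unfold seg; simpl; ring|]. split.
            - unfold seg; simpl. destruct P2. assert (0 <= u * v <= 1) by nra. nra.
            - destruct (Req_dec (u * v) u) as [->|]; auto. right. apply Fs. nra. }
          assert (Hc : cl Um c).
          { intros e He. destruct (seg_near p (fst p, Y+1) (e/2)) as [d [Hd Hsd]]; [lra|].
            assert (0 < u).
            { destruct (Req_dec u 0) as [->|]; [|lra]. unfold c in Fu. rewrite seg0 in Fu. contradiction. }
            assert (Hm : 0 < Rmin d u) by (apply Rmin_glb_lt; lra).
            pose proof (Rmin_l d u); pose proof (Rmin_r d u).
            assert (Hoff : off Up (seg p (fst p, Y+1) (u - Rmin d u / 2))) by (apply Fs; lra).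
            destruct (an_off_Um _ _ _ _ H _ Hoff (e/2)) as [q [Hq HUq]]; [lra|].
            exists q; split; auto. replace e with (e/2+e/2) by lra. eapply near_trans; [|exact Hq].
            apply Hsd. apply Rabs_def1; lra. }
          exists (segment p c). split; [apply conn_segment|]. split; [|split; [apply segment_l|]].
          { intros z Hz. destruct (Hseg z Hz) as [Z1 [Z2 Z3]]. split.
            - destruct Z3 as [->|Z3]; auto. apply (an_off_Um _ _ _ _ H); auto.
            - left. split; auto. destruct P2. unfold side in *. rewrite Z1. auto. }
          { exists c. split; [apply segment_r|]. apply ray_covers; [split; auto|].
            destruct (Hseg c (segment_r _ _)) as [Z1 _]. destruct P2. unfold side in *. rewrite Z1. lra. }
      + intros R. destruct (ray_far s k (Rabs R)) as [p [Hp Hpr]]. exists p. split; [|split].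
        * apply ray_core in Hp; apply Hp.
        * right; auto.
        * left. pose proof (Rle_abs R). revert Hpr. unfold side. destruct s; unfold Rabs at 2; destruct Rcase_abs; lra. }
  destruct (not_separates_reach (fun p => cl Um p \/ E p) t b) as [L [L1 [L2 [L3 [L4 L5]]]]]; auto.
  - apply closed_union; auto. apply closed_cl.
  - intros [A1|A1]; auto. apply (Eline t); auto.
  - intros [A1|A1]; [apply clUm_bound in A1; lra|]. apply (Eline b); auto.
  - exists L. split; [|split; [|split; [|split; [|split]]]]; auto.
    + intros z Hz A1. apply (L3 z Hz); auto.
    + exists b; auto.
    + intros z Hz Hzy. apply Rnot_le_lt; intro A1. apply (L3 z Hz). right; left. split; auto. lra.
Qed.
End Upper.

(** * Wide continua above the core *)

Definition spike_of (D : pset) (p z : pt) : Prop := exists S, conn S /\ subset S D /\ S p /\ S z.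

Lemma spike_of_conn D p : conn (spike_of D p).
Proof.
  apply conn_ext with (S := fun z => exists x : {S | conn S /\ subset S D /\ S p}, proj1_sig x z).
  - intro z; split.
    + intros [[S [H1 [H2 H3]]] Hz]. exists S; auto.
    + intros [S [H1 [H2 [H3 H4]]]]. exists (exist _ S (conj H1 (conj H2 H3))). exact H4.
  - apply (conn_Union _ _ p); intros [S HS]; apply HS.
Qed.

Lemma spike_of_sub D p : subset (spike_of D p) D.
Proof. intros z [S [H1 [H2 [H3 H4]]]]; auto. Qed.

Lemma spike_of_refl (D : pset) p : D p -> spike_of D p p.
Proof.
  intro Hp. exists (fun z => z = p). split; [apply conn_point|]. split; auto.
  intros z ->; auto.
Qed.

Lemma spike_of_max (D : pset) p S z : conn S -> subset S D -> spike_of D p z -> S z ->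
  subset S (spike_of D p).
Proof.
  intros H1 H2 Hz Sz w Hw. exists (fun x => spike_of D p x \/ S x). split; [|split; [|split]]; auto.
  - apply (conn_union _ _ z); auto. apply spike_of_conn.
  - intros x [Hx|Hx]; auto. apply spike_of_sub in Hx; auto.
  - left. apply spike_of_refl. destruct Hz as [S' [A1 [A2 [A3 A4]]]]. auto.
Qed.

Definition finite_width (S : pset) : Prop := exists M, forall p q, S p -> S q -> fst p - fst q <= M.
Definition wide (S : pset) (m : R) : Prop := exists p q, S p /\ S q /\ m < fst p - fst q.

Lemma int_shift x y : exists n : Z, y < x + IZR n <= y + 1.
Proof.
  exists (up (y - x)). destruct (archimed (y - x)). lra.
Qed.

Section Upper_spikes.
Context (Up Um A : pset) (Y : R) (H : annular Up Um A Y).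
Notation C := (core Up Um).

(** The translates of a compact set are locally finite, so those of [P] form an invariant clopen
    part of [A]; since [A] is connected in the annulus, this is all of [A]. In particular a compact
    clopen piece cannot avoid the core. *)
Lemma cpt_clopen_translates P : cpt P -> clopen A P -> (exists p, P p) ->
  forall p, A p -> exists n, P (sh (- n) p).
Proof.
  intros HP [P1 [P2 P3]] [p0 Hp0].
  assert (HA := proj1 (Tinv_sh A) (Tinv_A _ _ _ _ H)).
  apply (an_conn _ _ _ _ H (fun p => exists n, P (sh (- n) p))).
  - apply Tinv_sh. intros m p. split; intros [n Hn].
    + exists (n + m)%Z. rewrite sh_sh. replace (m + - (n + m))%Z with (- n)%Z by lia. auto.
    + exists (n - m)%Z. rewrite sh_sh in Hn. replace (- (n - m))%Z with (m + - n)%Z by lia. auto.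
  - split; [|split].
    + intros p [n Hn]. apply (HA (- n)%Z). auto.
    + apply closed_ext with (U := fun p => exists n, True /\ P (sh (- n) p)).
      * intro p; split; [intros [n [_ Hn]]|intros [n Hn]]; eauto.
      * apply closed_Union_sh; auto.
    + intros p Hp. destruct (classic (A p)) as [Ap|Ap].
      * assert (Hn : exists n, P (sh (- n) p)) by (apply NNPP; intro; tauto).
        destruct Hn as [n Hn]. destruct (P3 (sh (- n) p)) as [e [He Hne]]; [tauto|].
        exists e; split; auto. intros q Hq [Aq Hq']. apply (Hne (sh (- n) q)).
        -- apply sh_near; auto.
        -- split; [apply HA; auto|]. intro; apply Hq'; eauto.
      * destruct (closed_A _ _ _ _ H p Ap) as [e [He Hne]]. exists e; split; auto.
        intros q Hq [Aq _]. apply (Hne q); auto.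
  - exists p0, 0%Z. simpl. rewrite sh_0; auto.
Qed.

Definition upper : pset := fun p => A p /\ off Um p.

Lemma upper_T : Tinv upper.
Proof.
  intro p. unfold upper. rewrite <- (Tinv_A _ _ _ _ H p), <- (Tinv_off Um (an_UmT _ _ _ _ H) p). tauto.
Qed.

Context (NI : forall S, conn S -> subset S upper -> finite_width S).

(** Otherwise the spike is closed, and compact because its width is finite. A small neighbourhood of
    it in [A] then stays off the core, and [continuum_or_cut] yields either a continuum enlarging
    the spike or a compact clopen piece of [A] off the core; both are impossible. *)
Lemma spike_touches_core p : upper p -> exists c, C c /\ cl (spike_of upper p) c.
Proof.
  intros Hp. apply NNPP; intro Hno.
  set (Sp := spike_of upper p) in *.
  assert (Spp : Sp p) by (apply spike_of_refl; auto).
  assert (HSc : conn Sp) by apply spike_of_conn.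
  assert (HSs : subset Sp upper) by apply spike_of_sub.
  destruct (NI Sp HSc HSs) as [M HM].
  assert (HA := closed_A _ _ _ _ H).
  assert (Hcl : subset (cl Sp) upper).
  { intros z Hz. split.
    - apply cl_closed; auto. eapply cl_mono; [|exact Hz]. intros w Hw. apply HSs; auto.
    - intro Hc. apply Hno. exists z; split; auto. split; auto.
      apply cl_closed; [apply closed_cl|]. eapply cl_mono; [|exact Hz].
      intros w Hw. apply (an_off_Up _ _ _ _ H), HSs; auto. }
  assert (HSeq : subset (cl Sp) Sp).
  { apply (spike_of_max upper p (cl Sp) p); auto; [apply conn_cl; auto|apply cl_incl; auto]. }
  assert (HB : forall z, Sp z -> Rabs (fst z) <= Rabs (fst p) + Rabs M /\ Rabs (snd z) <= Rabs Y).
  { intros z Hz. assert (B1 := HM z p Hz Spp). assert (B2 := HM p z Spp Hz).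
    assert (B3 := an_A_bound _ _ _ _ H z (proj1 (HSs z Hz))).
    revert B1 B2 B3. unfold Rabs; repeat destruct Rcase_abs; lra. }
  assert (HSk : cpt Sp).
  { split.
    - apply closed_ext with (U := cl Sp); [|apply closed_cl]. intro z; split; [auto|apply cl_incl].
    - exists (Rabs (fst p) + Rabs M + Rabs Y). intros z Hz. destruct (HB z Hz).
      pose proof (Rabs_pos (fst p)); pose proof (Rabs_pos M); pose proof (Rabs_pos Y). lra. }
  destruct (cpt_gap Sp (cl Um) HSk (closed_cl Um)) as [d [Hd Hgap]].
  { intros z Hz. apply (HSs z Hz). }
  set (N := fun z => exists s, Sp s /\ near (d/2) s z).
  assert (HN : opn N).
  { intros z [s [H1 H2]]. destruct (opn_near _ _ _ H2) as [e [He Hn]]. exists e; split; auto.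
    intros q Hq. exists s; auto. }
  set (K := fun z => cl N z /\ A z).
  assert (HK1 : subset K upper).
  { intros z [Hz1 Hz2]. split; auto. destruct (Hz1 (d/2)) as [q [Hq [s [Hs Hsq]]]]; [lra|].
    apply (Hgap s z Hs). replace d with (d/2+d/2) by lra.
    eapply near_trans; [exact Hsq|apply near_sym; auto]. }
  assert (HK : cpt K).
  { split; [apply closed_inter; auto; apply closed_cl|].
    exists (Rabs (fst p) + Rabs M + Rabs Y + d). intros z [Hz1 Hz2].
    destruct (Hz1 (d/2)) as [q [Hq [s [Hs Hsq]]]]; [lra|].
    assert (Hn : near d s z).
    { replace d with (d/2 + d/2) by lra. eapply near_trans; [exact Hsq|apply near_sym; auto]. }
    destruct (HB s Hs) as [B1 B2]. apply near_def in Hn.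
    pose proof (Rabs_pos (fst p)); pose proof (Rabs_pos M); pose proof (Rabs_pos Y).
    apply Rabs_le_between in B1, B2. split; apply Rabs_le; lra. }
  destruct (continuum_or_cut K (fun z => z = p) (fun z => ~ N z)) as [[L [L1 [L2 [L3 [[q [L4 ->]] [w [L5 L6]]]]]]]|[P [P1 [P2 P3]]]]; auto.
  - apply (closed_ext (segment p p)); [|apply cpt_segment]. intro z; split.
    + intros [t [_ ->]]. destruct p; unfold seg; simpl. f_equal; ring.
    + intros ->. apply segment_l.
  - apply closed_compl; auto.
  - apply L6. exists w. split; [|apply near_refl; lra].
    apply (spike_of_max upper p L p); auto. intros z Hz; auto.
  - assert (PN : forall z, P z -> N z).
    { intros z Hz. apply NNPP; intro Hn. apply (P3 z); auto. apply P1; auto. }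
    destruct P1 as [Q1 [Q2 Q3]].
    assert (Ppp : P p).
    { apply P2; auto. split; [apply cl_incl|apply Hp]. exists p; split; auto. apply near_refl; lra. }
    destruct (an_core_at _ _ _ _ H 0) as [c [Hc _]].
    destruct (cpt_clopen_translates P) with (p := c) as [n Hn].
    + apply (cpt_subset K); auto.
    + split; [|split]; auto.
      * intros z Hz. apply Q1 in Hz. apply Hz.
      * apply closed_ext with (U := fun z => (A z /\ ~ N z) \/ (K z /\ ~ P z)).
        -- intro z. split.
           ++ intros [[Z1 Z2]|[[_ Z1] Z2]]; split; auto.
           ++ intros [Z1 Z2]. destruct (classic (N z)) as [Z3|Z3]; auto.
              right. split; auto. split; auto. apply cl_incl; auto.
        -- apply closed_union; auto. apply closed_inter; auto. apply closed_compl; auto.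
    + exists p; auto.
    + apply (an_core_A _ _ _ _ H); auto.
    + assert (U1 : upper (sh (- n) c)) by (apply HK1, Q1; auto).
      apply (proj1 (Tinv_sh upper) upper_T (- n)%Z) in U1. destruct U1 as [_ U1]. apply U1, Hc.
Qed.

(** Unlike [upper], this is a closed set: limits of deep continua do not fall into the core. *)
Definition deep (d : R) : pset := fun z => A z /\ forall x, cl Um x -> ~ near d z x.

Lemma deep_closed d : closed (deep d).
Proof.
  apply closed_inter; [apply (closed_A _ _ _ _ H)|].
  apply closed_ext with (U := fun z => ~ exists x, cl Um x /\ near d z x).
  - intro z; split; [intros Hn x H1 H2; apply Hn; eauto|intros Hn [x [H1 H2]]; eapply Hn; eauto].
  - apply closed_compl. intros z [x [H1 H2]]. apply near_sym in H2.
    destruct (opn_near d x z H2) as [e [He Hn]]. exists e; split; auto.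
    intros q Hq. exists x; split; auto. apply near_sym; auto.
Qed.

Lemma deep_T d : Tinv (deep d).
Proof.
  apply Tinv_sh. intros n p. unfold deep.
  rewrite <- (proj1 (Tinv_sh A) (Tinv_A _ _ _ _ H) n p).
  assert (HU := proj1 (Tinv_sh (cl Um)) (Tinv_cl Um (an_UmT _ _ _ _ H))).
  split; intros [H1 H2]; split; auto; intros x Hx Hn.
  - apply (H2 (sh (- n) x)); [apply HU; auto|]. apply (sh_near n). rewrite sh_inv; auto.
  - apply (H2 (sh n x)); [apply HU; auto|]. apply sh_near; auto.
Qed.

Lemma deep_upper d : 0 < d -> subset (deep d) upper.
Proof.
  intros Hd z [H1 H2]. split; auto. intro Hc. apply (H2 z Hc). apply near_refl; auto.
Qed.

Lemma side_wide (L : pset) s m p q : L p -> L q -> m < side s p - side s q -> wide L m.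
Proof. intros Hp Hq Hm. destruct s; simpl in Hm; [exists p, q|exists q, p]; repeat split; auto; lra. Qed.

(** A continuum in [B] leads from the end [b] to horizontal distance [m + 1]. Either it is deep
    throughout, and is the wanted [L], or [B] has a shallow point within [m + 1] of its end. *)
Lemma end_wide_or_shallow B d s m b b' : 0 < d -> 0 <= m -> cpt B -> conn B -> subset B A -> B b -> B b' ->
  side s b + m + 1 < side s b' ->
  (exists L, cpt L /\ conn L /\ subset L B /\ subset L (deep d) /\ wide L m) \/
  (exists q, B q /\ side s q <= side s b + m + 1 /\ ~ deep d q).
Proof.
  intros Hd Hm HB HBc HBA Hb Hb' Hs.
  set (a := side s b + m + 1) in *.
  destruct (continuum_or_cut (fun z => B z /\ side s z <= a) (segment b b) (fun z => a <= side s z))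
    as [[L [L1 [L2 [L3 [[p [L4 [t [_ Et]]]] [w [L5 L6]]]]]]]|[P [[P1 [P2 P3]] [P4 P5]]]].
  - apply cpt_inter; auto. apply closed_side_le.
  - apply cpt_segment.
  - apply closed_side_ge.
  - assert (p = b) as ->.
    { rewrite Et. destruct b; unfold seg; simpl. f_equal; ring. }
    destruct (classic (subset L (deep d))) as [HLd|HLd].
    + left. exists L. repeat split; auto; try apply L1. { intros z Hz; apply L3; auto. } { apply HLd; auto. }
      { intros x Hx. apply (HLd p); auto. }
      apply (side_wide L s m w b); auto. unfold a in L6; lra.
    + right. apply not_all_ex_not in HLd. destruct HLd as [q Hq]. apply imply_to_and in Hq.
      destruct Hq as [Lq Hq]. exists q. destruct (L3 q Lq). auto.
  - exfalso. apply (conn_no_clopen B P b b'); auto.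
    + split; [|split]; auto.
      * intros z Hz. apply P1 in Hz. apply Hz.
      * apply closed_ext with (U := fun z => ((B z /\ side s z <= a) /\ ~ P z) \/ (B z /\ a <= side s z)).
        -- intro z. split.
           ++ intros [[[Z1 _] Z2]|[Z1 Z2]]; split; auto. intro Pz. apply (P5 z); auto.
           ++ intros [Z1 Z2]. destruct (Rle_dec (side s z) a); auto. right; split; auto; lra.
        -- apply closed_union; auto. apply closed_inter; [apply HB|apply closed_side_ge].
    + apply P4; [split; auto; unfold a; lra|apply segment_l].
    + intro Pb. apply P1 in Pb. destruct Pb as [_ Pb]. lra.
Qed.

Context (G : pset) (HG : generates G C) (HGG : exists z, G z /\ G (sh (-1) z)).
Context (g : R) (Hg : forall p, G p -> Rabs (fst p) <= g).

(** The segment from [q] to a point of [cl Um] closer than [d] meets the core, and from there a tail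
    of the core leads to infinity. Such an arm prolongs a shallow end of a continuum without leaving
    the [d]-neighbourhood of [cl Um]. *)
Lemma arm s k d q : 0 < d <= 1 -> upper q -> ~ deep d q -> IZR k + g + 1 <= side s q ->
  exists L, closed L /\ conn L /\ L q /\
    (forall z, L z -> IZR k - g <= side s z /\ - Y <= snd z <= Y /\ ~ Um z /\
                      exists x, cl Um x /\ near d z x) /\
    (forall R, exists p, L p /\ R < side s p).
Proof.
  intros Hd [Aq Oq] Hq Hs.
  assert (Hx : exists x, cl Um x /\ near d q x).
  { apply NNPP; intro Hn. apply Hq. split; auto. intros x H1 H2. eauto. }
  destruct Hx as [x [Hx Hqx]].
  destruct (an_first_core _ _ _ _ H q x Oq Hx) as [c [Hc [Hsub Hoff]]].
  assert (Hball : forall z, segment q c z -> near d x z).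
  { intros z Hz. apply Hsub in Hz. apply (convex_near d x q x); auto; [apply near_sym; auto|apply near_refl; lra]. }
  assert (Hqb : forall z, segment q c z -> side s q - 1 <= side s z).
  { intros z [t [Ht ->]]. assert (Hn := Hsub c (segment_r _ _)). destruct Hn as [u [Hu Ec]].
    apply near_def in Hqx. rewrite Ec. unfold seg, side; simpl. destruct s; assert (0 <= t * u <= 1) by nra; nra. }
  assert (Hrc : ray G s k c).
  { apply (ray_covers Up Um G HG g Hg); auto. assert (B := Hqb c (segment_r _ _)). lra. }
  exists (fun z => segment q c z \/ ray G s k z). split; [|split; [|split; [|split]]].
  - apply closed_union; [apply cpt_segment|apply (ray_closed _ _ G HG)].
  - apply (conn_union _ _ c); auto; [apply conn_segment|apply (ray_conn _ _ G HG HGG)|apply segment_r].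
  - left; apply segment_l.
  - intros z [Hz|Hz].
    + split; [|split; [|split]].
      * assert (B := Hqb z Hz). assert (0 <= g); [|lra].
        destruct HGG as [w [Hw _]]. apply Hg in Hw. pose proof (Rabs_pos (fst w)). lra.
      * destruct Hz as [t [Ht ->]]. unfold seg; simpl.
        assert (B1 := an_A_bound _ _ _ _ H q Aq). assert (B2 := an_A_bound _ _ _ _ H c (an_core_A _ _ _ _ H c Hc)).
        apply convex_between; lra.
      * intro Uz. destruct (Hoff z Hz) as [->|Hz'].
        -- apply (an_Um_off _ _ _ _ H c Uz). apply Hc.
        -- apply Hz', cl_incl; auto.
      * exists x; split; auto. apply near_sym; auto.
    + assert (Cz := ray_core _ _ _ _ H G HG s k z Hz).
      split; [eapply ray_side; eauto|]. split; [|split].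
      * apply (an_A_bound _ _ _ _ H), (an_core_A _ _ _ _ H); auto.
      * intro Uz. apply (an_Um_off _ _ _ _ H z Uz). apply Cz.
      * exists z; split; [apply Cz|apply near_refl; lra].
  - intros R. destruct (ray_far _ _ _ _ H G HG g Hg s k R) as [p [Hp Hr]]. eauto.
Qed.

(** Escape paths [Ll] and [Lr] lead from the left and right ends of [B] to the top, and a deep part
    of [B'] is forced to join them. The values [d], [x0] and [W] come from [B], its spike and these
    paths, before [B'] is given. *)
Lemma wide_deep_normalized B m : 0 <= m -> cpt B -> conn B -> subset B upper -> wide B (m + 4 * g + 8) ->
  exists d x0 W, 0 < d /\ forall B' bl br, cpt B' -> conn B' -> subset B' upper ->
    B' bl -> B' br -> fst bl <= x0 - W -> x0 + W <= fst br ->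
    exists L, cpt L /\ conn L /\ subset L B' /\ subset L (deep d) /\ wide L m.
Proof.
  intros Hm HB HBc HBu [tr [tl [Btr [Btl Hw]]]].
  assert (Hg0 : 0 <= g).
  { destruct HGG as [w [Hw' _]]. apply Hg in Hw'. pose proof (Rabs_pos (fst w)). lra. }
  assert (HY := an_Y _ _ _ _ H).
  assert (Ul : upper tl) by auto. assert (Ur : upper tr) by auto.
  (* Up to height [Y], [Ll] stays left of [fst tl + 2 * g + 3] and [Lr] right of
     [fst tr - 2 * g - 3]; as [B] is wider than [m + 4 * g + 8], a continuum of [A] joining them is
     wider than [m]. *)
  destruct (escape _ _ _ _ H G HG HGG g Hg true tl (fst tl + 2 * g + 3)) as [Ll [Ll1 [Ll2 [Ll3 [Ll4 [[bl0 [Ll5 Ll5']] Ll6]]]]]];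
    [apply Ul|simpl; lra|].
  destruct (escape _ _ _ _ H G HG HGG g Hg false tr (- fst tr + 2 * g + 3)) as [Lr [Lr1 [Lr2 [Lr3 [Lr4 [[br0 [Lr5 Lr5']] Lr6]]]]]];
    [apply Ur|simpl; lra|].
  set (Sp := spike_of upper tl).
  assert (HSc : conn Sp) by apply spike_of_conn.
  assert (HSs : subset Sp upper) by apply spike_of_sub.
  assert (Sptl : Sp tl) by (apply spike_of_refl; auto).
  assert (HBS : subset B Sp) by (apply (spike_of_max upper tl B tl); auto).
  destruct (NI Sp HSc HSs) as [M0 HM0].
  destruct (spike_touches_core tl Ul) as [c [Hc Hcl]].
  destruct (cpt_gap (fun z => B z \/ (Ll z \/ Lr z)) (cl Um)) as [e [He Hgap]].
  { apply cpt_union; auto. apply cpt_union; auto. }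
  { apply closed_cl. }
  { intros z [Hz|[Hz|Hz]]; [apply HBu in Hz; apply Hz|apply Ll3; auto|apply Lr3; auto]. }
  (* Half of the gap, because [Xd] is the closure of the [d]-neighbourhood of [cl Um]; at most 1, as
     [arm] requires. *)
  set (d := Rmin (e / 2) 1).
  assert (Hd : 0 < d <= 1) by (unfold d; split; [apply Rmin_glb_lt; lra|apply Rmin_r]).
  assert (Hde : d + d <= e) by (unfold d; pose proof (Rmin_l (e/2) 1); lra).
  set (Nd := fun z => exists x, cl Um x /\ near d z x).
  set (Xd := cl Nd).
  assert (HXavoid : forall z, B z \/ (Ll z \/ Lr z) -> ~ Xd z).
  { intros z Hz Xz. destruct (Xz d) as [q [Hq [x [Hx Hqx]]]]; [lra|].
    apply (Hgap z x Hz); auto. apply (near_le (d + d)); auto. eapply near_trans; eauto. }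
  assert (HXY : forall z, Xd z -> snd z <= Y + 2).
  { intros z Xz. destruct (Xz d) as [q [Hq [x [Hx Hqx]]]]; [lra|].
    apply (clUm_bound _ _ _ _ H) in Hx. apply near_def in Hq, Hqx. lra. }
  assert (HclX : subset (cl Um) Xd).
  { intros z Hz. apply cl_incl. exists z; split; auto. apply near_refl; lra. }
  assert (HXc : conn Xd).
  { apply conn_cl. apply (conn_attach (cl Um)).
    - apply conn_cl, (an_Umc _ _ _ _ H).
    - intros z Hz. exists z; split; auto. apply near_refl; lra.
    - intros z [x [Hx Hzx]]. exists (near d x). split; [apply conn_convex, convex_near|].
      split; [|split].
      + intros w Hw'. exists x; split; auto. apply near_sym; auto.
      + apply near_sym; auto.
      + exists x; split; auto. apply near_refl; lra. }
  set (x0 := fst tl) in *.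
  destruct (int_above (- x0 + Rabs M0 + g + 2)) as [kl [Hkl1 Hkl2]].
  destruct (int_above (x0 + Rabs M0 + g + 2)) as [kr [Hkr1 Hkr2]].
  assert (HM0p := Rle_abs M0). assert (HM0q := Rabs_pos M0).
  (* Beyond the extent [Rabs M0] of the spike, [W] leaves [m + 1] for finding a shallow point near
     an end of [B'], and [2 * g] plus a constant for an arm that stays clear of the spike. *)
  exists d, x0, (Rabs M0 + 2 * g + m + 8). split; [lra|].
  intros B' bl br HB' HB'c HB'u Bbl Bbr Hbl Hbr.
  assert (HB'A : subset B' A) by (intros z Hz; apply HB'u; auto).
  destruct (end_wide_or_shallow B' d true m bl br) as [Hdone|[ql [Bql [Hql1 Hql2]]]]; auto; try lra.
  { simpl; lra. }
  destruct (end_wide_or_shallow B' d false m br bl) as [Hdone|[qr [Bqr [Hqr1 Hqr2]]]]; auto; try lra.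
  { simpl; lra. }
  simpl in Hql1, Hqr1.
  destruct (arm false kl d ql) as [Al [Al1 [Al2 [Al3 [Al4 Al5]]]]]; auto; [simpl; lra|].
  destruct (arm true kr d qr) as [Ar [Ar1 [Ar2 [Ar3 [Ar4 Ar5]]]]]; auto; [simpl; lra|].
  assert (HSp0 : forall z, Sp z -> Rabs (fst z - x0) <= Rabs M0).
  { intros z Hz. assert (B1 := HM0 z tl Hz Sptl). assert (B2 := HM0 tl z Sptl Hz). fold x0 in B1, B2.
    apply Rabs_le; lra. }
  assert (HSd : forall z, Sp z -> ~ B' z).
  { intros z Hz Bz.
    assert (Hsub : subset B' Sp) by (apply (spike_of_max upper tl B' z); auto).
    assert (B1 := HM0 br bl (Hsub br Bbr) (Hsub bl Bbl)). lra. }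
  assert (HAl : forall z, Al z -> fst z < x0 - Rabs M0 - 1).
  { intros z Hz. destruct (Al4 z Hz) as [B1 _]. simpl in B1. lra. }
  assert (HAr : forall z, Ar z -> x0 + Rabs M0 + 1 < fst z).
  { intros z Hz. destruct (Ar4 z Hz) as [B1 _]. simpl in B1. lra. }
  (* [Y1] runs through [B'] from left to right infinity, so it separates the bottom from the top. The
     spike [Sp] joins the bottom to [B] off [Y1], hence [B] is separated from the top by [Xd] and [B']. *)
  set (Y1 := fun z => (Al z \/ B' z) \/ Ar z).
  assert (Y1c : closed Y1) by (apply closed_union; auto; apply closed_union; auto; apply HB').
  assert (Y1n : conn Y1).
  { apply (conn_union _ _ qr); auto. apply (conn_union _ _ ql); auto. }
  set (b0 := (x0, Y + 3)). set (v := (x0, - Y - 1)).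
  assert (Uv : Um v) by (apply (an_bot _ _ _ _ H); unfold v; simpl; lra).
  assert (SY : separates Y1 v b0).
  { apply (strip_separates Y1 v b0 Y); auto.
    - intros z [[Hz|Hz]|Hz]; [apply Al4; auto|apply (an_A_bound _ _ _ _ H); auto|apply Ar4; auto].
    - unfold v; simpl; lra.
    - unfold b0; simpl; lra.
    - intros R. destruct (Al5 (- R)) as [p [Hp Hr]]. exists p. split; [left; left; auto|]. simpl in Hr; lra.
    - intros R. destruct (Ar5 R) as [p [Hp Hr]]. exists p. split; [right; auto|]. auto. }
  assert (Y1cn : ~ Y1 c).
  { assert (Bc : Rabs (fst c - x0) < Rabs M0 + 1).
    { destruct (Hcl 1) as [z [Hz Sz]]; [lra|]. apply HSp0 in Sz. apply Rabs_le_between in Sz.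
      apply near_def in Hz. apply Rabs_def1; lra. }
    apply Rabs_def2 in Bc.
    intros [[Hz|Hz]|Hz]; [apply HAl in Hz; lra| |apply HAr in Hz; lra].
    apply HB'u in Hz. destruct Hz as [_ Hz]. apply Hz, Hc. }
  destruct (Y1c c Y1cn) as [eta [Heta Hball]].
  assert (S1 : separates Y1 tl b0).
  { apply (separates_conn Y1 v b0 tl (fun z => (Um z \/ near eta c z) \/ Sp z)); auto.
    - destruct Hc as [_ Hc2].
      destruct (Hc2 eta Heta) as [u [Hu1 Hu2]]. destruct (Hcl eta Heta) as [w [Hw1 Hw2]].
      apply (conn_union _ _ w); auto. apply (conn_union _ _ u); auto.
      + apply (an_Umc _ _ _ _ H).
      + apply conn_convex, convex_near.
    - intros z [[Hz|Hz]|Hz].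
      + intros [[Yz|Yz]|Yz].
        * destruct (Al4 z Yz) as [_ [_ [E _]]]; auto.
        * apply HB'u in Yz. destruct Yz as [_ Yz]. apply Yz, cl_incl; auto.
        * destruct (Ar4 z Yz) as [_ [_ [E _]]]; auto.
      + apply Hball; auto.
      + assert (Bz := HSp0 z Hz). apply Rabs_le_between in Bz.
        intros [[Yz|Yz]|Yz]; [apply HAl in Yz; lra|apply (HSd z); auto|apply HAr in Yz; lra]. }
  set (Hd' := fun z => B' z /\ deep d z).
  assert (HHk : cpt Hd') by (apply cpt_inter; auto; apply deep_closed).
  assert (HBd : forall z, B' z -> Xd z \/ Hd' z).
  { intros z Hz. destruct (classic (deep d z)) as [D|D]; [right; split; auto|].
    left. apply cl_incl. apply NNPP; intro Hn. apply D. split; auto. intros x Hx1 Hx2. apply Hn. exists x; auto. }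
  (* If no deep piece of [B'] joins the two escape paths [Ll] and [Lr], the deep part splits into two
     parts, neither of which separates [B] from the top together with [Xd]. *)
  destruct (continuum_or_cut Hd' Ll Lr) as [[L [K1 [K2 [K3 [[p [K4 K5]] [q [K6 K7]]]]]]]|[P [P1 [P2 P3]]]]; auto;
    try apply Ll1; try apply Lr1.
  { exists L. split; [|split; [|split; [|split]]]; auto.
    - intros z Hz; apply K3; auto.
    - intros z Hz; apply K3; auto.
    - exists q, p. repeat split; auto.
      assert (E1 := Ll6 p K5). assert (E2 := Lr6 q K7). simpl in E1, E2.
      destruct (an_A_bound _ _ _ _ H p (HB'A p (proj1 (K3 p K4)))) as [_ E3].
      destruct (an_A_bound _ _ _ _ H q (HB'A q (proj1 (K3 q K6)))) as [_ E4].
      specialize (E1 E3). specialize (E2 E4). unfold x0 in *. lra. }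
  exfalso.
  assert (PB : subset P B') by (intros z Hz; apply P1 in Hz; apply Hz).
  destruct P1 as [Q1 [Q2 Q3]].
  assert (HtopX : forall z, Y + 2 < snd z -> ~ Xd z /\ ~ B' z).
  { intros z Hz. split; [intro Xz; apply HXY in Xz; lra|].
    intro Bz. apply HB'A, (an_A_bound _ _ _ _ H) in Bz. lra. }
  assert (Htc : conn (fun z => Y + 2 < snd z)) by apply conn_convex, convex_halfy_gt.
  assert (Hb0 : Y + 2 < snd b0) by (unfold b0; simpl; lra).
  assert (Hnb : ~ Xd b0 /\ ~ B' b0) by auto.
  assert (Hnt : ~ Xd tl /\ ~ B' tl) by (split; [apply HXavoid; auto|apply HSd; auto]).
  assert (HXP : closed (fun z => Xd z \/ P z)) by (apply closed_union; auto; apply closed_cl).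
  assert (HXQ : closed (fun z => Xd z \/ (Hd' z /\ ~ P z))) by (apply closed_union; auto; apply closed_cl).
  apply (union_not_separates (fun z => Xd z \/ P z) (fun z => Xd z \/ (Hd' z /\ ~ P z)) tl b0 (Y + 2)); auto.
  - intros z [Hz|Hz]; [apply HXY; auto|]. apply PB, HB'A, (an_A_bound _ _ _ _ H) in Hz. lra.
  - intros z [Hz|[[Hz _] _]]; [apply HXY; auto|]. apply HB'A, (an_A_bound _ _ _ _ H) in Hz. lra.
  - intros [Hz|Hz]; [tauto|]. apply PB in Hz. tauto.
  - intros [Hz|Hz]; [tauto|]. apply PB in Hz. tauto.
  - intros [Hz|[[Hz _] _]]; tauto.
  - intros [Hz|[[Hz _] _]]; tauto.
  - apply (not_separates_conn _ _ _ (fun z => (B z \/ Lr z) \/ Y + 2 < snd z)); auto.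
    + apply (conn_union _ _ br0); auto. apply (conn_union _ _ tr); auto.
    + intros z Hz [Xz|Pz].
      * destruct Hz as [[Hz|Hz]|Hz]; [apply (HXavoid z); auto|apply (HXavoid z); auto|destruct (HtopX z Hz); auto].
      * destruct Hz as [[Hz|Hz]|Hz].
        -- apply (HSd z); auto.
        -- apply (P3 z); auto.
        -- destruct (HtopX z Hz) as [T1 T2]; apply T2, PB; auto.
  - apply (not_separates_conn _ _ _ (fun z => Ll z \/ Y + 2 < snd z)); auto.
    + apply (conn_union _ _ bl0); auto.
    + intros z Hz [Xz|[Pz Pz']].
      * destruct Hz as [Hz|Hz]; [apply (HXavoid z); auto|destruct (HtopX z Hz); auto].
      * destruct Hz as [Hz|Hz]; [apply Pz', P2; auto|destruct (HtopX z Hz) as [T1 T2]; apply T2, Pz].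
  (* The two sets meet exactly in [Xd], which is connected and unbounded. *)
  - right. split.
    + apply (conn_ext Xd); auto. intro z; tauto.
    + intros R. destruct (clUm_out _ _ _ _ H R) as [z [Z1 Z2]]. exists z. auto 6.
  - apply (separates_mono Y1); auto.
    + apply closed_union; auto.
    + intros z Hz.
      assert (E : Xd z \/ Hd' z).
      { destruct Hz as [[Hz|Hz]|Hz]; auto; left; apply cl_incl; [apply Al4 in Hz|apply Ar4 in Hz]; apply Hz. }
      destruct (classic (P z)); tauto.
    + intros [[Hz|Hz]|[Hz|[[Hz _] _]]]; try tauto. apply PB in Hz; tauto.
    + intros [[Hz|Hz]|[Hz|[[Hz _] _]]]; try tauto. apply PB in Hz; tauto.
Qed.

(** [upper] and [deep d] are invariant, so a continuum wider than [2 * W + 2] can be translated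
    until its ends lie beyond [x0 - W] and [x0 + W]; the surplus 2 absorbs the rounding to an
    integer translation. *)
Lemma wide_deep B m : 0 <= m -> cpt B -> conn B -> subset B upper -> wide B (m + 4 * g + 8) ->
  exists d W, 0 < d /\ forall B', cpt B' -> conn B' -> subset B' upper -> wide B' W ->
    exists L, cpt L /\ conn L /\ subset L B' /\ subset L (deep d) /\ wide L m.
Proof.
  intros Hm HB HBc HBu Hw.
  destruct (wide_deep_normalized B m) as [d [x0 [W [Hd Hmain]]]]; auto.
  exists d, (2 * W + 2). split; auto. intros B' HB' HB'c HB'u [p [q [Bp [Bq Hpq]]]].
  destruct (int_shift (fst q) (x0 - W - 1)) as [n Hn].
  assert (HuT := proj1 (Tinv_sh upper) upper_T).
  destruct (Hmain (fun z => B' (sh (- n) z)) (sh n q) (sh n p)) as [L [L1 [L2 [L3 [L4 [a [b [La [Lb Lab]]]]]]]]].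
  - apply cpt_sh; auto.
  - apply conn_sh; auto.
  - intros z Hz. apply (HuT (- n)%Z). auto.
  - rewrite <- (sh_inv (- n) q) in Bq. rewrite Z.opp_involutive in Bq. exact Bq.
  - rewrite <- (sh_inv (- n) p) in Bp. rewrite Z.opp_involutive in Bp. exact Bp.
  - unfold sh; simpl; lra.
  - unfold sh; simpl; lra.
  - exists (fun z => L (sh n z)). split; [|split; [|split; [|split]]].
    + apply cpt_sh; auto.
    + apply conn_sh; auto.
    + intros z Hz. apply L3 in Hz. rewrite sh_sh, Z.add_opp_diag_r, sh_0 in Hz. auto.
    + intros z Hz. apply (proj1 (Tinv_sh (deep d)) (deep_T d) n). auto.
    + exists (sh (- n) a), (sh (- n) b). rewrite !sh_inv. repeat split; auto. unfold sh; simpl; lra.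
Qed.
End Upper_spikes.

Lemma list_nat_max (l : list nat) : exists N, forall i, In i l -> (i <= N)%nat.
Proof.
  induction l as [|a l [N IH]].
  - exists 0%nat. intros i [].
  - exists (Nat.max a N). intros i [<-|Hi]; [lia|]. apply IH in Hi. lia.
Qed.

Lemma wide_mono S m m' : m' <= m -> wide S m -> wide S m'.
Proof. intros Hm [p [q [H1 [H2 H3]]]]. exists p, q. repeat split; auto; lra. Qed.

Lemma closed_point p : closed (fun z => z = p).
Proof.
  apply (closed_ext (segment p p)); [|apply cpt_segment]. intro z; split.
  - intros [t [_ ->]]. destruct p; unfold seg; simpl. f_equal; ring.
  - intros ->. apply segment_l.
Qed.

Lemma conn_in_quasi K S p : conn S -> subset S K -> S p -> subset S (quasi K p).
Proof.
  intros HS HSK Hp z Hz. split; auto. intros P [P1 [P2 P3]] Pp.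
  assert (E : pred_bool (P p) = pred_bool (P z)).
  { apply (HS (fun w => pred_bool (P w))); auto. intros w Hw.
    destruct (classic (P w)) as [Pw|Pw].
    - destruct (P3 w) as [e [He Hn]]; [tauto|]. exists e; split; auto. intros q Hq Hwq.
      apply pred_bool_iff. split; auto. intros _. apply NNPP; intro. apply (Hn q Hwq). auto.
    - destruct (P2 w Pw) as [e [He Hn]]. exists e; split; auto. intros q Hq Hwq.
      apply pred_bool_iff. specialize (Hn q Hwq). tauto. }
  apply pred_boolP. rewrite <- E. apply pred_boolP; auto.
Qed.

(** * The width of continua on one side of the core *)

Section Width_bound.
Context (Up Um A : pset) (Y : R) (H : annular Up Um A Y).
Notation C := (core Up Um).
Notation upper := (upper Um A).
Notation deep := (deep Um A).
Context (NI : forall S, conn S -> subset S upper -> finite_width S).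
Context (G : pset) (HG : generates G C) (HGG : exists z, G z /\ G (sh (-1) z)).
Context (g : R) (Hg : forall p, G p -> Rabs (fst p) <= g).

Definition spread (d m : R) (p : pt) : Prop :=
  exists L, cpt L /\ conn L /\ subset L (deep d) /\ L p /\ exists q, L q /\ m < Rabs (fst q - fst p).

Lemma spread_T d m n p : spread d m p -> spread d m (sh n p).
Proof.
  intros [L [L1 [L2 [L3 [L4 [q [L5 L6]]]]]]].
  exists (fun z => L (sh (- n) z)). split; [|split; [|split; [|split]]].
  - apply cpt_sh; auto.
  - apply conn_sh; auto.
  - intros z Hz. apply (proj1 (Tinv_sh (deep d)) (deep_T Up Um A Y H d) (- n)%Z). auto.
  - rewrite sh_sh, Z.add_opp_diag_r, sh_0; auto.
  - exists (sh n q). rewrite sh_sh, Z.add_opp_diag_r, sh_0. split; auto.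
    unfold sh; simpl. replace (fst q + IZR n - (fst p + IZR n)) with (fst q - fst p) by ring. auto.
Qed.

(** Semicontinuity of [spread], for the passage to the limit. If no deep connected set through [p]
    reaches distance [m], a compact piece [P] of the deep set contains [p] and stays short of that
    distance; it is isolated from the rest of the deep set, so it captures the deep continua through
    all nearby points. *)
Lemma not_spread_near d m p : A p ->
  (forall L, conn L -> subset L (deep d) -> L p -> forall q, L q -> Rabs (fst q - fst p) < m) ->
  exists e, 0 < e /\ forall q, near e p q -> ~ spread d m q.
Proof.
  intros Ap Hno.
  assert (HD : closed (deep d)) by apply (deep_closed Up Um A Y H).
  destruct (classic (deep d p)) as [Dp|Dp].
  2:{ destruct (HD p Dp) as [e [He Hn]]. exists e; split; auto.
      intros q Hq [L [_ [_ [L3 [L4 _]]]]]. apply (Hn q Hq). auto. }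
  set (E := fun z => m <= side true z - fst p \/ m <= side false z + fst p).
  assert (HE : closed E).
  { apply closed_union.
    - apply closed_ext with (U := fun z => m + fst p <= side true z); [intro; split; lra|apply closed_side_ge].
    - apply closed_ext with (U := fun z => m - fst p <= side false z); [intro; split; lra|apply closed_side_ge]. }
  assert (HEn : forall z, E z <-> m <= Rabs (fst z - fst p)).
  { intro z. unfold E, side, Rabs. destruct Rcase_abs; lra. }
  assert (HK : cpt (fun z => deep d z /\ rect (fst p - Rabs m) (fst p + Rabs m) (- Y) Y z)).
  { apply (cpt_subset (rect (fst p - Rabs m) (fst p + Rabs m) (- Y) Y)); [apply cpt_rect| |intros z [_ Hz]; auto].
    apply closed_inter; auto. apply closed_rect. }
  destruct (continuum_or_cut _ (fun z => z = p) E HK (closed_point p) HE)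
    as [[L [L1 [L2 [L3 [[q [L4 ->]] [w [L5 L6]]]]]]]|[P [[P1 [P2 P3]] [P4 P5]]]].
  - exfalso. apply HEn in L6. assert (Hw := Hno L L2). assert (Rabs (fst w - fst p) < m); [|lra].
    apply Hw; auto. intros z Hz. apply L3; auto.
  - set (Q := fun z => ((deep d z /\ rect (fst p - Rabs m) (fst p + Rabs m) (- Y) Y z) /\ ~ P z) \/ (deep d z /\ E z)).
    assert (HQ : closed Q) by (apply closed_union; auto; apply closed_inter; auto).
    assert (HP : cpt P) by (apply (cpt_subset _ _ HK); auto).
    assert (HPE : forall z, P z -> ~ E z) by (intros z Hz Ez; apply (P5 z); auto).
    destruct (cpt_gap P E HP HE HPE) as [e1 [He1 N1]].
    destruct (cpt_gap P Q HP HQ) as [e2 [He2 N2]].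
    { intros z Hz [[_ Q1]|[_ Q1]]; auto. apply (HPE z); auto. }
    assert (HDPQ : forall z, deep d z -> P z \/ Q z).
    { intros z Hz. destruct (classic (E z)) as [Ez|Ez]; [right; right; auto|].
      destruct (classic (P z)) as [Pz|Pz]; auto. right; left. split; auto. split; auto.
      assert (By := an_A_bound _ _ _ _ H z (proj1 Hz)). rewrite HEn in Ez. apply Rnot_le_lt in Ez.
      pose proof (Rle_abs m). apply Rabs_def2 in Ez. split; lra. }
    assert (Pp : P p).
    { apply P4; auto. split; auto. pose proof (Rabs_pos m).
      split; [lra|]. apply (an_A_bound _ _ _ _ H p Ap). }
    exists (Rmin e1 e2). split; [apply Rmin_glb_lt; auto|].
    intros q Hq [L [L1 [L2 [L3 [L4 [r [L5 L6]]]]]]].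
    assert (HPQd : forall z, P z -> ~ Q z) by (intros z Hz; apply (N2 z z Hz); apply near_refl; auto).
    assert (Pq : P q).
    { destruct (HDPQ q (L3 q L4)); auto. exfalso. apply (N2 p q Pp); auto. eapply near_min_r; eauto. }
    assert (Pr : P r).
    { apply NNPP; intro Pr. apply (conn_no_clopen L (fun z => L z /\ P z) q r); auto; [|tauto].
      split; [intros z [Hz _]; auto|]. split.
      - apply closed_inter; auto. apply L1.
      - apply closed_ext with (U := fun z => L z /\ Q z).
        + intro z; split.
          * intros [Lz Qz]; split; auto. intros [_ Pz]. apply (HPQd z); auto.
          * intros [Lz Hz]; split; auto. destruct (HDPQ z (L3 z Lz)); auto. tauto.
        + apply closed_inter; auto. apply L1. }
    apply near_min_l, near_def in Hq. destruct Hq as [Hq _].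
    (* Points of [P] keep distance [e1] from [E], which compensates for measuring from [q] instead
       of [p]. *)
    assert (Hsh : forall t, Rabs t < e1 -> Rabs (fst r + t - fst p) < m).
    { intros t Ht. apply Rnot_le_lt; intro Hge.
      apply (N1 r (fst r + t, snd r) Pr).
      - split; simpl; [replace (fst r + t - fst r) with t by ring; auto|rewrite Rminus_diag, Rabs_R0; auto].
      - apply HEn; simpl; auto. }
    assert (Ht : Rabs (fst p - fst q) < e1) by (apply Rabs_def1; lra).
    specialize (Hsh _ Ht). replace (fst r + (fst p - fst q) - fst p) with (fst r - fst q) in Hsh by ring. lra.
Qed.

Lemma upper_width_bound : exists W, forall B, cpt B -> conn B -> subset B upper -> ~ wide B W.
Proof.
  apply NNPP; intro Hno.
  assert (Hbig : forall W, exists B, cpt B /\ conn B /\ subset B upper /\ wide B W).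
  { intros W. apply NNPP; intro Hn. apply Hno. exists W. intros B H1 H2 H3 H4. apply Hn. exists B; auto. }
  assert (Hstep : forall m, exists dW : R * R, 0 < fst dW /\ forall B', cpt B' -> conn B' -> subset B' upper ->
      wide B' (snd dW) -> exists L, cpt L /\ conn L /\ subset L B' /\ subset L (deep (fst dW)) /\ wide L m).
  { intros m. destruct (Hbig (Rmax m 0 + 4 * g + 8)) as [B [B1 [B2 [B3 B4]]]].
    destruct (wide_deep Up Um A Y H NI G HG HGG g Hg B (Rmax m 0)) as [d [W [Hd Hm]]]; auto; [apply Rmax_r|].
    exists (d, W). simpl. split; auto. intros B' C1 C2 C3 C4.
    destruct (Hm B' C1 C2 C3 C4) as [L [L1 [L2 [L3 [L4 L5]]]]]. exists L.
    split; [auto|]. split; [auto|]. split; [auto|]. split; [auto|].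
    eapply wide_mono; [|exact L5]. apply Rmax_l. }
  pose (F := fun m => proj1_sig (constructive_indefinite_description _ (Hstep m))).
  assert (HF : forall m, 0 < fst (F m) /\ forall B', cpt B' -> conn B' -> subset B' upper ->
      wide B' (snd (F m)) -> exists L, cpt L /\ conn L /\ subset L B' /\ subset L (deep (fst (F m))) /\ wide L m).
  { intro m. exact (proj2_sig (constructive_indefinite_description _ (Hstep m))). }
  clearbody F. clear Hstep.
  (* Each width feeds the next step down: a continuum in [upper] wider than [m (S i)] contains a
     continuum wider than [m i] in [deep (fst (F (m i)))]. The lower bound by [INR] makes the widths
     unbounded. *)
  pose (m := fix m (i : nat) : R := match i with O => 0 | S i => Rmax (snd (F (m i))) (INR (S i)) end).
  assert (Hm : forall i, INR i <= m i) by (intros [|i]; [simpl; lra|apply Rmax_r]).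
  (* The witness is a point common to all nested pieces; from any point of a piece wider than [m k],
     one of two far apart points is at distance more than [m k / 2]. *)
  assert (Hchain : forall i B, cpt B -> conn B -> subset B upper -> wide B (snd (F (m i))) ->
     exists p, B p /\ forall k, (k <= i)%nat -> spread (fst (F (m k))) (m k / 2) p).
  { assert (Hsp : forall L k p, cpt L -> conn L -> subset L (deep (fst (F (m k)))) -> wide L (m k) -> L p ->
               spread (fst (F (m k))) (m k / 2) p).
    { intros L k p L1 L2 L3 [a [b [La [Lb Lab]]]] Lp. exists L. split; [|split; [|split; [|split]]]; auto.
      destruct (Rlt_dec (m k / 2) (Rabs (fst a - fst p))) as [|Na]; [exists a; auto|].
      exists b; split; auto. revert Na. unfold Rabs; repeat destruct Rcase_abs; lra. }
    induction i as [|i IH]; intros B B1 B2 B3 B4.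
    - destruct (HF (m 0%nat)) as [_ HF0]. destruct (HF0 B B1 B2 B3 B4) as [L [L1 [L2 [L3 [L4 L5]]]]].
      assert (L5' := L5). destruct L5' as [a [_ [La _]]]. exists a; split; auto.
      intros k Hk. replace k with 0%nat by lia. apply (Hsp L); auto.
    - destruct (HF (m (S i))) as [Hd HF0]. destruct (HF0 B B1 B2 B3 B4) as [L [L1 [L2 [L3 [L4 L5]]]]].
      destruct (IH L) as [p [Lp Hp]]; auto.
      + intros z Hz. apply (deep_upper Um A (fst (F (m (S i))))); auto.
      + eapply wide_mono; [|exact L5]. apply Rmax_l.
      + exists p; split; auto. intros k Hk. destruct (Nat.eq_dec k (S i)) as [->|]; [apply (Hsp L); auto|].
        apply Hp; lia. }
  (* Compactness of a fundamental domain of [A]: otherwise finitely many levels, all at most [N],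
     would exclude every point, against [Hchain] at level [N]. *)
  assert (Hall : exists p, A p /\ forall k, exists L q, conn L /\ subset L (deep (fst (F (m k)))) /\ L p /\ L q /\
                  m k / 2 <= Rabs (fst q - fst p)).
  { apply NNPP; intro Hn.
    pose (U := fun (k : nat) p => exists e, 0 < e /\ forall q, near e p q -> ~ spread (fst (F (m k))) (m k / 2) q).
    destruct (cpt_cover (fun p => rect 0 1 (- Y) Y p /\ A p)) with (J := nat) (F := U) as [l Hl].
    - apply cpt_inter; [apply cpt_rect|apply (closed_A _ _ _ _ H)].
    - intros k p [e [He Hk]]. exists (e/2). split; [lra|]. intros q Hq. exists (e/2). split; [lra|].
      intros r Hr. apply Hk. replace e with (e/2+e/2) by lra. eapply near_trans; eauto.
    - intros p [_ Ap]. apply NNPP; intro HU. apply Hn. exists p; split; auto. intro k.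
      apply NNPP; intro Hk. apply HU. exists k. apply not_spread_near; auto.
      intros L L1 L2 L3 q Lq. apply Rnot_le_lt; intro. apply Hk. exists L, q; auto.
    - destruct (list_nat_max l) as [N HN].
      destruct (Hbig (snd (F (m N)))) as [B [B1 [B2 [B3 B4]]]].
      destruct (Hchain N B B1 B2 B3 B4) as [p [Bp Hp]].
      destruct (int_shift (fst p) 0) as [n Hsh].
      destruct (Hl (sh n p)) as [k [Hk [e [He Hk']]]].
      + assert (Ap : A (sh n p)).
        { apply (proj1 (proj1 (Tinv_sh A) (Tinv_A _ _ _ _ H) n p)). apply B3; auto. }
        split; auto. split; [unfold sh; simpl; lra|apply (an_A_bound _ _ _ _ H); auto].
      + apply (Hk' (sh n p)); [apply near_refl; auto|]. apply spread_T, Hp. auto. }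
  destruct Hall as [p [Ap Hall]].
  assert (HSp : finite_width (spike_of upper p)) by (apply NI; [apply spike_of_conn|apply spike_of_sub]).
  destruct HSp as [M HM].
  destruct (nat_above (2 * Rabs M + 1)) as [k Hk].
  destruct (Hall k) as [L [q [L1 [L2 [L3 [L4 L5]]]]]].
  destruct (HF (m k)) as [Hd _].
  assert (Lu : subset L upper) by (intros z Hz; apply (deep_upper Um A _ Hd); auto).
  assert (Sq : spike_of upper p q) by (exists L; auto).
  assert (Spp : spike_of upper p p) by (exists L; auto).
  assert (B1 := HM p q Spp Sq). assert (B2 := HM q p Sq Spp). specialize (Hm k).
  pose proof (Rle_abs M). revert L5. unfold Rabs at 1; destruct Rcase_abs; lra.
Qed.
End Width_bound.

(* The generator is the component of a core point in the part of [A] inside a large box. *)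
Lemma generates_of_bounded_width Up Um A Y G g W : annular Up Um A Y ->
  generates G (core Up Um) -> (forall p, G p -> Rabs (fst p) <= g) -> 0 < W ->
  (forall B, cpt B -> conn B -> subset B (fun p => A p /\ off Um p) -> ~ wide B W) ->
  (forall B, cpt B -> conn B -> subset B (fun p => A p /\ off Up p) -> ~ wide B W) ->
  exists G', generates G' A.
Proof.
  intros H HG Hg HW Hu Hl.
  assert (HAcl := closed_A _ _ _ _ H).
  assert (HAT := proj1 (Tinv_sh A) (Tinv_A _ _ _ _ H)).
  assert (HCT := proj1 (Tinv_sh (core Up Um)) (Tinv_core _ _ _ _ H)).
  assert (HCA := an_core_A _ _ _ _ H).
  (* Every point is joined to the core within [W + 1]: a continuum going that far off the core would
     lie on one side and be too wide, and a compact clopen piece of [A] around [p] cannot avoid the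
     core. *)
  assert (Hlocal : forall p, A p -> exists L c, cpt L /\ conn L /\ subset L A /\ L p /\ L c /\ core Up Um c /\
                     forall z, L z -> Rabs (fst z - fst p) <= W + 1).
  { intros p Ap.
    set (R0 := rect (fst p - (W + 1)) (fst p + (W + 1)) (- Y) Y).
    set (E := fun z => core Up Um z \/ (W + 1 + fst p <= side true z \/ W + 1 - fst p <= side false z)).
    assert (HE : closed E).
    { apply closed_union; [apply closed_core|]. apply closed_union; apply closed_side_ge. }
    assert (HK : cpt (fun z => R0 z /\ A z)) by (apply cpt_inter; auto; apply cpt_rect).
    assert (Kp : R0 p).
    { split; [lra|]. apply (an_A_bound _ _ _ _ H p Ap). }
    destruct (continuum_or_cut _ (fun z => z = p) E HK (closed_point p) HE)
      as [[L [L1 [L2 [L3 [[q [L4 ->]] [w [L5 L6]]]]]]]|[P [[P1 [P2 P3]] [P4 P5]]]].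
    - destruct (classic (exists c, L c /\ core Up Um c)) as [[c [Lc Cc]]|Hnc].
      + exists L, c. repeat split; auto; try apply L1; try apply Cc.
        * intros z Hz. apply L3; auto.
        * intros z Hz. destruct (L3 z Hz) as [[B _] _]. apply Rabs_le; lra.
      + exfalso.
        assert (Hwide : wide L W).
        { destruct L6 as [L6|L6]; [exfalso; eauto|]. unfold side in L6.
          destruct (L3 p L4) as [[B1 _] _]. destruct L6; [exists w, p|exists p, w]; repeat split; auto; lra. }
        assert (Hside : forall z, L z -> off Um z \/ off Up z).
        { intros z Hz. destruct (an_trichotomy Up Um z) as [T1|[T1|T1]]; auto. exfalso; eauto. }
        assert (Hloc : locc L (fun z => pred_bool (off Um z))).
        { intros z Hz. destruct (Hside z Hz) as [T1|T1].
          - destruct (opn_off Um z T1) as [e [He Hn]]. exists e; split; auto. intros r _ Hr.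
            apply pred_bool_iff. split; auto.
          - destruct (opn_off Up z T1) as [e [He Hn]]. exists e; split; auto. intros r _ Hr.
            specialize (Hn r Hr). apply pred_bool_iff.
            split; intro T2; exfalso; [destruct (an_cover _ _ _ _ H r)|destruct (an_cover _ _ _ _ H z)]; auto. }
        assert (Hc : forall z, L z -> pred_bool (off Um p) = pred_bool (off Um z)).
        { intros z Hz. apply (L2 (fun z => pred_bool (off Um z))); auto. }
        destruct (classic (off Um p)) as [T1|T1].
        * apply (Hu L); auto. intros z Hz. split; [apply L3; auto|].
          apply pred_boolP. rewrite <- (Hc z Hz). apply pred_boolP; auto.
        * apply (Hl L); auto. intros z Hz. split; [apply L3; auto|].
          destruct (Hside z Hz) as [T2|T2]; auto. exfalso. apply T1.
          apply pred_boolP. rewrite (Hc z Hz). apply pred_boolP; auto.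
    - exfalso. destruct (an_core_at _ _ _ _ H 0) as [c [Hc _]].
      destruct (cpt_clopen_translates Up Um A Y H P) with (p := c) as [n Hn]; auto.
      + apply (cpt_subset _ _ HK); auto.
      + split; [|split]; auto.
        * intros z Hz. apply P1 in Hz. apply Hz.
        * apply closed_ext with (U := fun z => ((R0 z /\ A z) /\ ~ P z) \/
             (A z /\ (W + 1 + fst p <= side true z \/ W + 1 - fst p <= side false z))).
          -- intro z; split.
             ++ intros [[[_ Z1] Z2]|[Z1 Z2]]; split; auto. intro Pz. apply (P5 z); auto. right; auto.
             ++ intros [Z1 Z2]. destruct (classic (R0 z)) as [Rz|Rz]; auto. right; split; auto.
                apply NNPP; intro Hn. apply Rz. unfold side in Hn.
                split; [lra|]. apply (an_A_bound _ _ _ _ H z Z1).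
          -- apply closed_union; auto. apply closed_inter; auto. apply closed_union; apply closed_side_ge.
      + exists p. apply P4; auto.
      + apply (P5 (sh (- n) c)); auto. left. apply (HCT (- n)%Z c); auto. }
  destruct HG as [G1 [G2 [G3 G4]]].
  destruct (an_core_at _ _ _ _ H 0) as [c1 [Hc1 _]]. destruct (G4 c1 Hc1) as [n1 Hn1].
  set (c0 := sh (- n1) c1) in *.
  (* A local continuum attached to [G], at a point of abscissa at most [g] in absolute value,
     extends at most [2 * (W + 1)] further. *)
  set (V := g + 2 * (W + 1)).
  set (K := fun z => rect (- V) V (- Y) Y z /\ A z).
  assert (HK : cpt K) by (apply cpt_inter; auto; apply cpt_rect).
  assert (HGK : subset G K).
  { intros z Hz. assert (Az : A z) by auto. split; auto. apply Hg, Rabs_le_between in Hz.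
    split; [unfold V; lra|apply (an_A_bound _ _ _ _ H z Az)]. }
  exists (quasi K c0). split; [|split; [|split]].
  - apply (cpt_subset K); auto; [apply closed_quasi, HK|intros z [Hz _]; auto].
  - apply conn_quasi; auto.
  - intros z [[_ Hz] _]; auto.
  - intros p Ap. destruct (Hlocal p Ap) as [L [c [L1 [L2 [L3 [L4 [L5 [L6 L7]]]]]]]].
    destruct (G4 c L6) as [n Hn]. exists n.
    assert (E : forall z, sh n (sh (- n) z) = z) by (intro; apply sh_inv).
    apply (conn_in_quasi K (fun z => G z \/ L (sh n z))).
    + apply (conn_union _ _ (sh (- n) c)); auto; [apply conn_sh; auto|]. rewrite E; auto.
    + intros z [Hz|Hz]; auto.
      assert (Az : A z) by (apply (HAT n); auto). split; auto.
      split; [|apply (an_A_bound _ _ _ _ H z Az)].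
      apply Hg, Rabs_le_between in Hn. apply L7 in L5, Hz. apply Rabs_le_between in L5, Hz.
      unfold sh in *; simpl in *. rewrite opp_IZR in Hn. unfold V. lra.
    + left; auto.
    + right. rewrite E; auto.
Qed.

(** * The annulus *)

Definition mirror (p : pt) : pt := (fst p, - snd p).
Definition mirrored (S : pset) : pset := fun p => S (mirror p).

Lemma mirror_mirror p : mirror (mirror p) = p.
Proof. destruct p; unfold mirror; simpl. f_equal; ring. Qed.

Lemma mirror_near e p q : near e (mirror p) (mirror q) <-> near e p q.
Proof. rewrite !near_def. unfold mirror; simpl. split; intros; lra. Qed.

Lemma opn_mirrored U : opn U -> opn (mirrored U).
Proof.
  intros HU p Hp. destruct (HU _ Hp) as [e [He Hn]]. exists e; split; auto.
  intros q Hq. apply Hn, mirror_near; auto.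
Qed.

Lemma closed_mirrored F : closed F -> closed (mirrored F).
Proof. exact (opn_mirrored (fun p => ~ F p)). Qed.

Lemma conn_mirrored S : conn S -> conn (mirrored S).
Proof.
  intros HS f Hf p q Hp Hq. rewrite <- (mirror_mirror p), <- (mirror_mirror q).
  apply (HS (fun z => f (mirror z))); auto.
  intros z Hz. destruct (Hf (mirror z)) as [e [He Hn]]; [unfold mirrored; rewrite mirror_mirror; auto|].
  exists e; split; auto. intros w Hw Hzw. apply Hn; [unfold mirrored; rewrite mirror_mirror; auto|].
  apply mirror_near; auto.
Qed.

Lemma cpt_mirrored S : cpt S -> cpt (mirrored S).
Proof.
  intros [H1 [M HM]]; split; [apply closed_mirrored; auto|].
  exists M. intros p Hp. destruct (HM _ Hp) as [A B]. unfold mirror in *; simpl in *.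
  rewrite Rabs_Ropp in B. auto.
Qed.

Lemma cl_mirrored S p : cl (mirrored S) p <-> cl S (mirror p).
Proof.
  split; intros Hc e He.
  - destruct (Hc e He) as [q [Hq HSq]]. exists (mirror q). split; auto. apply mirror_near; auto.
  - destruct (Hc e He) as [q [Hq HSq]]. exists (mirror q). split.
    + apply mirror_near. rewrite mirror_mirror; auto.
    + unfold mirrored. rewrite mirror_mirror; auto.
Qed.

Lemma Tinv_mirrored S : Tinv S -> Tinv (mirrored S).
Proof. intros HS p. exact (HS (mirror p)). Qed.

(** Reflection exchanges the two sides, so the width bound above the core also gives the one
    below. *)
Lemma annular_mirrored Up Um A Y : annular Up Um A Y -> annular (mirrored Um) (mirrored Up) (mirrored A) Y.
Proof.
  intros [O1 O2 C1 C2 T1 T2 Hdisj HA Hdense HY Htop Hbot Hconn].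
  constructor; auto using opn_mirrored, conn_mirrored, Tinv_mirrored.
  - intros p H1 H2. apply (Hdisj (mirror p)); auto.
  - intro p. unfold mirrored. rewrite HA. tauto.
  - intros p e He. destruct (Hdense (mirror p) e He) as [q [Hq Hq']]. exists (mirror q).
    unfold mirrored. rewrite mirror_mirror. split; [|tauto].
    apply mirror_near. rewrite mirror_mirror; auto.
  - intros p Hp. apply Hbot. simpl; lra.
  - intros p Hp. apply Htop. simpl; lra.
  - intros P HP [P1 [P2 P3]] [p0 Hp0] p Hp.
    unfold mirrored in *. rewrite <- (mirror_mirror p).
    apply (Hconn (mirrored P)); auto.
    + apply Tinv_mirrored; auto.
    + split; [|split].
      * intros z Hz. apply P1 in Hz. rewrite mirror_mirror in Hz; auto.
      * apply closed_mirrored; auto.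
      * apply closed_mirrored in P3. eapply closed_ext; [|exact P3].
        intro z; unfold mirrored; simpl. rewrite mirror_mirror. tauto.
    + exists (mirror p0). unfold mirrored. rewrite mirror_mirror; auto.
Qed.

Lemma off_mirrored S p : off (mirrored S) p <-> off S (mirror p).
Proof. unfold off. rewrite cl_mirrored. tauto. Qed.

Lemma wide_mirrored S m : wide S m -> wide (mirrored S) m.
Proof.
  intros [p [q [H1 [H2 H3]]]]. exists (mirror p), (mirror q). unfold mirrored. rewrite !mirror_mirror. auto.
Qed.

Lemma annular_width_bound Up Um A Y G0 : annular Up Um A Y -> generates G0 (core Up Um) ->
  (forall S, conn S -> subset S (upper Um A) -> finite_width S) ->
  exists W, forall B, cpt B -> conn B -> subset B (upper Um A) -> ~ wide B W.
Proof.
  intros H HG0 NI. destruct (chain_generator _ _ _ _ H G0 HG0) as [G [HG HGG]].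
  assert (HB : exists g, forall p, G p -> Rabs (fst p) <= g).
  { destruct HG as [[_ [g Hg]] _]. exists g. intros p Hp. apply Hg; auto. }
  destruct HB as [g Hg]. apply (upper_width_bound Up Um A Y H NI G HG HGG g Hg).
Qed.

Lemma annular_generates Up Um A Y G0 : annular Up Um A Y -> generates G0 (core Up Um) ->
  (forall S, conn S -> subset S (fun p => A p /\ ~ core Up Um p) -> finite_width S) ->
  exists G, generates G A.
Proof.
  intros H HG0 NI.
  assert (H' := annular_mirrored _ _ _ _ H).
  assert (Hcm : forall p, core (mirrored Um) (mirrored Up) p <-> core Up Um (mirror p)).
  { intro p. unfold core. rewrite !cl_mirrored. tauto. }
  assert (HG' : generates (mirrored G0) (core (mirrored Um) (mirrored Up))).
  { destruct HG0 as [G1 [G2 [G3 G4]]]. split; [|split; [|split]].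
    - apply cpt_mirrored; auto.
    - apply conn_mirrored; auto.
    - intros p Hp. apply Hcm, G3; auto.
    - intros p Hp. apply Hcm in Hp. destruct (G4 _ Hp) as [n Hn]. exists n. exact Hn. }
  destruct (annular_width_bound _ _ _ _ _ H HG0) as [W1 HW1].
  { intros S HS HSu. apply NI; auto. intros z Hz. destruct (HSu z Hz) as [Z1 Z2]. split; auto.
    intros [_ C2]; auto. }
  destruct (annular_width_bound _ _ _ _ _ H' HG') as [W2 HW2].
  { intros S HS HSu.
    destruct (NI (mirrored S)) as [M HM].
    - apply conn_mirrored; auto.
    - intros z Hz. destruct (HSu _ Hz) as [Z1 Z2]. unfold mirrored in Z1. rewrite mirror_mirror in Z1.
      split; auto. apply (proj1 (off_mirrored _ _)) in Z2. rewrite mirror_mirror in Z2. intros [C1 _]; auto.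
    - exists M. intros p q Hp Hq. apply (HM (mirror p) (mirror q)); unfold mirrored; rewrite mirror_mirror; auto. }
  destruct HG0 as [G1 G2].
  assert (HB : exists g, forall p, G0 p -> Rabs (fst p) <= g).
  { destruct G1 as [_ [g Hg]]. exists g. intros p Hp. apply Hg; auto. }
  destruct HB as [g Hg].
  apply (generates_of_bounded_width Up Um A Y G0 g (Rmax 1 (Rmax W1 W2))); auto.
  - split; auto.
  - eapply Rlt_le_trans; [apply Rlt_0_1|apply Rmax_l].
  - intros B B1 B2 B3 B4. apply (HW1 B); auto. eapply wide_mono; [|exact B4].
    eapply Rle_trans; [|apply Rmax_r]. apply Rmax_l.
  - intros B B1 B2 B3 B4. apply (HW2 (mirrored B)).
    + apply cpt_mirrored; auto.
    + apply conn_mirrored; auto.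
    + intros z Hz. destruct (B3 _ Hz) as [Z1 Z2]. split; auto. apply off_mirrored; auto.
    + apply wide_mirrored. eapply wide_mono; [|exact B4].
      eapply Rle_trans; [|apply Rmax_r]. apply Rmax_r.
Qed.

(** * Components and closures in the annulus *)

Definition saturation (B : pset) : pset := fun p => exists n, B (sh n p).

Lemma Tinv_saturation B : Tinv (saturation B).
Proof.
  apply Tinv_sh. intros m p. split; intros [n Hn].
  - exists (n - m)%Z. rewrite sh_sh. replace (m + (n - m))%Z with n by lia. auto.
  - exists (m + n)%Z. rewrite sh_sh in Hn. auto.
Qed.

Lemma saturation_incl (B : pset) p : B p -> saturation B p.
Proof. intro Hp. exists 0%Z. rewrite sh_0; auto. Qed.

Lemma openA_saturation B : opn B -> openA (saturation B).
Proof.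
  intro HB. split; [|apply Tinv_saturation]. apply opn_open2, opn_Union.
  intro n. apply opn_sh; auto.
Qed.

(** Opens of the annulus are invariant opens of the plane, and each contains a point of
    [saturation B] exactly when it contains the corresponding point of [B]; so a separation of the
    union would already split [C] or [B]. *)
Lemma connectedA_attach C B p : Tinv C -> connected_in openA C -> conn B -> C p -> B p ->
  connected_in openA (fun z => C z \/ saturation B z).
Proof.
  intros HT HC HB Cp Bp [U [V [HU [HV [Hcov [[a [Sa Ua]] [[b [Sb Vb]] Hd]]]]]]].
  assert (HBc := proj1 (conn_connected B) HB).
  assert (Psat : forall z, B z -> C z \/ saturation B z) by (intros z Hz; right; apply saturation_incl; auto).
  assert (Main : forall U V, openA U -> openA V ->
     (forall z, C z \/ saturation B z -> U z \/ V z) -> (forall z, C z \/ saturation B z -> U z -> V z -> False) ->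
     U p -> forall z, C z \/ saturation B z -> V z -> False).
  { clear U V HU HV Hcov Hd a Sa Ua b Sb Vb. intros U V HU HV Hcov Hd Upp z Hz Vz.
    destruct Hz as [Cz|[n Bz]].
    - apply HC. exists U, V. repeat split; eauto; try apply HU; try apply HV.
    - assert (Vsh : V (sh n z)) by (apply (proj1 (proj1 (Tinv_sh V) (proj2 HV) n z)); auto).
      apply HBc. exists U, V. split; [apply HU|]. split; [apply HV|].
      split; [intros w Hw; apply Hcov; auto|]. split; [exists p; auto|]. split; [exists (sh n z); auto|].
      intros w Hw. apply Hd; auto. }
  destruct (Hcov p (or_introl Cp)) as [Upp|Vpp].
  - apply (Main U V HU HV Hcov Hd Upp b); auto.
  - apply (Main V U HV HU) with (z := a); auto.
    + intros z Hz. destruct (Hcov z Hz); auto.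
    + intros z Hz H1 H2. eapply Hd; eauto.
Qed.

Lemma componentA_absorb X C B p : Tinv X -> componentA X C -> conn B -> subset B X -> C p -> B p -> subset B C.
Proof.
  intros HX [H1 [H2 [H3 [H4 H5]]]] HB HBX Cp Bp z Hz.
  apply (H5 (fun z => C z \/ saturation B z)).
  - intro w. rewrite (H1 w), (Tinv_saturation B w). tauto.
  - intros w [Hw|[n Hw]]; auto. apply (proj2 (proj1 (Tinv_sh X) HX n w)). auto.
  - eapply connectedA_attach; eauto.
  - intros w Hw; auto.
  - right. apply saturation_incl; auto.
Qed.

Lemma connectedA_union (J : Type) (F : J -> pset) p : (forall j, connected_in openA (F j)) -> (forall j, F j p) ->
  connected_in openA (fun z => exists j, F j z).
Proof.
  intros HF Hp [U [V [HU [HV [Hc [[a [[i Sa] Ua]] [[b [[j Sb] Vb]] Hd]]]]]]].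
  destruct (Hc p (ex_intro _ i (Hp i))) as [Hpp|Hpp].
  - apply (HF j). exists U, V. repeat split; try apply HU; try apply HV; eauto.
  - apply (HF i). exists U, V. repeat split; try apply HU; try apply HV; eauto.
Qed.

Lemma componentA_eq X C C' p : componentA X C -> componentA X C' -> C p -> C' p -> forall z, C z <-> C' z.
Proof.
  intros [H1 [H2 [H3 [H4 H5]]]] [K1 [K2 [K3 [K4 K5]]]] Cp C'p.
  set (D := fun z => exists b : bool, (if b then C else C') z).
  assert (D1 : Tinv D).
  { intro z. unfold D. split; intros [[|] Hb].
    - exists true; exact (proj1 (H1 z) Hb).
    - exists false; exact (proj1 (K1 z) Hb).
    - exists true; exact (proj2 (H1 z) Hb).
    - exists false; exact (proj2 (K1 z) Hb). }
  assert (D2 : subset D X) by (intros z [[|] Hz]; auto).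
  assert (D3 : connected_in openA D) by (apply (connectedA_union bool _ p); intros [|]; auto).
  assert (S1 : subset C D) by (intros z Hz; exists true; auto).
  assert (S2 : subset C' D) by (intros z Hz; exists false; auto).
  intro z; split; intro Hz.
  - apply (K5 D); auto.
  - apply (H5 D); auto.
Qed.

Lemma componentA_exists X p : Tinv X -> X p -> exists C, componentA X C /\ C p.
Proof.
  intros HX Hp.
  pose (J := {S | Tinv S /\ subset S X /\ connected_in openA S /\ S p}).
  set (C := fun z => exists j : J, proj1_sig j z).
  assert (CI : forall S z, Tinv S -> subset S X -> connected_in openA S -> S p -> S z -> C z).
  { intros S z H1 H2 H3 H4 Hz. exists (exist _ S (conj H1 (conj H2 (conj H3 H4)))). exact Hz. }
  assert (HO : C p).
  { apply (CI (saturation (fun z => z = p)) p).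
    - apply Tinv_saturation.
    - intros z [n Hz]. apply (proj2 (proj1 (Tinv_sh X) HX n z)). rewrite Hz; auto.
    - intros [U [V [HU [HV [Hc [[a [[n Sa] Ua]] [[b [[m Sb] Vb]] Hd]]]]]]].
      apply (Hd p); [apply saturation_incl; auto| |].
      + rewrite <- Sa. apply (proj1 (proj1 (Tinv_sh U) (proj2 HU) n a)); auto.
      + rewrite <- Sb. apply (proj1 (proj1 (Tinv_sh V) (proj2 HV) m b)); auto.
    - apply saturation_incl; auto.
    - apply saturation_incl; auto. }
  exists C. split; auto. split; [|split; [|split; [|split]]].
  - intro z; split; intros [[S [S1 [S2 [S3 S4]]]] Hz]; simpl in Hz; apply (CI S); auto.
    + exact (proj1 (S1 z) Hz).
    + exact (proj2 (S1 z) Hz).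
  - intros z [[S [S1 [S2 [S3 S4]]]] Hz]. apply S2; auto.
  - exists p; auto.
  - apply (connectedA_union J _ p); intros [S HS]; apply HS.
  - intros D D1 D2 D3 D4 z Hz. apply (CI D); auto.
Qed.

Lemma continuumA_closed A : Tinv A -> compact_in openA A -> closed A.
Proof.
  intros HT HC p Hp.
  assert (HT' := proj1 (Tinv_sh A) HT).
  pose (rc := fun e => rect (fst p - e) (fst p + e) (snd p - e) (snd p + e)).
  (* All translates of a closed square about [p] are removed together, so that what remains is open
     in the annulus. *)
  destruct (HC R (fun e q => 0 < e /\ ~ exists n, True /\ rc e (sh (- n) q))) as [l Hl].
  - intros e. assert (Hc := closed_Union_sh (rc e) (fun _ => True) (cpt_rect _ _ _ _)). split.
    + apply opn_open2. intros q [He Hq]. destruct (Hc q Hq) as [e' [He' Hn]].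
      exists e'; split; auto.
    + apply Tinv_sh. intros m q. split; intros [He Hq]; split; auto; intros [n [_ Hn]]; apply Hq.
      * exists (n - m)%Z. split; auto. rewrite sh_sh in Hn.
        replace (- (n - m))%Z with (m + - n)%Z by lia. auto.
      * exists (n + m)%Z. split; auto. rewrite sh_sh.
        replace (m + - (n + m))%Z with (- n)%Z by lia. auto.
  - intros q Aq.
    assert (Hpt : cpt (fun z => z = q)).
    { apply (cpt_subset (segment q q)); [apply cpt_segment|apply closed_point|]. intros z ->. apply segment_l. }
    destruct (closed_Union_sh (fun z => z = q) (fun _ => True) Hpt p) as [e [He Hn]].
    { intros [n [_ Hn]]. apply Hp. apply (proj2 (HT' (- n)%Z p)). rewrite Hn; auto. }
    exists (e / 2). split; [lra|]. intros [n [_ [Hx Hy]]].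
    apply (Hn (sh (- n) q)); [apply near_def; lra|].
    exists (- n)%Z. split; auto. rewrite sh_sh. replace (- n + - - n)%Z with 0%Z by lia. apply sh_0.
  - destruct (list_pos_min l) as [m [Hm Hmin]]. exists m; split; auto.
    intros q Hq HAq. destruct (Hl q HAq) as [e [He [He0 Hr]]]. specialize (Hmin e He He0).
    apply Hr. exists 0%Z. split; auto. change (- 0)%Z with 0%Z. rewrite sh_0.
    apply near_def in Hq. split; lra.
Qed.

Lemma continuumA_bounded A : compact_in openA A -> exists Y, 0 < Y /\ forall p, A p -> - Y < snd p < Y.
Proof.
  intros HC.
  destruct (HC R (fun e q => - e < snd q < e)) as [l Hl].
  - intros e. split.
    + apply opn_open2. apply opn_ext with (U := fun q => ~ (snd q <= - e) /\ ~ (e <= snd q)).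
      * intro q. lra.
      * apply opn_inter; [apply closed_halfy_le|apply closed_halfy_ge].
    + intro q. unfold T; simpl. tauto.
  - intros q _. exists (Rabs (snd q) + 1). pose proof (Rle_abs (snd q)); pose proof (Rle_abs (- snd q)).
    rewrite Rabs_Ropp in *. lra.
  - destruct (list_max l) as [m [Hm Hmax]]. exists m; split; auto. intros p Hp.
    destruct (Hl p Hp) as [e [He Hr]]. specialize (Hmax e He). lra.
Qed.

Lemma componentA_open X C : Tinv X -> opn X -> componentA X C -> opn C.
Proof.
  intros HT HX HC p Cp. destruct (HX p) as [e [He Hn]]; [apply HC; auto|]. exists e; split; auto.
  apply (componentA_absorb X C (near e p) p); auto; [apply conn_convex, convex_near|apply near_refl; auto].
Qed.

(* The half-plane [Hf] meets all its translates, so its component in the plane is [T]-invariant. *)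
Lemma componentA_conn X C (Hf : pset) b : Tinv X -> opn X -> componentA X C -> conn Hf -> Tinv Hf ->
  subset Hf C -> Hf b -> conn C.
Proof.
  intros HT HX HC Hfc HfT HfC Hb.
  assert (CT : forall n p, C p <-> C (sh n p)) by exact (proj1 (Tinv_sh C) (proj1 HC)).
  assert (CO := componentA_open X C HT HX HC).
  set (Q := spike_of C b).
  assert (Qs : subset Q C) by apply spike_of_sub.
  assert (Qc : conn Q) by apply spike_of_conn.
  assert (Qb : Q b) by (apply spike_of_refl; auto).
  assert (HfQ : subset Hf Q) by (apply (spike_of_max C b Hf b); auto).
  assert (Qball : forall p, C p -> exists e, 0 < e /\ forall q, near e p q -> C q /\ (Q p <-> Q q)).
  { intros p Cp. destruct (CO p Cp) as [e [He Hn]]. exists e; split; auto. intros q Hq. split; auto.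
    assert (Hmax : forall z, near e p z -> Q z -> subset (near e p) Q).
    { intros z Hz Qz. apply (spike_of_max C b (near e p) z); auto. apply conn_convex, convex_near. }
    split; intro; [apply (Hmax p)|apply (Hmax q)]; auto; apply near_refl; auto. }
  assert (QT : forall n p, Q p -> Q (sh n p)).
  { intros n p Qp.
    assert (HS : subset (fun z => Q (sh (- n) z)) Q).
    { apply (spike_of_max C b _ b); auto.
      - apply conn_sh; auto.
      - intros z Hz. apply (CT (- n)%Z). auto.
      - apply HfQ. apply (proj1 (proj1 (Tinv_sh Hf) HfT (- n)%Z b)); auto. }
    apply HS. rewrite sh_sh, Z.add_opp_diag_r, sh_0; auto. }
  assert (QT' : Tinv Q).
  { apply Tinv_sh. intros n p; split; [apply QT|]. intro Qp. apply (QT (- n)%Z) in Qp.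
    rewrite sh_sh, Z.add_opp_diag_r, sh_0 in Qp; auto. }
  apply (conn_between Q); auto. intros p Cp. apply cl_incl. apply NNPP; intro Qp.
  destruct HC as [C1 [C2 [C3 [C4 C5]]]]. apply C4.
  exists Q, (fun z => C z /\ ~ Q z). split; [|split; [|split; [|split; [|split]]]].
  - split; auto. apply opn_open2. intros z Qz. destruct (Qball z) as [e [He Hn]]; auto.
    exists e; split; auto. intros q Hq. apply (Hn q Hq); auto.
  - split.
    + apply opn_open2. intros z [Cz Qz]. destruct (Qball z) as [e [He Hn]]; auto.
      exists e; split; auto. intros q Hq. destruct (Hn q Hq) as [N1 N2]. tauto.
    + intro z. rewrite (QT' z), (C1 z). tauto.
  - intros z Cz. destruct (classic (Q z)); auto.
  - exists b; auto.
  - exists p; auto.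
  - intros z _ H1 [_ H2]; auto.
Qed.

(** An invariant set meets a ball as soon as it meets a translate of that ball. *)
Lemma closure_inA S p : Tinv S -> closure_in openA S p <-> cl S p.
Proof.
  intros HS. split.
  - intros Hc e He. destruct (Hc (saturation (near e p))) as [q [[n Hq] Sq]].
    + apply openA_saturation, opn_near.
    + apply saturation_incl, near_refl; auto.
    + exists (sh n q). split; auto. apply (proj1 (proj1 (Tinv_sh S) HS n q)); auto.
  - intros Hc U [HU _] Hp. apply opn_open2 in HU. destruct (HU p Hp) as [e [He Hn]].
    destruct (Hc e He) as [q [Hq Sq]]. exists q; auto.
Qed.

(** The passage from the annulus to the plane: maximality makes each component contain its
    half-plane, thinness gives the density of the two components, and connectedness of [A] gives
    [an_conn]. *)
Lemma annular_of_essential A : essential_annular A -> thin A ->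
  exists Up Um Y, annular Up Um A Y /\ forall p, CA A p <-> core Up Um p.
Proof.
  intros [[AT [_ [AC ACn]]] [Up [Um [CU [CM [UA [UB [Hne Hall]]]]]]]] Hthin.
  assert (Acl := continuumA_closed A AT AC).
  destruct (continuumA_bounded A AC) as [Y [HY HAY]].
  assert (XT : Tinv (complA A)) by (intro p; unfold complA; rewrite (AT p); tauto).
  assert (XO : opn (complA A)) by exact Acl.
  assert (Htop : forall C, componentA (complA A) C -> unb_above C -> subset (fun p => Y < snd p) C).
  { intros C HC HU. destruct (HU Y) as [p [Cp Hp]].
    apply (componentA_absorb (complA A) C _ p); auto; [apply conn_convex, convex_halfy_gt|].
    intros z Hz Az. apply HAY in Az. lra. }
  assert (Hbot : forall C, componentA (complA A) C -> unb_below C -> subset (fun p => snd p < - Y) C).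
  { intros C HC HU. destruct (HU (- Y)) as [p [Cp Hp]].
    apply (componentA_absorb (complA A) C _ p); auto; [apply conn_convex, convex_halfy_lt|].
    intros z Hz Az. apply HAY in Az. lra. }
  assert (HUp := Htop Up CU UA). assert (HUm := Hbot Um CM UB).
  assert (Hd : forall p, Up p -> Um p -> False).
  { intros p H1 H2. apply Hne. apply (componentA_eq (complA A) Up Um p); auto. }
  assert (HA : forall p, A p <-> ~ Up p /\ ~ Um p).
  { intro p. split.
    - intro Ap. split; intro Hp; [apply (proj1 (proj2 CU)) in Hp|apply (proj1 (proj2 CM)) in Hp]; contradiction.
    - intros [H1 H2]. apply NNPP; intro Ap.
      destruct (componentA_exists (complA A) p XT Ap) as [C [HC Cp]].
      destruct (Hall C HC) as [E|E]; apply E in Cp; contradiction. }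
  assert (HT1 : Tinv Up) by apply CU. assert (HT2 : Tinv Um) by apply CM.
  exists Up, Um, Y. split.
  - constructor; auto.
    + apply (componentA_open (complA A)); auto.
    + apply (componentA_open (complA A)); auto.
    + apply (componentA_conn (complA A) Up (fun p => Y < snd p) (0, Y + 1)); auto.
      * apply conn_convex, convex_halfy_gt.
      * intro p; unfold T; simpl; tauto.
      * simpl; lra.
    + apply (componentA_conn (complA A) Um (fun p => snd p < - Y) (0, - Y - 1)); auto.
      * apply conn_convex, convex_halfy_lt.
      * intro p; unfold T; simpl; tauto.
      * simpl; lra.
    + intros p e He. apply NNPP; intro Hn.
      apply (Hthin (saturation (near e p)) (openA_saturation _ (opn_near e p))) with (p := p).
      * intros z [n Hz]. apply (proj2 (proj1 (Tinv_sh A) AT n z)). apply HA.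
        split; intro Hz'; apply Hn; eauto.
      * apply saturation_incl, near_refl; auto.
    + intros P PT [P1 [P2 P3]] [p0 Pp0] p Ap. apply NNPP; intro Pp.
      apply ACn. exists (fun z => ~ (A z /\ ~ P z)), (fun z => ~ P z).
      split; [|split; [|split; [|split; [|split]]]].
      * split; [apply opn_open2; exact P3|]. intro z. rewrite (AT z), (PT z). tauto.
      * split; [apply opn_open2; exact P2|]. intro z. rewrite (PT z). tauto.
      * intros z Az. destruct (classic (P z)); tauto.
      * exists p0. split; auto. tauto.
      * exists p; auto.
      * intros z Az H1 H2. tauto.
  - intro p. split.
    + intros [Up' [Um' [CU' [UA' [CM' [UB' [H1 H2]]]]]]].
      assert (E1 : forall z, Up' z <-> Up z).
      { apply (componentA_eq (complA A) Up' Up (0, Y + 1)); auto; [apply (Htop Up')|apply HUp]; auto; simpl; lra. }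
      assert (E2 : forall z, Um' z <-> Um z).
      { apply (componentA_eq (complA A) Um' Um (0, - Y - 1)); auto; [apply (Hbot Um')|apply HUm]; auto; simpl; lra. }
      apply closure_inA in H1; [|apply CU']. apply closure_inA in H2; [|apply CM'].
      split; [eapply cl_mono; [|exact H1]|eapply cl_mono; [|exact H2]]; intros z Hz; [apply E1|apply E2]; auto.
    + intros [H1 H2]. exists Up, Um. repeat split; auto; try apply CU; try apply CM;
      apply closure_inA; auto.
Qed.

Lemma compactly_generated_generates S : Tinv S -> (compactly_generated S <-> exists G, generates G S).
Proof.
  intros HS.
  assert (E : forall n p, (fst p - IZR n, snd p) = sh (- n) p).
  { intros n p. unfold sh. rewrite opp_IZR. reflexivity. }
  split.
  - intros [G [G1 [G2 [G3 G4]]]]. exists G. split; [apply cpt_compact; auto|]. split; [apply conn_connected; auto|].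
    split; auto. intros p Hp. apply G4 in Hp. destruct Hp as [n Hn]. exists n. rewrite <- E; auto.
  - intros [G [G1 [G2 [G3 G4]]]]. exists G. split; auto. split; [apply cpt_compact; auto|].
    split; [apply conn_connected; auto|]. intro p; split.
    + intros Hp. destruct (G4 p Hp) as [n Hn]. exists n. rewrite E; auto.
    + intros [n Hn]. rewrite E in Hn. apply (generates_incl G S (- n)); auto.
Qed.

Lemma generates_ext G S S' : (forall p, S p <-> S' p) -> generates G S -> generates G S'.
Proof.
  intros E [G1 [G2 [G3 G4]]]. split; auto. split; auto. split.
  - intros p Hp. apply E; auto.
  - intros p Hp. apply G4, E; auto.
Qed.

Lemma spike_of_spike A p : A p -> ~ CA A p -> spike A (spike_of (fun z => A z /\ ~ CA A z) p).
Proof.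
  intros Ap Cp. set (D := fun z => A z /\ ~ CA A z).
  assert (Hp : spike_of D p p) by (apply spike_of_refl; split; auto).
  split; [|split; [|split]].
  - apply spike_of_sub.
  - exists p; auto.
  - apply conn_connected, spike_of_conn.
  - intros E E1 E2 E3. apply (spike_of_max D p E p); auto. apply conn_connected; auto.
Qed.

Theorem mainTheorem3 (A : pset) :
  essential_annular A -> thin A ->
  (~ compactly_generated A ->
     ~ compactly_generated (CA A) \/
     (compactly_generated (CA A) /\ exists S, spike A S /\ infinite_width S)) /\
  (compactly_generated A -> compactly_generated (CA A)).
Proof.
  intros HE HT. destruct (annular_of_essential A HE HT) as [Up [Um [Y [H HC]]]].
  assert (AT := Tinv_A _ _ _ _ H).
  assert (CT : Tinv (CA A)).
  { intro p. rewrite !HC. apply (Tinv_core _ _ _ _ H). }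
  rewrite !compactly_generated_generates by auto. split.
  - intros HnA. destruct (classic (exists G, generates G (CA A))) as [[G HG]|]; [right|left; auto].
    (* Without an infinite spike every connected set off the core has finite width, and the
       generator of the core yields one of [A]. *)
    split; [eauto|]. apply NNPP; intro Hno. apply HnA.
    apply (annular_generates Up Um A Y G H).
    + apply (generates_ext G (CA A)); auto.
    + intros S HS HSu.
      destruct (classic (exists p, S p)) as [[p Hp]|Hem].
      2:{ exists 0. intros p q Hp. exfalso; eauto. }
      set (D := fun z => A z /\ ~ CA A z).
      assert (HSD : subset S D).
      { intros z Hz. destruct (HSu z Hz) as [Z1 Z2]. split; auto. rewrite HC; auto. }
      assert (Hsub : subset S (spike_of D p)).
      { apply (spike_of_max D p S p); auto. apply spike_of_refl; auto. }
      apply NNPP; intro Hinf. apply Hno. exists (spike_of D p).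
      split; [apply spike_of_spike; apply (HSD p Hp)|].
      intros M. apply NNPP; intro HM. apply Hinf. exists M. intros a b Ha Hb.
      apply Rnot_lt_le; intro Hlt. apply HM. exists a, b. auto.
  - intros [G [G1 [G2 [G3 G4]]]]. exists (fun p => G p /\ CA A p).
    assert (E : forall p, (G p /\ core Up Um p) <-> (G p /\ CA A p)) by (intro p; rewrite HC; tauto).
    split; [|split; [|split]].
    + apply cpt_inter; auto. apply (closed_ext (core Up Um)); [intro; symmetry; auto|apply closed_core].
    + apply (conn_ext _ _ E). apply (conn_continuum_core Up Um A Y H); auto.
    + intros p [_ Hp]; auto.
    + intros p Hp. destruct (G4 p) as [n Hn].
      * apply HC in Hp. apply (an_core_A _ _ _ _ H); auto.
      * exists n. split; auto. apply (proj1 (proj1 (Tinv_sh (CA A)) CT (- n)%Z p)); auto.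
Qed.
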